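(* Let $P$ be a probability measure on $\mathbb{R}$ with bounded support, zero mean and unit variance. Then for all $0\le\lambda<\lambda_c$, the (sequences, indexed by $N\to\infty$, of) laws $\mathbb P_\lambda$ and $\mathbb P_0$ are mutually contiguous.
   Context: Model. For $\lambda\ge 0$ and $N\ge1$, let $x^*_1,\dots,x^*_N$ be i.i.d. from $P$, let $W_{ij}$ ($1\le i<j\le N$) be i.i.d. $\mathcal N(0,1)$ independent of the $x_i^*$, and $Y_{ij}=\sqrt{\lambda/N}\,x_i^*x_j^*+W_{ij}$ for $1\le i<j\le N$. $\mathbb{P}_\lambda=\mathbb P_{\lambda}^{(N)}$ is the law of $\boldsymbol Y=(Y_{ij})_{i<j}$ on $\mathbb R^{N(N-1)/2}$. Mutual contiguity means: for every sequence of measurable events $A_N\subseteq\mathbb R^{N(N-1)/2}$, $\mathbb P_\lambda^{(N)}(A_N)\to0$ if and only if $\mathbb P_0^{(N)}(A_N)\to0$. Threshold. For $r\ge0$, $\psi(r)=\mathbb E_{x^*,z}\log\int \exp(\sqrt r zx+rxx^*-\frac r2x^2)\,dP(x)$ with $x^*\sim P$, $z\sim\mathcal N(0,1)$ independent. $F(\lambda,q)=\psi(\lambda q)-\frac{\lambda q^2}{4}$, $\phi_{\mathsf{RS}}(\lambda)=\sup_{q\ge0}F(\lambda,q)$. $\mathcal D$ is the set of $\lambda>0$ at which $\phi_{\mathsf{RS}}$ is differentiable; for $\lambda\in\mathcal D$, $F(\lambda,\cdot)$ has a unique maximizer on $[0,\infty)$ (known result), denoted $q^*(\lambda)$, which is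 non-decreasing in $\lambda\in\mathcal D$. $\lambda_c=\sup\{\lambda>0:\lambda\in\mathcal D,\ q^*(\lambda)=0\}$. *)

(* Defs.v *)
(* Built on MathComp-Analysis, over an arbitrary R : realType. *)
From HB Require Import structures.
From mathcomp Require Export all_boot all_order all_algebra.
From mathcomp Require Export all_classical all_reals all_analysis.
From mathcomp Require Export measurable_realfun.
Export Order.TTheory GRing.Theory Num.Theory.
Export numFieldNormedType.Exports.

Set Implicit Arguments.
Unset Strict Implicit.
Unset Printing Implicit Defensive.

Local Open Scope classical_set_scope.
Local Open Scope ring_scope.

Section iid.
Context d (T : measurableType d) (R : realType).

Definition cons_pair n (z : T * n.-tuple T) : n.+1.-tuple T :=
  [tuple of z.1 :: z.2].

Lemma measurable_cons_pair n : measurable_fun [set: _] (@cons_pair n).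
Proof. exact: measurable_cons measurable_fst measurable_snd. Qed.

HB.instance Definition _ n :=
  isMeasurableFun.Build _ _ _ _ (@cons_pair n) (@measurable_cons_pair n).

(* The n-fold product probability P (x) ... (x) P. *)
Fixpoint iid (P : probability T R) (n : nat) : probability (n.-tuple T) R :=
  match n with
  | 0 => dirac [tuple]
  | n'.+1 => distribution (P \x iid P n')%E (@cons_pair n')
  end.

End iid.

Definition mutually_contiguous (R : realType) (d : nat -> measure_display)
    (T : forall N, measurableType (d N))
    (P Q : forall N, probability (T N) R) : Prop :=
  forall A : forall N, set (T N), (forall N, measurable (A N)) ->
    ((fun N => P N (A N)) @ \oo --> 0%E <-> (fun N => Q N (A N)) @ \oo --> 0%E).

Section spiked_wigner.
Variable R : realType.

(* The index pairs (i, j) with i < j; there are N (N - 1) / 2 of them, so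
   #|edge N|.-tuple R stands for R^(N (N - 1) / 2), with the coordinates
   enumerated by enum_val : 'I_#|edge N| -> 'I_N * 'I_N. *)
Definition edge (N : nat) : {set 'I_N * 'I_N} :=
  [set e : 'I_N * 'I_N | (e.1 < e.2)%N]%SET.

Lemma card_edge N : #|edge N| = 'C(N, 2).
Proof.
rewrite -bin2_sum big_mkord -sum1_card.
rewrite (eq_bigl (fun e : 'I_N * 'I_N => (e.1 < e.2)%N)); last first.
  by move=> e; rewrite inE.
rewrite -(pair_big_dep xpredT (fun i j : 'I_N => (i < j)%N) (fun _ _ => 1%N)) /=.
rewrite (exchange_big_dep xpredT) //=; apply: eq_bigr => j _.
rewrite -(big_ord_widen N (fun=> 1%N) (ltnW (ltn_ord j))).
by rewrite sum1_card card_ord.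
Qed.

(* Y_ij = sqrt (lambda / N) x_i x_j + W_ij, as a function of (x, W). *)
Definition observation (lambda : R) (N : nat)
    (xW : N.-tuple (measurableTypeR R) * #|edge N|.-tuple (measurableTypeR R)) :
    #|edge N|.-tuple (measurableTypeR R) :=
  [tuple Num.sqrt (lambda / N%:R) * tnth xW.1 (enum_val k).1
           * tnth xW.1 (enum_val k).2 + tnth xW.2 k | k < #|edge N|].

Lemma measurable_observation lambda N :
  measurable_fun [set: _] (@observation lambda N).
Proof.
apply/measurable_fun_tnthP => k.
apply: (eq_measurable_fun (fun xW => Num.sqrt (lambda / N%:R)
    * tnth xW.1 (enum_val k).1 * tnth xW.1 (enum_val k).2 + tnth xW.2 k)).
  by move=> xW _ /=; rewrite tnth_mktuple.
apply: measurable_funD; last exact: measurableT_comp (measurable_tnth k) _.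
apply: measurable_funM; last exact: measurableT_comp (measurable_tnth _) _.
apply: measurable_funM; first exact: measurable_cst.
exact: measurableT_comp (measurable_tnth _) _.
Qed.

HB.instance Definition _ lambda N :=
  isMeasurableFun.Build _ _ _ _ (@observation lambda N)
    (@measurable_observation lambda N).

Variable P : probability (measurableTypeR R) R.

(* The law of Y under x_1, ..., x_N i.i.d. of law P and independent i.i.d.
   standard normal W_ij. *)
Definition spiked_law (lambda : R) (N : nat) :
    probability (#|edge N|.-tuple (measurableTypeR R)) R :=
  distribution (iid P N \x iid (normal_prob 0 1) #|edge N|)%E
    (@observation lambda N).

(* xz = (x*, z) has law P (x) N(0, 1). *)
Definition psi (r : R) : R :=
  \int[(P \x normal_prob 0 1)%E]_xz
    ln (\int[P]_x expR (Num.sqrt r * xz.2 * x + r * x * xz.1 - r / 2 * x ^+ 2)).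

Definition rs_potential (lambda q : R) : R :=
  psi (lambda * q) - lambda * q ^+ 2 / 4.

(* For bounded P and lambda >= 0 the set is nonempty and bounded above (by
   lambda / 4 when P has unit variance), so this sup is the genuine one. *)
Definition phi_RS (lambda : R) : R :=
  sup [set rs_potential lambda q | q in [set q | 0 <= q]].

Definition rs_diff_set : set R :=
  [set lambda | 0 < lambda /\ derivable phi_RS lambda 1].

(* is_qstar lambda q states that q*(lambda) is defined and equal to q: q is the
   unique maximizer of rs_potential lambda on [0, +oo[. A relation avoids
   giving q* a default value where the maximizer is not unique. *)
Definition is_qstar (lambda q : R) : Prop :=
  unique (fun q => 0 <= q /\
    forall q', 0 <= q' -> rs_potential lambda q' <= rs_potential lambda q) q.

(* Taken in \bar R: the real-valued sup is 0 on empty or unbounded sets. *)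
Definition lambda_c : \bar R :=
  ereal_sup [set lambda%:E | lambda in
    [set lambda | rs_diff_set lambda /\ is_qstar lambda 0]].

End spiked_wigner.

(* Main.v *)
(** lambda < lambda_c provides lambda' > lambda with psi r <= r ^ 2 / (4 lambda')
    for all r, and lambda' <= 1 because psi r >= (r - ln (1 + r)) / 2. Let L be the
    likelihood ratio of P_lambda to P_0 and S the overlap of two spikes.

    A Gaussian comparison inequality (Kahane) bounds the small fractional moments of the
    part of L due to spikes of overlap about m N with the planted one by those of N
    scalar channels of signal-to-noise ratio lambda |m|. The bound on psi makes them
    exponentially small, so under P_lambda the posterior puts negligible mass on
    |S| > eps N. The second moment of L without these overlaps is bounded since
    lambda < 1, whence P_lambda is contiguous to P_0.

    Conversely log L is convex in Y and its gradient is the posterior mean of the spike.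
    The truncated second moments give a set, of P_0-probability bounded below, on which L is
    bounded below and the gradient is bounded. Dimension-free Gaussian concentration of
    a maximum of tangent planes to log L on that set makes P_0 (L < delta) small with
    delta, uniformly in N, whence P_0 is contiguous to P_lambda. *)

Require Import Defs.
From HB Require Import structures.
From mathcomp Require Import ring lra.
Set Implicit Arguments.
Unset Strict Implicit.
Unset Printing Implicit Defensive.
Local Open Scope classical_set_scope.
Local Open Scope ring_scope.

(** * Taylor bounds *)

(** Why fractional moments: the mean of the part of L with overlap m is dominated by rare events,
    while its moment of order a is expR (a * E ln + O(a ^+ 2)) and so sees the typical size as a
    tends to 0. Since x [^ a is concave, the comparison costs a factor expR (a (1 - a) / 2 k), k
    being the largest excess of covariance. Balance at overlap m N, in units of a N: linearising the
    square gives - lambda m^2 / 2, the comparison gives back lambda m^2 / 4, and the scalar channels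
    give psi (lambda |m|) <= lambda^2 m^2 / (4 lambda'). The sum is negative because lambda <
    lambda'. Passing from a fractional moment to a posterior probability uses Z / L <= exp (- b) / L
    + exp (a b) Z]^ a for Z <= L, where 1 / L has mean one under P_lambda. For the converse, the
    gradient of log L is controlled only on a set of probability bounded below, so Lipschitz
    concentration does not apply to log L itself. Convexity repairs this: the tangent planes taken
    on that set stay below log L everywhere, and their soft maximum has a bounded gradient. *)

Section real_bounds.
Variable R : realType.
Implicit Types x y t : R.

Lemma expR_sub1_le x : expR x - 1 <= x * expR x.
Proof.
have h : 1 - x <= expR (- x) by rewrite expR_ge1Dx.
have e0 := expR_gt0 x.
have : (1 - x) * expR x <= expR (- x) * expR x by rewrite ler_pM2r.
by rewrite -expRD addNr expR0 mulrBl mul1r; lra.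
Qed.

Lemma expR_taylor1 x : `|expR x - 1 - x| <= x ^+ 2 * expR `|x|.
Proof.
rewrite ger0_norm; last by have := expR_ge1Dx x; lra.
have h := expR_sub1_le x.
have [x0|x0] := leP 0 x.
  rewrite ger0_norm// expr2.
  have := ler_wpM2l x0 h; rewrite mulrA; nra.
rewrite ltr0_norm//.
have : x * (expR x - 1) <= x ^+ 2.
  by rewrite expr2; apply: ler_wnM2l; [exact: ltW|have := expR_ge1Dx x; lra].
have : 1 <= expR (- x) by have := expR_ge1Dx (- x); lra.
have : 0 <= x ^+ 2 by exact: sqr_ge0.
nra.
Qed.

Lemma expR_taylor2 x : `|expR x - 1 - x - x ^+ 2 / 2| <= `|x| ^+ 3 * expR `|x|.
Proof.
pose f t := expR t - 1 - t - t ^+ 2 / 2.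
have df t : is_derive t 1 f (expR t - 1 - t).
  apply: is_derive_eq; rewrite /GRing.scale/=.
  by field.
have cf a b : {within `[a, b], continuous f}.
  apply: derivable_within_continuous => t _; apply: ex_derive.
have f0 : f 0 = 0 by rewrite /f expR0 expr0n/= mul0r; ring.
have key c : `|c| <= `|x| -> `|(expR c - 1 - c) * x| <= `|x| ^+ 3 * expR `|x|.
  move=> cx; rewrite normrM exprS mulrC -mulrA ler_wpM2l//.
  apply: (le_trans (expR_taylor1 c)); apply: ler_pM => //; rewrite ?sqr_ge0 ?expR_ge0 ?ler_expR//.
  by rewrite -[c ^+ 2]real_normK ?num_real// ler_sqr ?nnegrE.
have [x0|x0|->] := ltgtP x 0.
- have [c + fc] := MVT x0 (fun t _ => df t) (cf _ _).
  rewrite in_itv/= => /andP[xc c0].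
  rewrite -/(f x) (_ : f x = (expR c - 1 - c) * x); last by move: fc; rewrite f0; lra.
  by apply: key; rewrite !ltr0_norm//; lra.
- have [c + fc] := MVT x0 (fun t _ => df t) (cf _ _).
  rewrite in_itv/= => /andP[c0 cx].
  rewrite -/(f x) (_ : f x = (expR c - 1 - c) * x); last by move: fc; rewrite f0; lra.
  by apply: key; rewrite !gtr0_norm//; lra.
- by rewrite -/(f 0) f0 normr0 mulr_ge0// expR_ge0.
Qed.

Lemma expR_le1_taylor2 t : `|t| <= 1 ->
  `|expR t - 1 - t - t ^+ 2 / 2| <= expR 1 * `|t| ^+ 3.
Proof.
move=> t1; apply: (le_trans (expR_taylor2 t)).
by rewrite mulrC ler_wpM2r ?exprn_ge0// ler_expR.
Qed.

(** Two regimes, cut at |D| = 1/2. Beyond it every term is at most a multiple of |D| ^+ 3. Below it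
    the power is expR (a * t) with t = ln (1 + D), and the exponential is expanded at both t and a *
    t. *)
Lemma powR_taylor (a : R) : 0 < a < 1 -> exists2 C, 0 <= C &
  forall D, -1 <= D ->
  `|(1 + D) `^ a - (1 + a * D - a * (1 - a) / 2 * D ^+ 2)| <= C * `|D| ^+ 3.
Proof.
move=> /andP[a0 a1]; pose e : R := expR 1.
have e0 : 0 <= e by exact: expR_ge0.
exists (26 + 40 * e + 20) => [|D D1]; first by lra.
have [Dl|Ds] := ltP (2^-1) `|D|.
  have p0 : 0 <= (1 + D) `^ a by exact: powR_ge0.
  have p1 : (1 + D) `^ a <= 2 + `|D|.
    have [d|d] := leP 1 (1 + D).
      apply: (le_trans (ler1_powR d (ltW a1))); have := ler_norm D; lra.
    have [->|dn] := eqVneq (1 + D) 0; first by rewrite powR0 ?gt_eqF//; lra.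
    apply: (@le_trans _ _ 1); last by have := normr_ge0 D; lra.
    by rewrite /powR (negbTE dn) expR_le1 mulr_ge0_le0// ?ln_le0// ltW.
  have DD : D ^+ 2 = `|D| ^+ 2 by rewrite real_normK ?num_real.
  rewrite DD; move: (normr_ge0 D) (ler_norm D) (lerNnormlW (lexx `|D|)) Dl p1.
  move: `|D| => d d0 Dd Dd' Dl p1.
  rewrite ler_norml.
  have h3 : d ^+ 3 = d * d * d by ring.
  have h2 : d ^+ 2 = d * d by ring.
  rewrite h3 h2.
  have q1 : 0 <= d * d * d * e by rewrite !mulr_ge0.
  have q2 : 1 <= 8 * (d * d * d) by nra.
  have q3 : d <= 4 * (d * d * d) by nra.
  have q4 : d * d <= 2 * (d * d * d) by nra.
  have q5 : `|a * D| <= d by rewrite normrM gtr0_norm//; have : `|D| <= d; [by rewrite ler_norml Dd'|nra].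
  have q6 : 0 <= a * (1 - a) / 2 * (d * d) <= d * d by apply/andP; split; nra.
  move: q5 q6; rewrite ler_norml => /andP[] ? ? /andP[] ? ?.
  by apply/andP; split; lra.
have /andP[Dlo Dhi] : - 2^-1 <= D <= 2^-1 by rewrite -ler_norml.
have D10 : 0 < 1 + D by lra.
pose t := ln (1 + D).
have et : expR t = 1 + D by rewrite lnK.
have tD : t <= D by apply: le_ln1Dx; lra.
have t2 : `|t| <= 2 * `|D|.
  have h := expR_ge1Dx (- t).
  rewrite expRN et in h.
  have h2 : (1 + D)^-1 <= 1 + 2 * `|D|.
    rewrite -[leLHS]mulr1 mulrC ler_pdivrMr//.
    have [d|d] := leP 0 D; [rewrite ger0_norm//; nra|rewrite ltr0_norm//; nra].
  rewrite ler_norml; apply/andP; split; first by lra.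
  by apply: (le_trans tD); have := ler_norm D; have := normr_ge0 D; lra.
have t1 : `|t| <= 1 by lra.
have e1 := expR_le1_taylor2 t1; rewrite et in e1.
have at1 : `|a * t| <= `|t|.
  by rewrite normrM gtr0_norm// ler_piMl//; lra.
have e2 := expR_le1_taylor2 (le_trans at1 t1).
have -> : (1 + D) `^ a = expR (a * t) by rewrite /powR gt_eqF.
have e2' : `|expR (a * t) - 1 - a * t - (a * t) ^+ 2 / 2| <= e * `|t| ^+ 3.
  by apply: (le_trans e2); rewrite ler_wpM2l// lerXn2r ?nnegrE.
pose E1 := D - t - t ^+ 2 / 2.
have E1e : `|E1| <= e * `|t| ^+ 3 by apply: le_trans e1; rewrite le_eqVlt /E1; apply/orP; left; apply/eqP; congr `|_|; ring.
pose E2 := expR (a * t) - 1 - a * t - (a * t) ^+ 2 / 2.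
rewrite -/E2 in e2'.
(* The quadratic terms combine into a (1 - a) / 2 times D ^+ 2 - t ^+ 2 = (D - t) (D + t), and D - t
   = t ^+ 2 / 2 + E1 makes this product of third order. *)
have -> : expR (a * t) - (1 + a * D - a * (1 - a) / 2 * D ^+ 2) =
  E2 - a * E1 + a * (1 - a) / 2 * ((t ^+ 2 / 2 + E1) * (D + t)).
  by rewrite /E1 /E2; field.
have T3 : `|t| ^+ 3 <= 8 * `|D| ^+ 3.
  rewrite (_ : 8 * `|D| ^+ 3 = (2 * `|D|) ^+ 3); last by ring.
  by rewrite lerXn2r ?nnegrE// mulr_ge0.
have bE : `|E1| <= 8 * e * `|D| ^+ 3.
  by apply: (le_trans E1e); have := ler_wpM2l e0 T3; lra.
have bE2 : `|E2| <= 8 * e * `|D| ^+ 3.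
  by apply: (le_trans e2'); have := ler_wpM2l e0 T3; lra.
have D30 : 0 <= `|D| ^+ 3 by rewrite exprn_ge0.
have bT : `|t ^+ 2 / 2| <= 2 * `|D| ^+ 2.
  rewrite normrM normrX (ger0_norm (x := 2^-1))//.
  have : `|t| ^+ 2 <= (2 * `|D|) ^+ 2 by rewrite lerXn2r ?nnegrE// mulr_ge0.
  by rewrite exprMn; lra.
have bDt : `|D + t| <= 3 * `|D| by apply: (le_trans (ler_normD _ _)); lra.
have bP : `|(t ^+ 2 / 2 + E1) * (D + t)| <= (6 + 24 * e) * `|D| ^+ 3.
  rewrite normrM.
  have h : `|t ^+ 2 / 2 + E1| <= (2 + 8 * e) * `|D| ^+ 2.
    apply: (le_trans (ler_normD _ _)).
    have : `|D| ^+ 3 <= `|D| ^+ 2.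
      by rewrite [leLHS]exprS ler_piMl ?exprn_ge0//; lra.
    by move=> /(ler_wpM2l (mulr_ge0 (ler0n R 8) e0)); lra.
  apply: (le_trans (ler_pM _ _ h bDt)) => //.
  by rewrite le_eqVlt; apply/orP; left; apply/eqP; ring.
have ba : 0 <= a * (1 - a) / 2 <= 1 by apply/andP; split; nra.
case/andP: ba => ba0 ba1.
apply: (le_trans (ler_normD _ _)); apply: (@le_trans _ _ (8 * e * `|D| ^+ 3 + 8 * e * `|D| ^+ 3 + (6 + 24 * e) * `|D| ^+ 3)); last by nra.
apply: lerD.
  apply: (le_trans (ler_normB _ _)); apply: lerD => //.
  by rewrite normrM gtr0_norm//; apply: le_trans bE; rewrite ler_piMl//; lra.
by rewrite normrM (ger0_norm ba0); apply: le_trans bP; rewrite ler_piMl.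
Qed.

(** Arithmetic-geometric mean on |D| ^+ 3, because even powers have explicit Gaussian moments. The
    parameter s becomes the interpolation step, for which both terms are of order s ^+ 3. *)
Lemma powR_taylor_quartic (a : R) : 0 < a < 1 -> exists2 C, 0 <= C &
  forall D s, -1 <= D -> 0 < s ->
  `|(1 + D) `^ a - (1 + a * D - a * (1 - a) / 2 * D ^+ 2)| <=
     C * (s * D ^+ 2 + D ^+ 4 / s).
Proof.
move=> /powR_taylor[C C0 H]; exists C => // D s D1 s0.
apply: (le_trans (H D D1)); rewrite ler_wpM2l//.
have -> : s * D ^+ 2 + D ^+ 4 / s = s * `|D| ^+ 2 + `|D| ^+ 4 / s.
  by rewrite -!normrX !ger0_norm ?exprn_even_ge0.
have d0 := normr_ge0 D; move: `|D| d0 => d d0.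
rewrite -subr_ge0 (_ : _ - _ = d ^+ 2 / s * ((s - d / 2) ^+ 2 + 3 / 4 * d ^+ 2)); last by field; rewrite gt_eqF.
apply: mulr_ge0; first by rewrite divr_ge0 ?sqr_ge0// ltW.
by have := sqr_ge0 d; have := sqr_ge0 (s - d / 2); lra.
Qed.

(* the polynomial is E (e^G - 1)^4 for G ~ N(-v/2, v) *)
Lemma quartic_mgf_le (v : R) : 0 <= v ->
  expR (6 * v) - 4 * expR (3 * v) + 6 * expR v - 3 <= 42 * v ^+ 2 * expR (6 * v).
Proof.
move=> v0.
have h6 := expR_taylor1 (6 * v); have h1 := expR_taylor1 v.
have h3 := expR_ge1Dx (3 * v).
move: h6 h1; rewrite (ger0_norm (x := 6 * v)) ?mulr_ge0// (ger0_norm v0).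
move=> /ler_normlP[_ h6] /ler_normlP[_ h1].
have : expR v <= expR (6 * v) by rewrite ler_expR; lra.
move=> /(ler_wpM2l (sqr_ge0 v)).
rewrite exprMn in h6; lra.
Qed.

End real_bounds.

(** * Gaussian vectors *)

Section affine.
Variable R : realType.
Notation mR := (measurableTypeR R).
Notation leb := (@lebesgue_measure R).

Definition affine (a b : R) (x : mR) : mR := a * x + b.

Lemma measurable_affine (a b : R) : measurable_fun [set: mR] (affine a b).
Proof. by apply: measurable_funD => //; apply: measurable_funM. Qed.

HB.instance Definition _ (a b : R) :=
  isMeasurableFun.Build _ _ _ _ (affine a b) (measurable_affine a b).

Lemma lebesgue_affine (a b : R) (a0 : 0 < a) (A : set mR) :
  measurable A ->
  leb A = (a%:E * leb (affine a b @^-1` A))%E.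
Proof.
have mf := measurable_affine a b.
move=> mA; rewrite (lebesgue_measure_unique
  (mu := mscale (NngNum (ltW a0)) (pushforward leb (affine a b)))) => // _ [[u v] _ <-].
change (leb `]u, v] = a%:E * leb (affine a b @^-1` `]u, v]))%E.
have -> : affine a b @^-1` `]u, v] = `](u - b) / a, (v - b) / a]%classic.
  apply/seteqP; split => x /=; rewrite /affine !in_itv/= ltr_pdivrMr// ler_pdivlMr// [x * a]mulrC;
  by rewrite ltrBlDr lerBrDr.
rewrite !lebesgue_measure_itv/= !lte_fin.
rewrite ltr_pM2r ?invr_gt0// ltrD2r.
case: ifP => uv; rewrite ?mule0// -EFinM; congr EFin.
by field; rewrite gt_eqF.
Qed.

Local Open Scope ereal_scope.
Lemma integral_affine (a b : R) (F : mR -> \bar R) : (0 < a)%R ->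
  measurable_fun [set: mR] F -> (forall x, 0 <= F x) ->
  \int[leb]_x F x = a%:E * \int[leb]_x F (affine a b x).
Proof.
move=> a0 mF F0.
rewrite (@eq_measure_integral _ _ _ _ (mscale (NngNum (ltW a0)) (pushforward leb (affine a b)))); last first.
  by move=> A mA _; apply: lebesgue_affine.
rewrite ge0_integral_mscale//.
by rewrite ge0_integral_pushforward//= => y _.
Qed.

End affine.

Section std_normal.
Variable R : realType.
Notation mR := (measurableTypeR R).
Notation leb := (@lebesgue_measure R).
Definition gauss : probability mR R := normal_prob 0 1.
Local Open Scope ereal_scope.

(** The Radon-Nikodym derivative of the normal law is given only through its integrals; their
    equality on all measurable sets identifies it almost everywhere with [normal_pdf]. *)
Lemma integral_normal_prob (m s : R) (F : mR -> \bar R) :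
  measurable_fun [set: mR] F -> (forall x, 0 <= F x) ->
  \int[normal_prob m s]_x F x = \int[leb]_x (F x * (normal_pdf m s x)%:E).
Proof.
move=> mF F0.
have dom := @normal_prob_dominates R m s.
rewrite -(Radon_Nikodym_SigmaFinite.change_of_variables dom)//.
apply: ae_eq_integral => //.
- apply: emeasurable_funM => //.
  exact: measurable_int (Radon_Nikodym_SigmaFinite.f_integrable dom).
- apply: emeasurable_funM => //; apply/measurable_EFinP; exact: measurable_normal_pdf.
apply: ae_eqe_mul2l.
apply: integral_ae_eq => //.
- exact: (Radon_Nikodym_SigmaFinite.f_integrable dom).
- apply/measurable_EFinP; exact: measurable_normal_pdf.
- by move=> E _ mE; rewrite -(Radon_Nikodym_SigmaFinite.f_integral dom)//.
Qed.

Lemma normal_pdf01 (x : R) :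
  normal_pdf 0 1 x = ((Num.sqrt (pi *+ 2))^-1 * expR (- x ^+ 2 / 2))%R.
Proof.
rewrite normal_pdfE ?oner_eq0// /normal_peak /normal_fun subr0 expr1n mul1r.
by rewrite mulr2n.
Qed.

(** Cameron-Martin in dimension one: translate the Lebesgue integral and complete the square in the
    density. *)
Lemma gauss_shift (a : R) (F : mR -> \bar R) :
  measurable_fun [set: mR] F -> (forall x, 0 <= F x) ->
  \int[gauss]_z F (a + z)%R =
  \int[gauss]_z ((expR (a * z - a ^+ 2 / 2))%:E * F z).
Proof.
move=> mF F0.
have mFa : measurable_fun [set: mR] (fun z : mR => F (a + z)%R).
  apply: measurableT_comp => //; exact: measurable_funD.
have mE : measurable_fun [set: mR] (fun z : mR => (expR (a * z - a ^+ 2 / 2))%:E).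
  apply/measurable_EFinP/measurableT_comp => //.
  by apply: measurable_funB => //; apply: measurable_funM.
rewrite /gauss !integral_normal_prob//; last 2 first.
- exact: emeasurable_funM.
- by move=> x; rewrite mule_ge0.
rewrite [RHS](@integral_affine _ 1 a)//.
- rewrite mul1e; apply: eq_integral => x _.
  rewrite /affine mul1r !normal_pdf01 [(x + a)%R]addrC [(expR _)%:E * _]muleC -muleA; congr (_ * _).
  rewrite -EFinM; congr EFin.
  rewrite mulrCA; congr (_ * _)%R; rewrite -expRD; congr expR.
  by field.
- apply: emeasurable_funM; first exact: emeasurable_funM.
  by apply/measurable_EFinP; exact: measurable_normal_pdf.
- by move=> x; rewrite !mule_ge0// lee_fin ?normal_pdf_ge0.
Qed.

(** Two affine substitutions separated by Fubini: first u = c x + s y in x, then y / c - (s / c) u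
    in y. The Jacobians c^-1 agree, and c > 0 makes both substitutions legitimate. *)
Lemma lebesgue_rotation (c s : R) (G : mR * mR -> \bar R) :
  (c ^+ 2 + s ^+ 2 = 1)%R -> (0 < c)%R ->
  measurable_fun [set: mR * mR] G -> (forall x, 0 <= G x) ->
  \int[leb]_x \int[leb]_y G (c * x + s * y, c * y - s * x)%R =
  \int[leb]_x \int[leb]_y G (x, y).
Proof.
move=> cs c0 mG G0.
have mrot (a b a' b' : R) : measurable_fun [set: mR * mR]
    (fun z : mR * mR => (a * z.1 + b * z.2, a' * z.2 + b' * z.1)%R : mR * mR).
  by apply/measurable_fun_pair => /=; apply: measurable_funD; apply: measurable_funM.
transitivity (\int[leb]_y \int[leb]_x G (c * x + s * y, c * y - s * x)%R).
  apply: (fubini_tonelli (fun z : mR * mR => G (c * z.1 + s * z.2, c * z.2 - s * z.1)%R)) => //.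
  by apply: measurableT_comp => //; under eq_fun do rewrite -mulNr; exact: mrot.
transitivity (\int[leb]_y (c^-1%:E * \int[leb]_x G (x, c^-1 * y - s / c * x)%R)).
  apply: eq_integral => y _.
  rewrite (@integral_affine _ c (s * y)%R (fun x => G (x, c^-1 * y - s / c * x)%R))//.
  - rewrite muleA -EFinM mulVf ?gt_eqF// mul1e; apply: eq_integral => x _ /=.
    rewrite /affine; congr (G (_, _)).
    suff -> : (c^-1 * y = c * y + s ^+ 2 * y / c)%R by field; rewrite gt_eqF.
    by apply: (mulfI (lt0r_neq0 c0)); rewrite mulrA divff ?gt_eqF// mul1r mulrDr mulrA -expr2 mulrCA divff ?gt_eqF// mulr1 -mulrDl cs mul1r.
  - apply: (measurableT_comp mG) => /=; apply/measurable_fun_pair => //=.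
    by apply: measurable_funB => //; apply: measurable_funM.
rewrite ge0_integralZl//; first last.
- by rewrite lee_fin invr_ge0 ltW.
- by move=> x _; exact: integral_ge0.
- apply: (measurable_fun_fubini_tonelli_G (fun z : mR * mR => G (z.1, c^-1 * z.2 - s / c * z.1)%R)) => //.
  apply: measurableT_comp => //; apply/measurable_fun_pair => //=.
  by apply: measurable_funB => //; apply: measurable_funM.
rewrite -(fubini_tonelli (fun z : mR * mR => G (z.1, c^-1 * z.2 - s / c * z.1)%R))//; last first.
  apply: measurableT_comp => //; apply/measurable_fun_pair => //=.
  by apply: measurable_funB => //; apply: measurable_funM.
rewrite -ge0_integralZl//; first last.
- by rewrite lee_fin invr_ge0 ltW.
- by move=> x _; exact: integral_ge0.
- apply: (measurable_fun_fubini_tonelli_F (fun z : mR * mR => G (z.1, c^-1 * z.2 - s / c * z.1)%R)) => //.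
  apply: measurableT_comp => //; apply/measurable_fun_pair => //=.
  by apply: measurable_funB => //; apply: measurable_funM.
apply: eq_integral => x _ /=.
rewrite [RHS](@integral_affine _ c^-1 (- (s / c * x))%R (fun y => G (x, y)))// ?invr_gt0//.
exact: measurableT_comp.
Qed.

Lemma gauss_gaussE (H : mR * mR -> \bar R) :
  measurable_fun [set: mR * mR] H -> (forall x, 0 <= H x) ->
  \int[gauss]_x \int[gauss]_y H (x, y) =
  \int[leb]_x \int[leb]_y (H (x, y) * (normal_pdf 0 1 x * normal_pdf 0 1 y)%:E).
Proof.
move=> mH H0.
rewrite {1}/gauss integral_normal_prob//; first last.
- by move=> x; exact: integral_ge0.
- exact: (measurable_fun_fubini_tonelli_F H).
apply: eq_integral => x _.
rewrite /gauss integral_normal_prob//; last exact: measurableT_comp.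
rewrite -ge0_integralZr//; first last.
- by rewrite lee_fin normal_pdf_ge0.
- by move=> y _; rewrite mule_ge0// lee_fin normal_pdf_ge0.
- apply: emeasurable_funM; first exact: measurableT_comp.
  by apply/measurable_EFinP; exact: measurable_normal_pdf.
by apply: eq_integral => y _; rewrite -muleA -EFinM [(normal_pdf _ _ y * _)%R]mulrC.
Qed.

Lemma gauss_rotation (c s : R) (F : mR * mR -> \bar R) :
  (c ^+ 2 + s ^+ 2 = 1)%R -> (0 < c)%R ->
  measurable_fun [set: mR * mR] F -> (forall x, 0 <= F x) ->
  \int[gauss]_x \int[gauss]_y F (c * x + s * y, c * y - s * x)%R =
  \int[gauss]_x \int[gauss]_y F (x, y).
Proof.
move=> cs c0 mF F0.
have mrot (a b a' b' : R) : measurable_fun [set: mR * mR]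
    (fun z : mR * mR => (a * z.1 + b * z.2, a' * z.2 + b' * z.1)%R : mR * mR).
  by apply/measurable_fun_pair => /=; apply: measurable_funD; apply: measurable_funM.
rewrite [LHS](gauss_gaussE (H := fun z => F (c * z.1 + s * z.2, c * z.2 - s * z.1)%R))//; last first.
  by apply: measurableT_comp => //; under eq_fun do rewrite -mulNr; exact: mrot.
pose G z := F z * (normal_pdf 0 1 z.1 * normal_pdf 0 1 z.2)%:E.
rewrite (gauss_gaussE mF F0).
transitivity (\int[leb]_x \int[leb]_y G (c * x + s * y, c * y - s * x)%R); last first.
  apply: lebesgue_rotation => //; last first.
    by move=> x; rewrite mule_ge0// lee_fin mulr_ge0// normal_pdf_ge0.
  apply: emeasurable_funM => //; apply/measurable_EFinP; apply: measurable_funM;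
    apply: measurableT_comp => //; exact: measurable_normal_pdf.
apply: eq_integral => x _; apply: eq_integral => y _ /=; congr (_ * _%:E).
rewrite !normal_pdf01 mulrACA [RHS]mulrACA -!expRD; congr (_ * expR _)%R.
  rewrite -!mulrDl /=; congr (_ / 2)%R.
  transitivity (- ((c ^+ 2 + s ^+ 2) * (x ^+ 2 + y ^+ 2)))%R; last by ring.
  by rewrite cs; ring.
Qed.

Lemma gauss_sqr_mgf (a : R) : (a < 1)%R ->
  \int[gauss]_z (expR (a * z ^+ 2 / 2))%:E = ((Num.sqrt (1 - a))^-1)%:E.
Proof.
move=> a1.
have a1' : (0 < 1 - a)%R by lra.
have sa : (0 < Num.sqrt (1 - a))%R by rewrite sqrtr_gt0.
rewrite /gauss integral_normal_prob//; last first.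
  apply/measurable_EFinP/measurableT_comp => //.
  by do 2! apply: measurable_funM => //.
rewrite (@integral_affine _ (Num.sqrt (1 - a))^-1 0) ?invr_gt0//.
- rewrite -[RHS]mule1; congr (_ * _).
  rewrite -(@integral_normal_pdf R 0 1); apply: eq_integral => x _.
  rewrite /affine addr0 !normal_pdf01 -EFinM mulrCA; congr (_ * _)%:E.
  rewrite -expRD; congr expR.
  rewrite !exprMn exprVn sqr_sqrtr; last exact: ltW.
  by field; lra.
- apply: emeasurable_funM; last by apply/measurable_EFinP; exact: measurable_normal_pdf.
  apply/measurable_EFinP/measurableT_comp => //.
  by do 2! apply: measurable_funM => //.
- by move=> x; rewrite mule_ge0// lee_fin ?normal_pdf_ge0.
Qed.

End std_normal.

(** * Integration against product measures *)

Section iid_integral.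
Context d (T : measurableType d) (R : realType) (P : probability T R).
Local Open Scope ereal_scope.

Lemma integral_prob_cst (r : \bar R) : \int[P]_x r = r.
Proof. by rewrite integral_cst//= probability_setT mule1. Qed.

Lemma tnth_cons_pair0 n (z : T * n.-tuple T) : tnth (cons_pair z) ord0 = z.1.
Proof. by []. Qed.

Lemma tnth_cons_pairS n (z : T * n.-tuple T) (i : 'I_n) :
  tnth (cons_pair z) (lift ord0 i) = tnth z.2 i.
Proof. exact: tnthS. Qed.

Lemma integral_iid0 (F : 0.-tuple T -> \bar R) :
  measurable_fun setT F -> \int[iid P 0]_t F t = F [tuple].
Proof. by move=> mF; rewrite integral_dirac//= diracT mul1e. Qed.

Lemma integral_iidS n (F : n.+1.-tuple T -> \bar R) :
  measurable_fun setT F -> (forall t, 0 <= F t) ->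
  \int[iid P n.+1]_t F t = \int[P]_x \int[iid P n]_t F (cons_pair (x, t)).
Proof.
move=> mF F0 /=; rewrite ge0_integral_distribution//.
exact: (fubini_tonelli1 (F \o @cons_pair _ T n) (measurableT_comp mF (@measurable_cons_pair _ T n)) (fun z => F0 _)).
Qed.

Lemma integral_iid_prod n (f : 'I_n -> T -> R) (c : 'I_n -> R) :
  (forall i, measurable_fun setT (f i)) -> (forall i x, 0 <= f i x)%R ->
  (forall i, \int[P]_x (f i x)%:E = (c i)%:E) ->
  \int[iid P n]_t (\prod_(i < n) f i (tnth t i))%:E = (\prod_(i < n) c i)%:E.
Proof.
elim: n f c => [|n IH] f c mf f0 fc.
  rewrite integral_iid0 ?big_ord0//.
  by under eq_fun do rewrite big_ord0; exact: measurable_cst.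
have mprod m (g : 'I_m -> T -> R) : (forall i, measurable_fun setT (g i)) ->
  measurable_fun [set: m.-tuple T] (fun t => \prod_(i < m) g i (tnth t i))%R.
  move=> mg; apply: measurable_prod => i _.
  exact: (measurableT_comp (mg i) (@measurable_tnth _ T m i)).
rewrite integral_iidS//; first last.
- by move=> t; rewrite lee_fin prodr_ge0.
- by apply/measurable_EFinP; exact: mprod.
rewrite big_ord_recl EFinM -(fc ord0) -ge0_integralZr//; first last.
- by rewrite lee_fin prodr_ge0// => i _; rewrite -lee_fin -fc; apply: integral_ge0 => x _; rewrite lee_fin.
- by move=> x _; rewrite lee_fin.
- exact/measurable_EFinP.
apply: eq_integral => x _.
rewrite -(IH (fun i => f (lift ord0 i)) (fun i => c (lift ord0 i)))//.
rewrite -ge0_integralZl//; first last.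
- by rewrite lee_fin.
- by move=> t _; rewrite lee_fin prodr_ge0.
- by apply/measurable_EFinP; exact: (mprod _ (fun i => f (lift ord0 i))).
apply: eq_integral => t _.
rewrite big_ord_recl tnth_cons_pair0 EFinM; congr (_ * _%:E).
by apply: eq_bigr => i _; rewrite tnth_cons_pairS.
Qed.

(** Applied later to the truncation [clamp], which preserves P because it is almost surely the
    identity. *)
Lemma integral_iid_map n (g : T -> T) (F : n.-tuple T -> \bar R) :
  measurable_fun setT g ->
  (forall f : T -> \bar R, measurable_fun setT f -> (forall x, 0 <= f x) ->
     \int[P]_x f (g x) = \int[P]_x f x) ->
  measurable_fun setT F -> (forall t, 0 <= F t) ->
  \int[iid P n]_t F (map_tuple g t) = \int[iid P n]_t F t.
Proof.
move=> mg gP; elim: n F => [|n IH] F mF F0.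
  by rewrite !integral_iid0//; first (congr F; exact: tuple0); apply: measurableT_comp => //; apply/measurable_fun_tnthP => -[].
have mmap m : measurable_fun setT (fun t : m.-tuple T => map_tuple g t).
  apply/measurable_fun_tnthP => i.
  apply: (eq_measurable_fun (fun t => g (tnth t i))).
    by move=> t _ /=; rewrite tnth_map.
  exact: (measurableT_comp mg (@measurable_tnth _ T m i)).
rewrite (integral_iidS mF F0) (integral_iidS (F := fun t => F (map_tuple g t)) (measurableT_comp mF (mmap _)) (fun t => F0 _)).
rewrite -[RHS](gP (fun x => \int[iid P n]_t F (cons_pair (x, t)))); first last.
- by move=> x; exact: integral_ge0.
- apply: (measurable_fun_fubini_tonelli_F (fun z => F (cons_pair z))) => //.
  exact: measurableT_comp.
apply: eq_integral => x _.
rewrite -[RHS](IH (fun t => F (cons_pair (g x, t))))//; last first.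
  apply: measurableT_comp => //; apply: measurableT_comp => //; exact: measurable_fun_pair.
apply: eq_integral => t _; congr F.
by apply: eq_from_tnth => i; rewrite tnth_map; case: (unliftP ord0 i) => [j ->|->];
  rewrite ?tnth_cons_pair0 ?tnth_cons_pairS//= tnth_map.
Qed.

End iid_integral.

Section tuple_ops.
Variable R : realType.
Notation mR := (measurableTypeR R).

Definition dot n (a b : n.-tuple mR) : R := \sum_(k < n) tnth a k * tnth b k.
Definition lin n (c s : R) (a b : n.-tuple mR) : n.-tuple mR :=
  [tuple c * tnth a k + s * tnth b k | k < n].

Definition scal n (c : R) (a : n.-tuple mR) : n.-tuple mR := lin c 0 a a.

Lemma tnth_lin n c s (a b : n.-tuple mR) k :
  tnth (lin c s a b) k = c * tnth a k + s * tnth b k.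
Proof. by rewrite tnth_mktuple. Qed.

(** The Cameron-Martin density of a standard Gaussian vector translated by a. *)
Definition wt n (a Y : n.-tuple mR) : R := expR (dot a Y - dot a a / 2).

Lemma wt_ge0 n (a Y : n.-tuple mR) : 0 <= wt a Y.
Proof. exact: expR_ge0. Qed.

Context d (T : measurableType d).

Lemma measurable_tnthT n (f : T -> n.-tuple mR) k :
  measurable_fun setT f -> measurable_fun setT (fun x => tnth (f x) k : mR).
Proof. by move=> mf; apply: (measurableT_comp (@measurable_tnth _ mR n k)). Qed.

Lemma measurable_dot n (f g : T -> n.-tuple mR) :
  measurable_fun setT f -> measurable_fun setT g ->
  measurable_fun setT (fun x => dot (f x) (g x) : mR).
Proof.
move=> mf mg; apply: measurable_sum => k.
by apply: measurable_funM; apply: measurable_tnthT.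
Qed.

Lemma measurable_lin n c s (f g : T -> n.-tuple mR) :
  measurable_fun setT f -> measurable_fun setT g ->
  measurable_fun setT (fun x => lin c s (f x) (g x)).
Proof.
move=> mf mg; apply/measurable_fun_tnthP => k.
apply: (eq_measurable_fun (fun x => c * tnth (f x) k + s * tnth (g x) k)).
  by move=> x _ /=; rewrite tnth_lin.
by apply: measurable_funD; apply: measurable_funM => //; exact: measurable_tnthT.
Qed.

Lemma measurable_scal n c (f : T -> n.-tuple mR) :
  measurable_fun setT f -> measurable_fun setT (fun x => scal c (f x)).
Proof. by move=> mf; exact: measurable_lin. Qed.

Lemma measurable_consp n (f : T -> mR) (g : T -> n.-tuple mR) :
  measurable_fun setT f -> measurable_fun setT g ->
  measurable_fun setT (fun x => cons_pair (f x, g x)).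
Proof.
move=> mf mg.
apply: (@measurableT_comp _ _ _ _ _ _ (@cons_pair _ mR n)) => //.
exact: measurable_fun_pair.
Qed.

End tuple_ops.

Lemma measurable_wt (R : realType) d (T : measurableType d) n
    (f g : T -> n.-tuple (measurableTypeR R)) :
  measurable_fun setT f -> measurable_fun setT g ->
  measurable_fun setT (fun x => wt (f x) (g x) : measurableTypeR R).
Proof.
move=> mf mg; apply: (measurableT_comp (@measurable_expR R)).
apply: measurable_funB; first exact: measurable_dot.
by apply: measurable_funM => //; exact: measurable_dot.
Qed.

Ltac mstep :=
  match goal with
  | H : measurable_fun _ ?f |- measurable_fun _ ?f => exact: H
  | |- measurable_fun _ (fun x => x) => exact: measurable_id
  | |- measurable_fun _ (fun _ => ?c) => exact: measurable_cst
  | |- measurable_fun _ fst => exact: measurable_fst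
  | |- measurable_fun _ snd => exact: measurable_snd
  | |- measurable_fun _ (EFin \o _) => apply/measurable_EFinP
  | |- measurable_fun _ (fun x => EFin (@?f x)) => apply/measurable_EFinP
  | |- measurable_fun _ (fun x => ((@?f x) * (@?g x))%E) => apply: emeasurable_funM
  | |- measurable_fun _ (fun x => ((@?f x) + (@?g x))%E) => apply: emeasurable_funD
  | |- measurable_fun _ (fun x => ((@?f x) + (@?g x))%R) => apply: measurable_funD
  | |- measurable_fun _ (fun x => (- (@?f x))%R) => apply: measurable_funN
  | |- measurable_fun _ (fun x => ((@?f x) * (@?g x))%R) => apply: measurable_funM
  | |- measurable_fun _ (fun x => ((@?f x) ^+ _)%R) => apply: measurable_funX
  | |- measurable_fun _ (fun x => expR (@?f x)) => apply: (measurableT_comp (@measurable_expR _))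
  | |- measurable_fun _ (fun x => dot (@?f x) (@?g x)) => apply: measurable_dot
  | |- measurable_fun _ (fun x => wt (@?f x) (@?g x)) => apply: measurable_wt
  | |- measurable_fun _ (fun x => lin _ _ (@?f x) (@?g x)) => apply: measurable_lin
  | |- measurable_fun _ (fun x => scal _ (@?f x)) => apply: measurable_scal
  | |- measurable_fun _ (fun x => tnth (@?f x) _) => apply: measurable_tnthT
  | |- measurable_fun _ (fun x => cons_pair (@?f x, @?g x)) => apply: measurable_consp
  | |- measurable_fun _ (fun x => (@?f x, @?g x)) => apply: measurable_fun_pair
  | |- measurable_fun _ (fun x => fst (@?f x)) => apply: (measurableT_comp measurable_fst)
  | |- measurable_fun _ (fun x => snd (@?f x)) => apply: (measurableT_comp measurable_snd)
  | H : measurable_fun _ ?F |- measurable_fun _ (fun x => ?F (@?g x)) => apply: (measurableT_comp H)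
  | |- measurable_fun ?D ?f =>
      lazymatch f with (fun _ => _) => fail | _ => change (measurable_fun D (fun x => f x)) end
  end.
Ltac mble := repeat (cbv beta; mstep).

Section gaussn.
Variable R : realType.
Notation mR := (measurableTypeR R).
Notation gaussn := (iid (@gauss R)).
Local Open Scope ereal_scope.

Lemma wt_cons n x (a : n.-tuple mR) y Y :
  wt (cons_pair (x, a)) (cons_pair (y, Y)) = (expR (x * y - x ^+ 2 / 2) * wt a Y)%R.
Proof.
rewrite /wt /dot !big_ord_recl !tnth_cons_pair0 -expRD; congr expR.
under eq_bigr do rewrite !tnth_cons_pairS.
under [in X in (_ - X)%R]eq_bigr do rewrite !tnth_cons_pairS.
by rewrite /=; field.
Qed.

Lemma tuple_consP n (a : n.+1.-tuple mR) : exists x b, a = cons_pair (x, b).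
Proof. by exists (thead a), [tuple of behead a]; rewrite [LHS]tuple_eta; exact: val_inj. Qed.

Lemma lin_cons n c s x (a : n.-tuple mR) y b :
  lin c s (cons_pair (x, a)) (cons_pair (y, b)) = cons_pair (c * x + s * y, lin c s a b)%R.
Proof.
apply: eq_from_tnth => i; rewrite tnth_lin; case: (unliftP ord0 i) => [j ->|->].
  by rewrite !tnth_cons_pairS tnth_lin.
by rewrite !tnth_cons_pair0.
Qed.

Lemma gaussn_shift n (a : n.-tuple mR) (F : n.-tuple mR -> \bar R) :
  measurable_fun setT F -> (forall Y, 0 <= F Y) ->
  \int[gaussn n]_Y F (lin 1 1 a Y) = \int[gaussn n]_Y ((wt a Y)%:E * F Y).
Proof.
elim: n a F => [|n IH] a F mF F0.
  rewrite [LHS]integral_iid0; last by mble.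
  rewrite [RHS]integral_iid0; last by mble.
  by rewrite /wt /dot !big_ord0 mul0r subr0 expR0 mul1e; congr F; exact: tuple0.
have [x [b ->]] := tuple_consP a.
rewrite [LHS]integral_iidS//; last by mble.
have mw : measurable_fun setT (fun Y => (wt (cons_pair (x, b)) Y)%:E * F Y) by mble.
have w0 Y : 0 <= (wt (cons_pair (x, b)) Y)%:E * F Y by rewrite mule_ge0// lee_fin wt_ge0.
rewrite [RHS](integral_iidS (@gauss R) mw w0).
under eq_integral => y _ do under eq_integral => Y _ do rewrite lin_cons !mul1r.
rewrite (gauss_shift x (F := fun y => \int[gaussn n]_Y F (cons_pair (y, lin 1 1 b Y)))).
- apply: eq_integral => y _.
  rewrite (IH b (fun Y => F (cons_pair (y, Y))))//; last by mble.
  rewrite -ge0_integralZl//; [|by mble|by move=> Y _; rewrite mule_ge0// lee_fin wt_ge0].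
  by apply: eq_integral => Y _; rewrite muleA -EFinM -wt_cons.
- apply: (measurable_fun_fubini_tonelli_F (fun z => F (cons_pair (z.1, lin 1 1 b z.2)))) => //.
  by mble.
- by move=> y; exact: integral_ge0.
Qed.

Lemma gaussn_wt n (a : n.-tuple mR) : \int[gaussn n]_Y (wt a Y)%:E = 1.
Proof.
have := @gaussn_shift n a (fun=> 1) (measurable_cst _) (fun=> lee01).
rewrite integral_prob_cst => ->.
by apply: eq_integral => Y _; rewrite mule1.
Qed.

(** Each pair of coordinates rotates in its own plane. This serves twice: to split one Gaussian
    field into two independent ones, and to turn a Gaussian vector progressively into an independent
    copy. *)
Lemma gaussn_rotation n (c s : R) (F : n.-tuple mR * n.-tuple mR -> \bar R) :
  (c ^+ 2 + s ^+ 2 = 1)%R -> (0 < c)%R ->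
  measurable_fun setT F -> (forall z, 0 <= F z) ->
  \int[gaussn n]_x \int[gaussn n]_y F (lin c s x y, lin c (- s) y x) =
  \int[gaussn n]_x \int[gaussn n]_y F (x, y).
Proof.
move=> cs c0; elim: n F => [|n IH] F mF F0.
  have mI (G : 0.-tuple mR * 0.-tuple mR -> \bar R) : measurable_fun setT G -> (forall z, 0 <= G z) ->
      \int[gaussn 0]_x \int[gaussn 0]_y G (x, y) = G ([tuple], [tuple]).
    move=> mG G0; rewrite integral_iid0; last exact: (measurable_fun_fubini_tonelli_F G).
    by rewrite integral_iid0//; mble.
  rewrite (mI (fun z => F (lin c s z.1 z.2, lin c (- s) z.2 z.1)))//; last by mble.
  by rewrite (mI F)//; congr (F (_, _)); exact: tuple0.
(* Fubini brings the two head coordinates outermost: the planar rotation acts on them and the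
   induction hypothesis on the tails. *)
have mI (G : n.+1.-tuple mR * n.+1.-tuple mR -> \bar R) : measurable_fun setT G -> (forall z, 0 <= G z) ->
    \int[gaussn n.+1]_x \int[gaussn n.+1]_y G (x, y) =
    \int[@gauss R]_x \int[@gauss R]_y \int[gaussn n]_X \int[gaussn n]_Y G (cons_pair (x, X), cons_pair (y, Y)).
  move=> mG G0; rewrite integral_iidS//; first last.
  - by move=> x; exact: integral_ge0.
  - exact: (measurable_fun_fubini_tonelli_F G).
  apply: eq_integral => x _.
  transitivity (\int[gaussn n]_X \int[@gauss R]_y \int[gaussn n]_Y G (cons_pair (x, X), cons_pair (y, Y))).
    apply: eq_integral => X _; rewrite integral_iidS//; by mble.
  rewrite (fubini_tonelli (fun z : n.-tuple mR * mR => \int[gaussn n]_Y G (cons_pair (x, z.1), cons_pair (z.2, Y))))//.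
    apply: (measurable_fun_fubini_tonelli_F (fun z : (n.-tuple mR * mR) * n.-tuple mR => G (cons_pair (x, z.1.1), cons_pair (z.1.2, z.2)))) => //.
    by mble.
  by move=> z; exact: integral_ge0.
have mK (K : (mR * mR) * (n.-tuple mR * n.-tuple mR) -> \bar R) : measurable_fun setT K -> (forall z, 0 <= K z) ->
   measurable_fun setT (fun z : mR * mR => \int[gaussn n]_X \int[gaussn n]_Y K (z, (X, Y))).
  move=> mK K0.
  apply: (measurable_fun_fubini_tonelli_F (fun z : (mR * mR) * (n.-tuple mR) => \int[gaussn n]_Y K (z.1, (z.2, Y)))).
  - apply: (measurable_fun_fubini_tonelli_F (fun z : ((mR * mR) * (n.-tuple mR)) * n.-tuple mR => K (z.1.1, (z.1.2, z.2)))) => //.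
    by mble.
  - by move=> z; exact: integral_ge0.
pose H (z : mR * mR) := \int[gaussn n]_X \int[gaussn n]_Y F (cons_pair (z.1, X), cons_pair (z.2, Y)).
transitivity (\int[@gauss R]_x \int[@gauss R]_y H (c * x + s * y, c * y - s * x)%R); last first.
  rewrite (gauss_rotation (F := H) cs c0); first by rewrite [RHS]mI.
  - apply: (mK (fun z => F (cons_pair (z.1.1, z.2.1), cons_pair (z.1.2, z.2.2)))) => //.
    by mble.
  - by move=> x; apply: integral_ge0 => X _; exact: integral_ge0.
transitivity (\int[@gauss R]_x \int[@gauss R]_y \int[gaussn n]_X \int[gaussn n]_Y
   F (lin c s (cons_pair (x, X)) (cons_pair (y, Y)), lin c (- s) (cons_pair (y, Y)) (cons_pair (x, X)))).
  by apply: (mI (fun z => F (lin c s z.1 z.2, lin c (- s) z.2 z.1))) => //; mble.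
apply: eq_integral => x _; apply: eq_integral => y _.
transitivity (\int[gaussn n]_X \int[gaussn n]_Y F (cons_pair (c * x + s * y, lin c s X Y), cons_pair (c * y - s * x, lin c (- s) Y X))%R).
  by apply: eq_integral => X _; apply: eq_integral => Y _ /=; rewrite !lin_cons mulNr.
apply: (IH (fun z => F (cons_pair (c * x + s * y, z.1), cons_pair (c * y - s * x, z.2))%R)) => //.
by mble.
Qed.

End gaussn.

(** * Tilted partition functions *)

Section expectation_lemmas.
Context d (T : measurableType d) (R : realType) (P : probability T R).
Implicit Types f g : T -> R.

Definition itg f := P.-integrable setT (EFin \o f).

Lemma itg_measurable f : itg f -> measurable_fun setT f.
Proof. by move=> /measurable_int/measurable_EFinP. Qed.

Lemma itg_ge0 f : measurable_fun setT f -> (forall x, 0 <= f x) ->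
  (\int[P]_x (f x)%:E < +oo)%E -> itg f.
Proof.
move=> mf f0 fy; apply/integrableP; split; first exact/measurable_EFinP.
by under eq_integral do rewrite /= ger0_norm//.
Qed.

Lemma itg_le f g : measurable_fun setT f -> (forall x, `|f x| <= g x) ->
  itg g -> itg f.
Proof.
move=> mf fg ig; apply: le_integrable ig => //; first exact/measurable_EFinP.
by move=> x _ /=; rewrite lee_fin (le_trans (fg x))// ler_norm.
Qed.

Lemma itgD f g : itg f -> itg g -> itg (fun x => f x + g x).
Proof. by move=> fi gi; exact: (integrableD measurableT fi gi). Qed.

Lemma itgZ c f : itg f -> itg (fun x => c * f x).
Proof. by move=> fi; exact: (integrableZl measurableT c fi). Qed.

Lemma itg_cst c : itg (fun=> c).
Proof. exact: finite_measure_integrable_cst. Qed.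

Lemma Rintegral_prob_cst c : \int[P]_x c = c.
Proof. by rewrite Rintegral_cst//= probability_setT/= mulr1. Qed.

Lemma ge0_RintegralE f : (forall x, 0 <= f x) -> itg f ->
  (\int[P]_x f x)%:E = (\int[P]_x (f x)%:E)%E.
Proof. by move=> f0 fi; rewrite /Rintegral fineK//; exact: integrable_fin_num. Qed.

Lemma RintegralEFin f r : (\int[P]_x (f x)%:E = r%:E)%E -> \int[P]_x f x = r.
Proof. by rewrite /Rintegral => ->. Qed.

(** A common format for the expansions to come; shorter ones are padded with zero coefficients. *)
Lemma Rintegral_lin3 c0 c1 c2 c3 f1 f2 f3 : itg f1 -> itg f2 -> itg f3 ->
  \int[P]_x (c0 + c1 * f1 x + c2 * f2 x + c3 * f3 x) =
  c0 + c1 * (\int[P]_x f1 x) + c2 * (\int[P]_x f2 x) + c3 * (\int[P]_x f3 x).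
Proof.
move=> i1 i2 i3.
have j0 := itg_cst c0.
have j1 := itgZ c1 i1; have j2 := itgZ c2 i2; have j3 := itgZ c3 i3.
rewrite RintegralD//; last by apply: itgD => //; apply: itgD.
rewrite RintegralD//; last exact: itgD.
by rewrite RintegralD// !RintegralZl// Rintegral_prob_cst.
Qed.

Lemma itg_lin3 c0 c1 c2 c3 f1 f2 f3 : itg f1 -> itg f2 -> itg f3 ->
  itg (fun x => c0 + c1 * f1 x + c2 * f2 x + c3 * f3 x).
Proof.
move=> i1 i2 i3; apply: itgD; last exact: itgZ.
apply: itgD; last exact: itgZ.
by apply: itgD; [exact: itg_cst|exact: itgZ].
Qed.

Lemma Rintegral_le f g : itg f -> itg g -> (forall x, f x <= g x) ->
  \int[P]_x f x <= \int[P]_x g x.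
Proof. by move=> fi gi fg; apply: le_Rintegral. Qed.

End expectation_lemmas.

Lemma measurable_Rintegral d d' (T : measurableType d) (T' : measurableType d')
    (R : realType) (P : probability T R) (f : T' -> T -> R) :
  measurable_fun setT (fun z : T' * T => f z.1 z.2) -> (forall y x, 0 <= f y x) ->
  measurable_fun setT (fun y => \int[P]_x f y x).
Proof.
move=> mf f0; apply: (measurableT_comp (@fine_measurable _ setT measurableT)) => //.
apply: (measurable_fun_fubini_tonelli_F (fun z : T' * T => (f z.1 z.2)%:E)) => //.
  exact/measurable_EFinP.
by move=> x; rewrite lee_fin.
Qed.

Section dot_algebra.
Variable R : realType.
Notation mR := (measurableTypeR R).
Notation gaussn := (iid (@gauss R)).

Lemma tnth_scal n c (a : n.-tuple mR) k : tnth (scal c a) k = c * tnth a k.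
Proof. by rewrite tnth_lin mul0r addr0. Qed.

Lemma dotC n (a b : n.-tuple mR) : dot a b = dot b a.
Proof. by apply: eq_bigr => k _; rewrite mulrC. Qed.

Lemma dot_linl n c s (a b z : n.-tuple mR) :
  dot (lin c s a b) z = c * dot a z + s * dot b z.
Proof.
rewrite /dot !mulr_sumr -big_split; apply: eq_bigr => k _.
by rewrite tnth_lin /=; ring.
Qed.

Lemma dot_linr n c s (a b z : n.-tuple mR) :
  dot z (lin c s a b) = c * dot z a + s * dot z b.
Proof. by rewrite dotC dot_linl ![dot _ z]dotC. Qed.

Lemma dot_scall n c (a z : n.-tuple mR) : dot (scal c a) z = c * dot a z.
Proof. by rewrite dot_linl mul0r addr0. Qed.

Lemma dot_scalr n c (a z : n.-tuple mR) : dot z (scal c a) = c * dot z a.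
Proof. by rewrite dotC dot_scall dotC. Qed.

Lemma dot_ge0 n (a : n.-tuple mR) : 0 <= dot a a.
Proof. by apply: sumr_ge0 => k _; rewrite -expr2 sqr_ge0. Qed.

Lemma dot_amgm n (a b : n.-tuple mR) : dot a b <= (dot a a + dot b b) / 2.
Proof.
have := dot_ge0 (lin 1 (-1) a b).
by rewrite dot_linl !dot_linr [dot b a]dotC; lra.
Qed.

Lemma wtM n (a b W : n.-tuple mR) :
  wt a W * wt b W = expR (dot a b) * wt (lin 1 1 a b) W.
Proof.
rewrite /wt -!expRD; congr expR.
by rewrite !dot_linl !dot_linr [dot b a]dotC; field.
Qed.

Lemma wtX n k (a W : n.-tuple mR) :
  wt a W ^+ k = expR ((k * k.-1)%:R / 2 * dot a a) * wt (scal k%:R a) W.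
Proof.
rewrite /wt -expRM_natl -expRD; congr expR.
rewrite !dot_scall dot_scalr.
case: k => [|k]; first by rewrite mul0n; ring.
by rewrite /= natrM -natr1; field.
Qed.

Lemma wt_bound n (a W : n.-tuple mR) : wt a W <= expR (dot W W / 2).
Proof. by rewrite ler_expR; have := dot_amgm a W; lra. Qed.

Lemma itg_wt n (a : n.-tuple mR) : itg (gaussn n) (wt a).
Proof.
apply: itg_ge0 => [||]; [by mble|by move=> W; exact: wt_ge0|].
by rewrite gaussn_wt ltry.
Qed.

Lemma Rintegral_wt n (a : n.-tuple mR) : \int[gaussn n]_W wt a W = 1.
Proof. by apply: RintegralEFin; rewrite gaussn_wt. Qed.

Lemma Rintegral_wtX n k (a : n.-tuple mR) :
  \int[gaussn n]_W (wt a W ^+ k) = expR ((k * k.-1)%:R / 2 * dot a a).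
Proof.
under eq_Rintegral do rewrite wtX.
by rewrite RintegralZl//; [rewrite Rintegral_wt mulr1|exact: itg_wt].
Qed.

Lemma itg_wtX n k (a : n.-tuple mR) : itg (gaussn n) (fun W => wt a W ^+ k).
Proof.
rewrite (_ : (fun W => _) = (fun W => expR ((k * k.-1)%:R / 2 * dot a a) * wt (scal k%:R a) W)).
  by apply: itgZ; exact: itg_wt.
by apply/funext => W; rewrite wtX.
Qed.

(** Expanding the power and using [Rintegral_wtX] gives the polynomial of [quartic_mgf_le] at v =
    dot a a, which is of order v ^+ 2 because its terms of order 0 and 1 cancel. *)
Lemma quartic_wt n (a : n.-tuple mR) :
  itg (gaussn n) (fun W => (wt a W - 1) ^+ 4) /\
  \int[gaussn n]_W ((wt a W - 1) ^+ 4) <= 42 * dot a a ^+ 2 * expR (6 * dot a a).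
Proof.
have e W : (wt a W - 1) ^+ 4 = (1 + -4 * wt a W + 6 * wt a W ^+ 2 + -4 * wt a W ^+ 3) + wt a W ^+ 4 by ring.
have i1 := itg_wt a; have i2 := itg_wtX 2 a; have i3 := itg_wtX 3 a; have i4 := itg_wtX 4 a.
have i5 := itg_lin3 1 (-4) 6 (-4) i1 i2 i3.
split.
  by rewrite (_ : (fun W => _) = (fun W => (1 + -4 * wt a W + 6 * wt a W ^+ 2 + -4 * wt a W ^+ 3) + wt a W ^+ 4)); [exact: itgD|apply/funext].
under eq_Rintegral do rewrite e.
rewrite RintegralD// Rintegral_lin3// !Rintegral_wtX Rintegral_wt/=.
have := quartic_mgf_le (dot_ge0 a).
rewrite (_ : (2 * 1)%:R / 2 * dot a a = dot a a); last by field.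
rewrite (_ : (3 * 2)%:R / 2 * dot a a = 3 * dot a a); last by field.
rewrite (_ : (4 * 3)%:R / 2 * dot a a = 6 * dot a a); last by field.
lra.
Qed.

End dot_algebra.

Ltac pos1 := match goal with
  | |- is_true (0 <= _ ^+ 2) => exact: sqr_ge0
  | |- is_true (0 <= _ ^+ _) => first [exact: exprn_even_ge0 | apply: exprn_ge0]
  | |- is_true (0 <= expR _) => exact: expR_ge0
  | |- is_true (0 <= wt _ _) => exact: wt_ge0
  | |- is_true (0 <= `|_|) => exact: normr_ge0
  | |- is_true (0 <= _ * _) => apply: mulr_ge0
  | |- is_true (0 <= _ + _) => apply: addr_ge0
  | |- is_true (0 <= _ ^-1) => rewrite invr_ge0
  | |- _ => first [done | exact: ltW | exact: powR_ge0]
  end.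
Ltac pos := repeat pos1.

Section partition_function.
Context d (X : measurableType d) (R : realType) (mu : probability X R).
Notation mR := (measurableTypeR R).
Notation gaussn := (iid (@gauss R)).
Variables (n : nat) (rho : X -> mR) (u : X -> n.-tuple mR).
Hypothesis rho_ge0 : forall x, 0 <= rho x.
Hypothesis irho : itg mu rho.
Hypothesis mu_u : measurable_fun setT u.

(** A partition function with signal u and prior density rho. For rho = 1 it is the likelihood ratio
    of the observation u x + noise to pure noise. *)
Definition part (W : n.-tuple mR) : R := \int[mu]_x (rho x * wt (u x) W).

Let mrho : measurable_fun setT rho := itg_measurable irho.

Lemma part_integrand_ge0 x W : 0 <= rho x * wt (u x) W.
Proof. by rewrite mulr_ge0// wt_ge0. Qed.

Lemma itg_part W : itg mu (fun x => rho x * wt (u x) W).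
Proof.
apply: (itg_le (g := fun x => expR (dot W W / 2) * rho x)); [by mble| |exact: itgZ].
move=> x; rewrite ger0_norm ?part_integrand_ge0// mulrC ler_wpM2r//; exact: wt_bound.
Qed.

Lemma partE W : (part W)%:E = (\int[mu]_x (rho x * wt (u x) W)%:E)%E.
Proof. by rewrite /part ge0_RintegralE//; [move=> x; exact: part_integrand_ge0|exact: itg_part]. Qed.

Lemma part_ge0 W : 0 <= part W.
Proof. by apply: Rintegral_ge0 => x _; exact: part_integrand_ge0. Qed.

Lemma measurable_part : measurable_fun setT part.
Proof.
apply: measurable_Rintegral; last by move=> W x; exact: part_integrand_ge0.
by mble.
Qed.

Lemma integral_part_wt (b : n.-tuple mR) :
  (\int[gaussn n]_W (part W * wt b W)%:E = \int[mu]_x (rho x * expR (dot (u x) b))%:E)%E.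
Proof.
transitivity (\int[gaussn n]_W \int[mu]_x (rho x * wt (u x) W * wt b W)%:E)%E.
  apply: eq_integral => W _; rewrite EFinM partE -ge0_integralZr//; [by mble| |by rewrite lee_fin wt_ge0].
  by move=> x _; rewrite lee_fin part_integrand_ge0.
rewrite (fubini_tonelli (fun z : n.-tuple mR * X => (rho z.2 * wt (u z.2) z.1 * wt b z.1)%:E)%E)//; first last.
- by move=> z; rewrite lee_fin mulr_ge0 ?wt_ge0 ?part_integrand_ge0.
- by mble.
apply: eq_integral => x _ /=.
under eq_integral => W _ do rewrite -mulrA wtM mulrA EFinM.
rewrite ge0_integralZl//; first by rewrite gaussn_wt mule1.
- by mble.
- by move=> W _; rewrite lee_fin wt_ge0.
- by rewrite lee_fin mulr_ge0// expR_ge0.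
Qed.

Lemma integral_part : (\int[gaussn n]_W (part W)%:E = \int[mu]_x (rho x)%:E)%E.
Proof.
transitivity (\int[gaussn n]_W \int[mu]_x (rho x * wt (u x) W)%:E)%E.
  by apply: eq_integral => W _; rewrite partE.
rewrite (fubini_tonelli (fun z : n.-tuple mR * X => (rho z.2 * wt (u z.2) z.1)%:E)%E)//; first last.
- by move=> z; rewrite lee_fin part_integrand_ge0.
- by mble.
apply: eq_integral => x _ /=.
under eq_integral => W _ do rewrite EFinM.
rewrite ge0_integralZl//; first by rewrite gaussn_wt mule1.
- by mble.
- by move=> W _; rewrite lee_fin wt_ge0.
- by rewrite lee_fin.
Qed.

Lemma integral_part_sqr :
  (\int[gaussn n]_W (part W ^+ 2)%:E =
   \int[mu]_y \int[mu]_x (rho y * (rho x * expR (dot (u x) (u y))))%:E)%E.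
Proof.
have mp := measurable_part.
transitivity (\int[gaussn n]_W \int[mu]_y (part W * (rho y * wt (u y) W))%:E)%E.
  apply: eq_integral => W _; rewrite expr2 EFinM {2}partE.
  under [RHS]eq_integral => y _ do rewrite EFinM.
  rewrite ge0_integralZl//; [by mble| |by rewrite lee_fin part_ge0].
  by move=> x _; rewrite lee_fin part_integrand_ge0.
rewrite (fubini_tonelli (fun z : n.-tuple mR * X => (part z.1 * (rho z.2 * wt (u z.2) z.1))%:E)%E)//; first last.
- by move=> z; rewrite lee_fin mulr_ge0 ?part_ge0 ?part_integrand_ge0.
- apply/measurable_EFinP; apply: measurable_funM; last by mble.
  exact: (measurableT_comp mp measurable_fst).
apply: eq_integral => y _ /=.
transitivity (\int[gaussn n]_W ((rho y)%:E * (part W * wt (u y) W)%:E))%E.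
  by apply: eq_integral => W _; rewrite mulrCA EFinM.
rewrite ge0_integralZl//; first last.
- by rewrite lee_fin.
- by move=> W _; rewrite lee_fin mulr_ge0 ?part_ge0 ?wt_ge0.
- by mble.
rewrite integral_part_wt -ge0_integralZl//.
- by mble.
- by move=> x _; rewrite lee_fin mulr_ge0// expR_ge0.
- by rewrite lee_fin.
Qed.

Hypothesis rho1 : \int[mu]_x rho x = 1.

Let rho1E : (\int[mu]_x (rho x)%:E = 1)%E.
Proof. by rewrite -ge0_RintegralE// rho1. Qed.

Lemma itg_part_gauss : itg (gaussn n) part.
Proof.
apply: itg_ge0; [exact: measurable_part|exact: part_ge0|].
by rewrite integral_part rho1E ltry.
Qed.

Lemma Rintegral_part : \int[gaussn n]_W part W = 1.
Proof. by apply: RintegralEFin; rewrite integral_part rho1E. Qed.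

(** Jensen for the probability rho mu, through the tangent line of t ^+ 4 at c = part W - 1: the gap
    is (t - c) ^+ 2 * ((t + c) ^+ 2 + 2 * c ^+ 2). *)
Lemma part_jensen4 W : (part W - 1) ^+ 4 <= \int[mu]_x (rho x * (wt (u x) W - 1) ^+ 4).
Proof.
set c := part W - 1.
have i1 := irho; have i2 := itg_part W.
have i3 : itg mu (fun x => rho x * (wt (u x) W - 1) ^+ 4).
  apply: (itg_le (g := fun x => (expR (dot W W / 2) + 1) ^+ 4 * rho x)); [by mble| |exact: itgZ].
  move=> x; rewrite ger0_norm; last by rewrite mulr_ge0// exprn_even_ge0.
  rewrite mulrC ler_wpM2r//.
  rewrite -(ger0_norm (exprn_even_ge0 (wt (u x) W - 1) (isT : ~~ odd 4))) normrX.
  rewrite lerXn2r ?nnegrE ?addr_ge0 ?expR_ge0//.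
  by apply: (le_trans (ler_normB _ _)); rewrite normr1 ger0_norm ?wt_ge0// lerD2r wt_bound.
have /(Rintegral_le (itg_lin3 0 (- 4 * c ^+ 3 - 3 * c ^+ 4) (4 * c ^+ 3) 0 i1 i2 i1) i3) : forall x,
   0 + (- 4 * c ^+ 3 - 3 * c ^+ 4) * rho x + 4 * c ^+ 3 * (rho x * wt (u x) W) + 0 * rho x
   <= rho x * (wt (u x) W - 1) ^+ 4.
  move=> x; rewrite -subr_ge0; set y := wt (u x) W.
  rewrite (_ : _ - _ = rho x * ((y - 1 - c) ^+ 2 * ((y - 1 + c) ^+ 2 + 2 * c ^+ 2))); last by ring.
  apply: mulr_ge0 => //; apply: mulr_ge0; first exact: sqr_ge0.
  by apply: addr_ge0; [exact: sqr_ge0|apply: mulr_ge0 => //; exact: sqr_ge0].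
rewrite Rintegral_lin3// rho1 -/(part W).
by rewrite (_ : part W = c + 1); [lra|rewrite /c subrK].
Qed.

Variable c : R.
Hypothesis uc : forall x y, dot (u x) (u y) <= c.

Lemma part_moment4 :
  itg (gaussn n) (fun W => (part W - 1) ^+ 4) /\
  \int[gaussn n]_W (part W - 1) ^+ 4 <= 42 * c ^+ 2 * expR (6 * c).
Proof.
have mp := measurable_part.
pose K := 42 * c ^+ 2 * expR (6 * c).
have p0 W : 0 <= (part W - 1) ^+ 4 by exact: exprn_even_ge0.
have q0 x W : 0 <= rho x * (wt (u x) W - 1) ^+ 4 by rewrite mulr_ge0// exprn_even_ge0.
suff le : (\int[gaussn n]_W ((part W - 1) ^+ 4)%:E <= K%:E)%E.
  have i : itg (gaussn n) (fun W => (part W - 1) ^+ 4).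
    apply: itg_ge0 => //; first by mble.
    by apply: le_lt_trans le _; rewrite ltry.
  by split => //; rewrite -lee_fin ge0_RintegralE.
apply: (@le_trans _ _ (\int[gaussn n]_W \int[mu]_x (rho x * (wt (u x) W - 1) ^+ 4)%:E)%E).
  apply: ge0_le_integral => //.
  - by move=> W _; rewrite lee_fin.
  - by mble.
  - apply: (measurable_fun_fubini_tonelli_F (fun z : n.-tuple mR * X => (rho z.2 * (wt (u z.2) z.1 - 1) ^+ 4)%:E)) => [|z]; last by rewrite lee_fin.
    by mble.
  - move=> W _; apply: le_trans (_ : (\int[mu]_x (rho x * (wt (u x) W - 1) ^+ 4))%:E <= _)%E; first by rewrite lee_fin part_jensen4.
    rewrite /Rintegral; have [/fineK ->//|] := boolP (\int[mu]_x (rho x * (wt (u x) W - 1) ^+ 4)%:E \is a fin_num)%E.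
    have : (0 <= \int[mu]_x (rho x * (wt (u x) W - 1) ^+ 4)%:E)%E by apply: integral_ge0 => x _; rewrite lee_fin.
    by case: (\int[mu]_x _)%E => //= _ _; exact: leey.
rewrite (fubini_tonelli (fun z : n.-tuple mR * X => (rho z.2 * (wt (u z.2) z.1 - 1) ^+ 4)%:E)%E)//; first last.
- by move=> z; rewrite lee_fin.
- by mble.
rewrite -[leRHS]mul1e -rho1E -ge0_integralZr//; first last.
- by rewrite lee_fin /K; pos.
- by move=> x _; rewrite lee_fin.
- by mble.
apply: ge0_le_integral => //.
- by move=> x _; apply: integral_ge0 => W _; rewrite lee_fin.
- apply: (measurable_fun_fubini_tonelli_G (fun z : n.-tuple mR * X => (rho z.2 * (wt (u z.2) z.1 - 1) ^+ 4)%:E)) => [|z]; last by rewrite lee_fin.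
  by mble.
- by mble.
- move=> x _ /=; under eq_integral => W _ do rewrite EFinM.
  rewrite ge0_integralZl//; first last.
  + by rewrite lee_fin.
  + by move=> W _; rewrite lee_fin exprn_even_ge0.
  + by mble.
  have [i4 le4] := quartic_wt (u x).
  rewrite -ge0_RintegralE//; last by move=> W; rewrite exprn_even_ge0.
  rewrite -!EFinM lee_fin ler_wpM2l//; apply: (le_trans le4).
  have := uc x x; have := dot_ge0 (u x) => a0 ac.
  apply: ler_pM; [by pos|by pos| |].
    by rewrite ler_wpM2l// lerXn2r ?nnegrE ?(le_trans a0 ac).
  by rewrite ler_expR; lra.
Qed.

Lemma integral_part_sqr_le : (\int[gaussn n]_W (part W ^+ 2)%:E <= (expR c)%:E)%E.
Proof.
rewrite integral_part_sqr.
have -> : (expR c)%:E = (\int[mu]_y \int[mu]_x (rho y * (rho x * expR c))%:E)%E.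
  transitivity (\int[mu]_y (rho y * expR c)%:E)%E.
    under eq_integral => y _ do rewrite EFinM.
    by rewrite ge0_integralZr// ?rho1E ?mul1e ?lee_fin ?expR_ge0//; [by mble|by move=> x _; rewrite lee_fin].
  apply: eq_integral => y _.
  under [RHS]eq_integral => x _ do rewrite EFinM EFinM.
  rewrite ge0_integralZl//; first last.
  - by rewrite lee_fin.
  - by move=> x _; rewrite -EFinM lee_fin mulr_ge0// expR_ge0.
  - by mble.
  by rewrite ge0_integralZr// ?rho1E ?mul1e ?lee_fin ?expR_ge0//; [by mble|by move=> x _; rewrite lee_fin].
have m (f : X -> X -> R) : measurable_fun setT (fun z : X * X => f z.1 z.2) -> (forall y x, 0 <= f y x) ->
    measurable_fun setT (fun y => \int[mu]_x (rho y * (rho x * f y x))%:E)%E.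
  move=> mf f0.
  apply: (measurable_fun_fubini_tonelli_F (fun z : X * X => (rho z.1 * (rho z.2 * f z.1 z.2))%:E)%E) => [|z].
    by apply/measurable_EFinP/measurable_funM; [mble|apply: measurable_funM => //; mble].
  by rewrite lee_fin !mulr_ge0.
apply: ge0_le_integral; [exact: measurableT| | | |].
- by move=> y _; apply: integral_ge0 => x _; rewrite lee_fin !mulr_ge0 ?expR_ge0.
- by apply: (m (fun y x => expR (dot (u x) (u y)))) => [|y x]; [mble|exact: expR_ge0].
- by apply: (m (fun y x => expR c)) => [|y x]; [mble|exact: expR_ge0].
move=> y _; apply: ge0_le_integral => //.
- by move=> x _; rewrite lee_fin !mulr_ge0 ?expR_ge0.
- by mble.
- by mble.
- by move=> x _; rewrite lee_fin !ler_wpM2l// ler_expR.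
Qed.

Lemma itg_part_sqr : itg (gaussn n) (fun W => part W ^+ 2).
Proof.
have mp := measurable_part.
apply: itg_ge0; [by mble|by move=> W; exact: sqr_ge0|].
by apply: le_lt_trans integral_part_sqr_le _; rewrite ltry.
Qed.

Definition part2 := \int[gaussn n]_W part W ^+ 2.

Lemma part2_le : part2 <= expR c.
Proof.
rewrite -lee_fin ge0_RintegralE ?integral_part_sqr_le//; last exact: itg_part_sqr.
by move=> W; exact: sqr_ge0.
Qed.

Lemma part_moment2 : itg (gaussn n) (fun W => (part W - 1) ^+ 2) /\
  \int[gaussn n]_W (part W - 1) ^+ 2 = part2 - 1.
Proof.
have e W : (part W - 1) ^+ 2 = 1 + -2 * part W + 1 * part W ^+ 2 + 0 * part W by ring.
split.
  by rewrite (_ : (fun W => _) = (fun W => 1 + -2 * part W + 1 * part W ^+ 2 + 0 * part W)); [apply: itg_lin3 => //; [exact: itg_part_gauss|exact: itg_part_sqr|exact: itg_part_gauss]|apply/funext].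
under eq_Rintegral do rewrite e.
rewrite Rintegral_lin3; [|exact: itg_part_gauss|exact: itg_part_sqr|exact: itg_part_gauss].
by rewrite Rintegral_part -/part2; lra.
Qed.

Lemma part2_ge1 : 1 <= part2.
Proof.
have [_ e] := part_moment2.
by rewrite -subr_ge0 -e; apply: Rintegral_ge0 => W _; exact: sqr_ge0.
Qed.

End partition_function.

Lemma moment_sandwich (R : realType) (a C s m q k x : R) :
  1 - a + a * 1 + (- (a * (1 - a) / 2) - C * s) * m + - C / s * q <= x ->
  x <= 1 - a + a * 1 + (- (a * (1 - a) / 2) + C * s) * m + C / s * q ->
  C / s * q <= C * (k / s) ->
  `|x - (1 - a * (1 - a) / 2 * m)| <= C * (s * m + k / s).
Proof. by move=> h1 h2 h3; rewrite ler_norml; apply/andP; split; lra. Qed.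

Section fractional_moment.
Context (R : realType) (a : R).
Hypothesis a01 : 0 < a < 1.
Notation mR := (measurableTypeR R).
Notation gaussn := (iid (@gauss R)).

(** As [part] has Gaussian mean one, the linear term of the expansion vanishes and the variance
    [part2] - 1 alone decides the fractional moment at leading order. Two fields with close
    covariances therefore have close fractional moments. *)
Lemma powR_part_moment : exists2 C, 0 <= C &
  forall d (X : measurableType d) (mu : probability X R) n (rho : X -> mR) (u : X -> n.-tuple mR),
  (forall x, 0 <= rho x) -> itg mu rho -> measurable_fun setT u -> \int[mu]_x rho x = 1 ->
  forall c s, (forall x y, dot (u x) (u y) <= c) -> 0 < s ->
  `|\int[gaussn n]_W (part mu rho u W `^ a) -
      (1 - a * (1 - a) / 2 * (part2 mu rho u - 1))| <=
   C * (s * (part2 mu rho u - 1) + 42 * c ^+ 2 * expR (6 * c) / s).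
Proof.
have [C C0 HC] := powR_taylor_quartic a01.
exists C => // d X mu n rho u rho0 irho mu_u rho1 c s uc s0.
have mp := measurable_part rho0 irho mu_u.
have p0 W : 0 <= part mu rho u W by exact: part_ge0.
have i1 := itg_part_gauss rho0 irho mu_u rho1.
have E1 := Rintegral_part rho0 irho mu_u rho1.
have [i2 E2] := part_moment2 rho0 irho mu_u rho1 uc.
have [i4 E4] := part_moment4 rho0 irho mu_u rho1 uc.
case/andP: (a01) => a0 a1.
set I := part mu rho u in mp p0 i1 E1 i2 E2 i4 E4 *.
set M := part2 mu rho u in E2 *.
have ia : itg (gaussn n) (fun W => I W `^ a).
  apply: (itg_le (g := fun W => 1 + 1 * I W + 0 * I W + 0 * I W)).
  - exact: (measurableT_comp (measurable_powR _) mp).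
  - move=> W; rewrite ger0_norm ?powR_ge0// !mul0r !addr0 mul1r.
    have [h|h] := leP 1 (I W); first by apply: (le_trans (ler1_powR h (ltW a1))); rewrite lerDr.
    have [->|dn] := eqVneq (I W) 0; first by rewrite powR0 ?gt_eqF// addr0.
    apply: (@le_trans _ _ 1); last by rewrite lerDl.
    by rewrite /powR (negbTE dn) expR_le1 mulr_ge0_le0 ?(ltW a0)// ln_le0// ltW.
  - exact: itg_lin3.
have i3 := itg_lin3 (1 - a) a (- (a * (1 - a) / 2) - C * s) (- C / s) i1 i2 i4.
have j3 := itg_lin3 (1 - a) a (- (a * (1 - a) / 2) + C * s) (C / s) i1 i2 i4.
have HW W : `|I W `^ a - (1 + a * (I W - 1) - a * (1 - a) / 2 * (I W - 1) ^+ 2)| <= C * (s * (I W - 1) ^+ 2 + (I W - 1) ^+ 4 / s).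
  have := HC (I W - 1) s; rewrite [1 + (I W - 1)]addrC subrK; apply => //.
  by rewrite lerBrDr addNr p0.
have lo := Rintegral_le i3 ia.
have hi := Rintegral_le ia j3.
rewrite !Rintegral_lin3// E1 E2 in lo hi.
have {}lo : 1 - a + a * 1 + (- (a * (1 - a) / 2) - C * s) * (M - 1) + - C / s * (\int[gaussn n]_W ((I W - 1) ^+ 4)) <= \int[gaussn n]_W (I W `^ a).
  apply: lo => W; have := HW W; rewrite ler_distl => /andP[h _].
  by apply: le_trans h; rewrite le_eqVlt; apply/orP; left; apply/eqP; field; rewrite gt_eqF.
have {}hi : \int[gaussn n]_W (I W `^ a) <= 1 - a + a * 1 + (- (a * (1 - a) / 2) + C * s) * (M - 1) + C / s * (\int[gaussn n]_W ((I W - 1) ^+ 4)).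
  apply: hi => W; have := HW W; rewrite ler_distl => /andP[_ h].
  by apply: (le_trans h); rewrite le_eqVlt; apply/orP; left; apply/eqP; field; rewrite gt_eqF.
have k4 : C / s * (\int[gaussn n]_W ((I W - 1) ^+ 4)) <= C * (42 * c ^+ 2 * expR (6 * c) / s).
  rewrite mulrAC -mulrA ler_wpM2l// ler_wpM2r// invr_ge0 ltW//.
exact: moment_sandwich lo hi k4.
Qed.

End fractional_moment.

(** * Gaussian comparison of fractional moments *)

Section part_extra.
Context d (X : measurableType d) (R : realType) (mu : probability X R).
Notation mR := (measurableTypeR R).
Notation gaussn := (iid (@gauss R)).

Lemma part2_compare n m (rho : X -> mR) (u : X -> n.-tuple mR) (v : X -> m.-tuple mR) (k c : R) :
  (forall x, 0 <= rho x) -> itg mu rho -> measurable_fun setT u -> measurable_fun setT v ->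
  \int[mu]_x rho x = 1 ->
  (forall x y, dot (u x) (u y) <= c) -> (forall x y, dot (v x) (v y) <= c) ->
  (forall x y, dot (v x) (v y) <= dot (u x) (u y) + k) ->
  part2 mu rho v <= expR k * part2 mu rho u.
Proof.
move=> rho0 irho mfu mfv rho1 uc vc uvk.
have mrho := itg_measurable irho.
rewrite -lee_fin EFinM !ge0_RintegralE; first last.
- exact: itg_part_sqr vc.
- by move=> W; exact: sqr_ge0.
- exact: itg_part_sqr uc.
- by move=> W; exact: sqr_ge0.
rewrite !integral_part_sqr//.
have mf2 (f : X -> X -> R) : measurable_fun setT (fun z : X * X => f z.1 z.2) -> (forall y x, 0 <= f y x) ->
    measurable_fun setT (fun y => \int[mu]_x (rho y * (rho x * f y x))%:E)%E.
  move=> mf f0.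
  apply: (measurable_fun_fubini_tonelli_F (fun z : X * X => (rho z.1 * (rho z.2 * f z.1 z.2))%:E)%E) => [|z].
    by apply/measurable_EFinP/measurable_funM; [mble|apply: measurable_funM => //; mble].
  by rewrite lee_fin !mulr_ge0.
have m1 : measurable_fun setT (fun y => \int[mu]_x (rho y * (rho x * expR (dot (u x) (u y))))%:E)%E.
  by apply: (mf2 (fun y x => expR (dot (u x) (u y)))) => [|y x]; [mble|exact: expR_ge0].
rewrite -ge0_integralZl//; first last.
- by move=> y _; apply: integral_ge0 => x _; rewrite lee_fin !mulr_ge0 ?expR_ge0.
apply: ge0_le_integral; [exact: measurableT| | | |].
- by move=> y _; apply: integral_ge0 => x _; rewrite lee_fin !mulr_ge0 ?expR_ge0.
- by apply: (mf2 (fun y x => expR (dot (v x) (v y)))) => [|y x]; [mble|exact: expR_ge0].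
- by apply: emeasurable_funM => //; mble.
move=> y _; rewrite -ge0_integralZl//; first last.
- by move=> x _; rewrite lee_fin !mulr_ge0 ?expR_ge0.
- by mble.
apply: ge0_le_integral => //.
- by move=> x _; rewrite lee_fin !mulr_ge0 ?expR_ge0.
- by mble.
- by mble.
- move=> x _; rewrite -EFinM lee_fin [leRHS]mulrCA; apply: ler_wpM2l => //; rewrite [leRHS]mulrCA; apply: ler_wpM2l => //.
  by rewrite -expRD ler_expR addrC.
Qed.

Lemma part_scale n (rho : X -> mR) (u : X -> n.-tuple mR) (c : R) W :
  (forall x, 0 <= rho x) -> itg mu rho -> measurable_fun setT u ->
  part mu (fun x => c * rho x) u W = c * part mu rho u W.
Proof.
move=> rho0 irho mfu; rewrite /part -RintegralZl//; last exact: itg_part.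
by apply: eq_Rintegral => x _; rewrite mulrA.
Qed.

Lemma part_null n (rho : X -> mR) (u : X -> n.-tuple mR) W :
  (forall x, 0 <= rho x) -> itg mu rho -> measurable_fun setT u ->
  \int[mu]_x rho x = 0 -> part mu rho u W = 0.
Proof.
move=> rho0 irho mfu r0; apply/eqP; rewrite eq_le part_ge0// andbT.
rewrite -(mulr0 (expR (dot W W / 2))) -r0 -RintegralZl//.
apply: Rintegral_le; [exact: itg_part|exact: itgZ|].
by move=> x; rewrite mulrC ler_wpM2r// wt_bound.
Qed.

Lemma itg_part_powR n (rho : X -> mR) (u : X -> n.-tuple mR) (a : R) :
  0 < a < 1 -> (forall x, 0 <= rho x) -> itg mu rho -> measurable_fun setT u ->
  itg (gaussn n) (fun W => part mu rho u W `^ a).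
Proof.
move=> /andP[a0 a1] rho0 irho mfu.
have mp := measurable_part rho0 irho mfu.
have p0 W : 0 <= part mu rho u W by exact: part_ge0.
apply: (itg_le (g := fun W => 1 + part mu rho u W)).
- exact: (measurableT_comp (measurable_powR _) mp).
- move=> W; rewrite ger0_norm ?powR_ge0//; move: (part _ _ _ W) (p0 W) => I I0.
  have [h|h] := leP 1 I; first by apply: (le_trans (ler1_powR h (ltW a1))); lra.
  have [->|dn] := eqVneq I 0; first by rewrite powR0 ?gt_eqF// addr0.
  apply: (@le_trans _ _ 1); last by lra.
  by rewrite /powR (negbTE dn) expR_le1 mulr_ge0_le0 ?(ltW a0)// ln_le0// ltW.
- apply: itgD; first exact: itg_cst.
  apply: itg_ge0 => //; rewrite integral_part// -ge0_RintegralE// ltry.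
  by [].
Qed.

End part_extra.

Section comparison_step.
Context (R : realType) (a : R).
Hypothesis a01 : 0 < a < 1.
Notation mR := (measurableTypeR R).
Notation gaussn := (iid (@gauss R)).

(** A and A' are the fractional moments for the fields u and v, Mu and Mv the second moments, b = a
    (1 - a) / 2. From Mv - Mu <= k s ^+ 2 + O(s ^+ 3) follows A - A' <= b k s ^+ 2 + O(s ^+ 3). The
    smallness condition on s forces A' >= 1/2, which turns the additive error into a multiplicative
    one. *)
Lemma comparison_arith (b C k B Q k1 k2 s Mu Mv A A' e q : R) :
  let K3 := (1 + C) * B + C * Q in
  let K2 := k1 + k2 * B + 2 * C * (B + Q) in
  0 <= b <= 1 -> 0 <= C -> 0 <= k -> 0 <= B -> 0 <= Q -> 0 <= k1 -> 0 <= k2 ->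
  0 < s -> s <= 1 -> s * (2 * K3 + 1) <= 1 ->
  1 <= e -> e - 1 <= s ^+ 2 * k + (s ^+ 2) ^+ 2 * k1 -> e - 1 <= s ^+ 2 * k2 ->
  1 <= Mu -> 1 <= Mv -> Mu <= 1 + s ^+ 2 * B -> Mv <= 1 + s ^+ 2 * B -> Mv <= e * Mu ->
  A <= C * (s * (Mu - 1) + q) + (1 - b * (Mu - 1)) ->
  1 - b * (Mv - 1) - A' <= C * (s * (Mv - 1) + q) -> q <= s ^+ 3 * Q ->
  A <= (1 + b * k * s ^+ 2 + 2 * (k * K3 + K2) * s ^+ 3) * A'.
Proof.
move=> K3 K2 /andP[b0 b1] C0 k0 B0 Q0 k10 k20 s0 s1 sK e1 eK eK' Mu1 Mv1 Mu3 Mv3 Mvu Hu Hv eQ.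
have sn0 := ltW s0; have h0 : 0 <= s ^+ 2 by exact: sqr_ge0.
have K30 : 0 <= K3 by rewrite /K3; pos.
have K20 : 0 <= K2 by rewrite /K2; pos.
have t3 : s ^+ 3 <= s ^+ 2 by rewrite [leLHS]exprS ler_piMl.
have t4 : (s ^+ 2) ^+ 2 <= s ^+ 3 by rewrite -exprM [leLHS]exprS ler_piMl// exprn_ge0.
have t30 : 0 <= s ^+ 3 by exact: exprn_ge0.
have sM M : M <= 1 + s ^+ 2 * B -> s * (M - 1) <= s ^+ 3 * B.
  by move=> h; rewrite [s ^+ 3]exprS -mulrA ler_wpM2l// lerBlDl.
have sMu := sM _ Mu3; have sMv := sM _ Mv3.
have D1 : Mv - Mu <= s ^+ 2 * k + s ^+ 3 * (k1 + k2 * B).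
  have h1 : (e - 1) * (Mu - 1) <= (s ^+ 2 * k2) * (s ^+ 2 * B).
    by apply: ler_pM => //; rewrite ?subr_ge0// lerBlDl.
  have q1 : (s ^+ 2) ^+ 2 * k1 <= s ^+ 3 * k1 by apply: ler_wpM2r.
  have q2 : (s ^+ 2) ^+ 2 * (k2 * B) <= s ^+ 3 * (k2 * B) by apply: ler_wpM2r => //; pos.
  move: h1 q1 q2 eK Mvu; clear; lra.
have x1v : b * (Mv - 1) <= s ^+ 2 * B.
  by apply: (@le_trans _ _ (Mv - 1)); [rewrite ler_piMl// subr_ge0|rewrite lerBlDl].
have x2v : C * (s * (Mv - 1) + q) <= C * (s ^+ 3 * B + s ^+ 3 * Q).
  by apply: ler_wpM2l => //; apply: lerD.
have x2u : C * (s * (Mu - 1) + q) <= C * (s ^+ 3 * B + s ^+ 3 * Q).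
  by apply: ler_wpM2l => //; apply: lerD.
have x3 : C * (s ^+ 3 * B + s ^+ 3 * Q) <= C * (s ^+ 2 * B + s ^+ 2 * Q).
  by apply: ler_wpM2l => //; apply: lerD; apply: ler_wpM2r.
have A'lo : 1 - K3 * s ^+ 2 <= A'.
  by rewrite /K3; move: x1v x2v x3 Hv; clear; lra.
have A'half : 2^-1 <= A'.
  have : K3 * s ^+ 2 <= K3 * s by apply: ler_wpM2l => //; rewrite expr2 ler_piMl.
  by move: sK A'lo s0; clear; lra.
have x1 : b * (Mv - Mu) <= b * k * s ^+ 2 + (k1 + k2 * B) * s ^+ 3.
  apply: (le_trans (ler_wpM2l b0 D1)); rewrite mulrDr; apply: lerD; first by rewrite -mulrA [k * _]mulrC.
  by rewrite mulrCA [leRHS]mulrC ler_wpM2l// ler_piMl//; pos.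
have AA' : A <= A' + b * k * s ^+ 2 + K2 * s ^+ 3.
  by rewrite /K2; move: x1 x2v x2u Hu Hv; clear; lra.
have y1 : b * k * s ^+ 2 * (1 - A') <= k * K3 * s ^+ 3.
  apply: (@le_trans _ _ (b * k * s ^+ 2 * (K3 * s ^+ 2))).
    by apply: ler_wpM2l; [pos|rewrite lerBlDl -lerBlDr].
  rewrite (_ : b * k * s ^+ 2 * (K3 * s ^+ 2) = b * (k * K3 * (s ^+ 2) ^+ 2)); last by ring.
  apply: (@le_trans _ _ (k * K3 * (s ^+ 2) ^+ 2)); first by rewrite ler_piMl//; pos.
  by apply: ler_wpM2l => //; pos.
have y2 : (k * K3 + K2) * s ^+ 3 <= 2 * (k * K3 + K2) * s ^+ 3 * A'.
  rewrite (_ : 2 * (k * K3 + K2) * s ^+ 3 * A' = (k * K3 + K2) * s ^+ 3 * (2 * A')); last by ring.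
  rewrite ler_peMr//; first by pos.
  by move: A'half; clear; lra.
by apply: (le_trans AA'); move: y1 y2; clear; lra.
Qed.

(** One small step of Kahane's interpolation, with a second order expansion in the role of Gaussian
    integration by parts. K and s0 depend neither on the measure, nor on the density, nor on the
    dimensions, so the same step serves along the whole path. *)
Lemma comparison_step_normalized (k c : R) : 0 <= k -> 0 <= c -> exists2 K, 0 <= K & exists2 s0, 0 < s0 &
  forall d (X : measurableType d) (mu : probability X R) n m (rho : X -> mR)
    (u : X -> n.-tuple mR) (v : X -> m.-tuple mR) s, 0 < s <= s0 ->
  (forall x, 0 <= rho x) -> itg mu rho -> measurable_fun setT u -> measurable_fun setT v ->
  (forall x y, dot (u x) (u y) <= c) -> (forall x y, dot (v x) (v y) <= c) ->
  (forall x y, dot (v x) (v y) <= dot (u x) (u y) + k) ->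
  \int[mu]_x rho x = 1 ->
  \int[gaussn n]_W (part mu rho (scal s \o u) W `^ a) <=
  (1 + a * (1 - a) / 2 * k * s ^+ 2 + K * s ^+ 3) *
    \int[gaussn m]_W (part mu rho (scal s \o v) W `^ a).
Proof.
move=> k0 c0; have [C C0 HC] := powR_part_moment a01.
pose b := a * (1 - a) / 2.
have b01 : 0 <= b <= 1 by case/andP: a01 => ? ?; rewrite /b; apply/andP; split; nra.
case/andP: (b01) => b0 b1.
pose B := c * expR c; pose Q := 42 * c ^+ 2 * expR (6 * c).
have B0 : 0 <= B by rewrite /B; pos.
have Q0 : 0 <= Q by rewrite /Q; pos.
pose K1 := k ^+ 2 * expR k + k * expR k * B.
have K10 : 0 <= K1 by rewrite /K1; pos.
pose K2 := K1 + 2 * C * (B + Q).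
have K20 : 0 <= K2 by rewrite /K2; pos.
pose K3 := (1 + C) * B + C * Q.
have K30 : 0 <= K3 by rewrite /K3; pos.
exists (2 * (k * K3 + K2)); first by pos.
exists (Num.min 1 (2 * K3 + 1)^-1); first by rewrite lt_min ltr01 invr_gt0; lra.
move=> d X mu n m rho u v s /andP[s0]; rewrite le_min => /andP[s1 sK] rho0 irho mfu mfv uc vc uvk rho1.
have sn0 := ltW s0.
have h0 : 0 <= s ^+ 2 by exact: sqr_ge0.
have h1 : s ^+ 2 <= 1 by rewrite -(expr1n R 2) lerXn2r ?nnegrE.
have sc l (w : X -> l.-tuple mR) : (forall x y, dot (w x) (w y) <= c) ->
    forall x y, dot ((scal s \o w) x) ((scal s \o w) y) <= s ^+ 2 * c.
  by move=> wc x y; rewrite /= dot_scall dot_scalr mulrA -expr2 ler_wpM2l.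
have ms l (w : X -> l.-tuple mR) : measurable_fun setT w -> measurable_fun setT (scal s \o w).
  by move=> mw; exact: measurable_lin.
have uk x y : dot ((scal s \o v) x) ((scal s \o v) y) <= dot ((scal s \o u) x) ((scal s \o u) y) + s ^+ 2 * k.
  by rewrite /= !dot_scall !dot_scalr !mulrA -!expr2 -mulrDr ler_wpM2l.
have eB : expR (s ^+ 2 * c) - 1 <= s ^+ 2 * B.
  apply: (le_trans (expR_sub1_le _)); rewrite /B -mulrA; do 2 (apply: ler_wpM2l => //).
  by rewrite ler_expR ler_piMl.
have eK : expR (s ^+ 2 * k) - 1 <= s ^+ 2 * k + (s ^+ 2) ^+ 2 * (k ^+ 2 * expR k).
  have := expR_taylor1 (s ^+ 2 * k) => /ler_normlP[_].
  rewrite ger0_norm ?mulr_ge0// exprMn.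
  have : (s ^+ 2) ^+ 2 * (k ^+ 2 * expR (s ^+ 2 * k)) <= (s ^+ 2) ^+ 2 * (k ^+ 2 * expR k).
    apply: ler_wpM2l; first exact: sqr_ge0.
    by apply: ler_wpM2l; [exact: sqr_ge0|rewrite ler_expR ler_piMl].
  lra.
have eK' : expR (s ^+ 2 * k) - 1 <= s ^+ 2 * (k * expR k).
  apply: (le_trans (expR_sub1_le _)); rewrite -mulrA; do 2 (apply: ler_wpM2l => //).
  by rewrite ler_expR ler_piMl.
have eQ : 42 * (s ^+ 2 * c) ^+ 2 * expR (6 * (s ^+ 2 * c)) / s <= s ^+ 3 * Q.
  rewrite ler_pdivrMr// /Q (_ : s ^+ 3 * _ * s = 42 * (s ^+ 2 * c) ^+ 2 * expR (6 * c)); last by ring.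
  apply: ler_wpM2l; first by pos.
  by rewrite ler_expR ler_wpM2l// ler_piMl.
have Hu := HC d X mu n rho (scal s \o u) rho0 irho (ms _ _ mfu) rho1 _ s (sc _ _ uc) s0.
have Hv := HC d X mu m rho (scal s \o v) rho0 irho (ms _ _ mfv) rho1 _ s (sc _ _ vc) s0.
have Mu1 := part2_ge1 rho0 irho (ms _ _ mfu) rho1 (sc _ _ uc).
have Mv1 := part2_ge1 rho0 irho (ms _ _ mfv) rho1 (sc _ _ vc).
have Mu2 := part2_le rho0 irho (ms _ _ mfu) rho1 (sc _ _ uc).
have Mv2 := part2_le rho0 irho (ms _ _ mfv) rho1 (sc _ _ vc).
have Mvu := part2_compare rho0 irho (ms _ _ mfu) (ms _ _ mfv) rho1 (sc _ _ uc) (sc _ _ vc) uk.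
move: Hu Hv Mu1 Mv1 Mu2 Mv2 Mvu.
set Mu := part2 _ _ _; set Mv := part2 _ _ _.
set A := \int[_]_W _; set A' := \int[_]_W _.
move=> /ler_normlP[_ Hu] /ler_normlP[Hv _] Mu1 Mv1 Mu2 Mv2 Mvu; rewrite -/b in Hu Hv *.
apply: (comparison_arith (b := b) (C := C) (B := B) (Q := Q) (k1 := k ^+ 2 * expR k)
  (k2 := k * expR k) (Mu := Mu) (Mv := Mv) (e := expR (s ^+ 2 * k))
  (q := 42 * (s ^+ 2 * c) ^+ 2 * expR (6 * (s ^+ 2 * c)) / s)) => //.
- by pos.
- by pos.
- by rewrite -/K3 -ler_pdivlMr ?div1r//; move: K30; clear; lra.
- by rewrite -expR0 ler_expR mulr_ge0.
- by move: Mu2 eB; clear; lra.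
- by move: Mv2 eB; clear; lra.
- by rewrite -lerBlDr.
- by rewrite -opprB opprK in Hv *; move: Hv; clear; lra.
Qed.

(** Both sides are homogeneous of degree a in rho, which reduces to total mass one; if the mass is
    zero the left side vanishes. *)
Lemma comparison_step (k c : R) : 0 <= k -> 0 <= c -> exists2 K, 0 <= K & exists2 s0, 0 < s0 &
  forall d (X : measurableType d) (mu : probability X R) n m (rho : X -> mR)
    (u : X -> n.-tuple mR) (v : X -> m.-tuple mR) s, 0 < s <= s0 ->
  (forall x, 0 <= rho x) -> itg mu rho -> measurable_fun setT u -> measurable_fun setT v ->
  (forall x y, dot (u x) (u y) <= c) -> (forall x y, dot (v x) (v y) <= c) ->
  (forall x y, dot (v x) (v y) <= dot (u x) (u y) + k) ->
  (\int[gaussn n]_W (part mu rho (scal s \o u) W `^ a)%:E <=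
  (expR (a * (1 - a) / 2 * k * s ^+ 2 + K * s ^+ 3))%:E *
    \int[gaussn m]_W (part mu rho (scal s \o v) W `^ a)%:E)%E.
Proof.
move=> k0 c0; have [K K0 [s0 s00 H]] := comparison_step_normalized k0 c0.
exists K => //; exists s0 => // d X mu n m rho u v s ss rho0 irho mfu mfv uc vc uvk.
have ms l (w : X -> l.-tuple mR) : measurable_fun setT w -> measurable_fun setT (scal s \o w).
  by move=> mw; exact: measurable_lin.
have a0 : a != 0 by case/andP: a01 => a0 _; rewrite gt_eqF.
have S0 : 0 <= \int[mu]_x rho x by apply: Rintegral_ge0.
have [Sz|Sn] := eqVneq (\int[mu]_x rho x) 0.
  under eq_integral => W _ do rewrite (part_null _ rho0 irho (ms _ _ mfu) Sz) powR0//.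
  rewrite integral0 mule_ge0 ?lee_fin ?expR_ge0//.
  by apply: integral_ge0 => W _; rewrite lee_fin powR_ge0.
have Sp : 0 < \int[mu]_x rho x by rewrite lt_neqAle eq_sym Sn.
pose S := \int[mu]_x rho x.
pose rho' x := S^-1 * rho x.
have rho'0 x : 0 <= rho' x by rewrite mulr_ge0// invr_ge0 ltW.
have irho' : itg mu rho' by exact: itgZ.
have r1 : \int[mu]_x rho' x = 1 by rewrite RintegralZl// mulVf.
have := H d X mu n m rho' u v s ss rho'0 irho' mfu mfv uc vc uvk r1.
have P l (w : X -> l.-tuple mR) : measurable_fun setT w ->
   \int[gaussn l]_W (part mu rho' (scal s \o w) W `^ a) = S^-1 `^ a * \int[gaussn l]_W (part mu rho (scal s \o w) W `^ a).
  move=> mw; rewrite -RintegralZl//; last exact: (itg_part_powR a01 rho0 irho (ms _ _ mw)).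
  apply: eq_Rintegral => W _; rewrite (part_scale _ W rho0 irho (ms _ _ mw)).
  by rewrite powRM// ?invr_ge0 ?(ltW Sp)//; exact: part_ge0.
rewrite !P// mulrCA ler_pM2l ?powR_gt0 ?invr_gt0// => le.
rewrite -!ge0_RintegralE; first last.
- exact: (itg_part_powR a01 rho0 irho (ms _ _ mfu)).
- by move=> W; exact: powR_ge0.
- exact: (itg_part_powR a01 rho0 irho (ms _ _ mfv)).
- by move=> W; exact: powR_ge0.
rewrite -EFinM lee_fin; apply: (le_trans le); apply: ler_wpM2r.
  by apply: Rintegral_ge0 => W _; exact: powR_ge0.
by rewrite -addrA expR_ge1Dx.
Qed.

End comparison_step.

Lemma part_ext d (X : measurableType d) (R : realType) (mu : probability X R) n m
    (rho rho' : X -> measurableTypeR R) (u : X -> n.-tuple (measurableTypeR R))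
    (v : X -> m.-tuple (measurableTypeR R)) W V :
  (forall x, rho x * wt (u x) W = rho' x * wt (v x) V) ->
  part mu rho u W = part mu rho' v V.
Proof. by move=> e; apply: eq_Rintegral => x _; exact: e. Qed.

Lemma part_cong (R : realType) (a x y : R) : x = y -> (x `^ a)%:E = (y `^ a)%:E.
Proof. by move=> ->. Qed.

Section gaussian_comparison.
Context (R : realType).
Notation mR := (measurableTypeR R).
Notation gaussn := (iid (@gauss R)).

Lemma gaussn_split n (c s : R) (F : n.-tuple mR -> \bar R) :
  c ^+ 2 + s ^+ 2 = 1 -> 0 < c -> measurable_fun setT F -> (forall z, 0 <= F z)%E ->
  (\int[gaussn n]_x \int[gaussn n]_y F (lin c s x y) = \int[gaussn n]_x F x)%E.
Proof.
move=> cs c0 mF F0.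
have := gaussn_rotation (F := fun z => F z.1) cs c0 (measurableT_comp mF measurable_fst) (fun z => F0 _).
by move=> /= ->; apply: eq_integral => x _; rewrite integral_prob_cst.
Qed.

Context d (X : measurableType d) (mu : probability X R) (a : R).
Hypothesis a01 : 0 < a < 1.

Lemma measurable_part_powR d' (T : measurableType d') n (rho : T -> X -> mR)
    (u : X -> n.-tuple mR) (f : T -> n.-tuple mR) :
  measurable_fun setT (fun z : T * X => rho z.1 z.2) -> (forall t x, 0 <= rho t x) ->
  measurable_fun setT u -> measurable_fun setT f ->
  measurable_fun setT (fun t => (part mu (rho t) u (f t) `^ a)%:E).
Proof.
move=> mr r0 mfu mf; apply/measurable_EFinP; apply: (measurableT_comp (measurable_powR _)).
apply: (@measurable_Rintegral _ _ _ _ _ mu (fun t x => rho t x * wt (u x) (f t))).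
  by apply: measurable_funM => //; mble.
by move=> t x; rewrite mulr_ge0// wt_ge0.
Qed.

(** A field of variance t ^+ 2 is the sum of independent ones of variances p ^+ 2 and r ^+ 2, and
    the first can be absorbed into the density. *)
Lemma part_split n (rho : X -> mR) (u : X -> n.-tuple mR) (p r t : R) W W' :
  0 < t -> t ^+ 2 = p ^+ 2 + r ^+ 2 ->
  part mu rho (scal t \o u) (lin (r / t) (p / t) W' W) =
  part mu (fun x => rho x * wt (scal p (u x)) W) (scal r \o u) W'.
Proof.
move=> t0 tpr; apply: eq_Rintegral => x _ /=; rewrite -mulrA; congr (_ * _).
rewrite /wt -expRD; congr expR.
rewrite !dot_scall !dot_scalr dot_linr !mulrA -!expr2 tpr.
by field; rewrite gt_eqF.
Qed.

Opaque part.

Variables (n m : nat) (rho : X -> mR) (u : X -> n.-tuple mR) (v : X -> m.-tuple mR).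
Variables (k c : R).
Hypotheses (rho0 : forall x, 0 <= rho x) (irho : itg mu rho).
Hypotheses (mfu : measurable_fun setT u) (mfv : measurable_fun setT v).
Hypotheses (k0 : 0 <= k) (c0 : 0 <= c).
Hypotheses (uc : forall x y, dot (u x) (u y) <= c) (vc : forall x y, dot (v x) (v y) <= c).
Hypothesis uvk : forall x y, dot (v x) (v y) <= dot (u x) (u y) + k.

Let mrho : measurable_fun setT rho := itg_measurable irho.

(** Kahane's path: u at strength p and v at strength q with independent noises, the v field being
    stored in the density. The endpoints (1, 0) and (0, 1) are the two moments to compare. *)
Definition interpolant (p q : R) : \bar R := (\int[gaussn m]_Z \int[gaussn n]_W
  (part mu (fun x => rho x * wt (scal q (v x)) Z) (scal p \o u) W `^ a)%:E)%E.

Let msc l (w : X -> l.-tuple mR) q : measurable_fun setT w -> measurable_fun setT (fun x => scal q (w x)).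
Proof. by move=> mw; exact: measurable_lin. Qed.

(** Transfers a variance r ^+ 2 from u to v. The field t u splits into p u and r u, all but r u is
    frozen in the density f Z W, the hypothesis compares r u with r v for frozen Z and W, and r v
    then merges with q v into w v. *)
Let interpolant_step K s0 : 0 <= K ->
  (forall rho', (forall x, 0 <= rho' x) -> itg mu rho' -> forall s, 0 < s <= s0 ->
   (\int[gaussn n]_W (part mu rho' (scal s \o u) W `^ a)%:E <=
  (expR (a * (1 - a) / 2 * k * s ^+ 2 + K * s ^+ 3))%:E *
    \int[gaussn m]_W (part mu rho' (scal s \o v) W `^ a)%:E)%E) ->
  forall p q r t w, 0 < r <= s0 -> 0 < t -> 0 < w -> t ^+ 2 = p ^+ 2 + r ^+ 2 ->
    w ^+ 2 = q ^+ 2 + r ^+ 2 ->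
  (interpolant t q <= (expR (a * (1 - a) / 2 * k * r ^+ 2 + K * r ^+ 3))%:E * interpolant p w)%E.
Proof.
move=> K0 H p q r t w rs t0 w0 tpr wqr.
have r0 : 0 < r by case/andP: rs.
have csP x y : 0 < y -> y ^+ 2 = x ^+ 2 + r ^+ 2 -> (r / y) ^+ 2 + (x / y) ^+ 2 = 1.
  by move=> y0 e; rewrite !exprMn !exprVn -mulrDl [r ^+ 2 + _]addrC -e divff// sqrf_eq0 gt_eqF.
have mscu := msc _ mfu; have mscv := msc _ mfv.
pose f Z W := fun x => rho x * wt (scal q (v x)) Z * wt (scal p (u x)) W.
have f0 Z W x : 0 <= f Z W x by rewrite /f; pos.
have -> : interpolant t q = (\int[gaussn m]_Z \int[gaussn n]_W \int[gaussn n]_W'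
   (part mu (f Z W) (scal r \o u) W' `^ a)%:E)%E.
  apply: eq_integral => Z _.
  pose F W := (part mu (fun x => rho x * wt (scal q (v x)) Z) (scal t \o u) W `^ a)%:E.
  transitivity (\int[gaussn n]_x \int[gaussn n]_y F (lin (r / t) (p / t) x y))%E.
    apply/esym/(gaussn_split (F := F) (csP _ _ t0 tpr)); first by rewrite divr_gt0.
      by apply: measurable_part_powR; [mble|move=> _ x; cbv beta; pos|exact: mscu|mble].
    by move=> W; rewrite lee_fin powR_ge0.
  transitivity (\int[gaussn n]_x \int[gaussn n]_y (part mu (f Z y) (scal r \o u) x `^ a)%:E)%E.
    apply: eq_integral => x _; apply: eq_integral => y _; rewrite /F; apply: part_cong; exact: part_split.
  apply: (fubini_tonelli (fun z : n.-tuple mR * n.-tuple mR => (part mu (f Z z.2) (scal r \o u) z.1 `^ a)%:E)).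
    by apply: measurable_part_powR; rewrite /f; [mble|move=> z x; cbv beta; pos|exact: mscu|mble].
  by move=> z; rewrite lee_fin powR_ge0.
have -> : interpolant p w = (\int[gaussn m]_Z \int[gaussn n]_W \int[gaussn m]_Z'
   (part mu (f Z W) (scal r \o v) Z' `^ a)%:E)%E.
  transitivity (\int[gaussn n]_W \int[gaussn m]_Z (part mu (fun x => rho x * wt (scal p (u x)) W) (scal w \o v) Z `^ a)%:E)%E.
    etransitivity.
      apply: (fubini_tonelli (fun z : m.-tuple mR * n.-tuple mR => (part mu (fun x => rho x * wt (scal w (v x)) z.1) (scal p \o u) z.2 `^ a)%:E)).
        by apply: measurable_part_powR; [mble|move=> z x; cbv beta; pos|exact: mscu|mble].
      by move=> z; rewrite lee_fin powR_ge0.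
    apply: eq_integral => W _; apply: eq_integral => Z _; apply: part_cong.
    by apply: part_ext => x /=; rewrite mulrAC.
  transitivity (\int[gaussn n]_W \int[gaussn m]_Z \int[gaussn m]_Z' (part mu (f Z W) (scal r \o v) Z' `^ a)%:E)%E.
    apply: eq_integral => W _.
    pose F Z := (part mu (fun x => rho x * wt (scal p (u x)) W) (scal w \o v) Z `^ a)%:E.
    transitivity (\int[gaussn m]_x \int[gaussn m]_y F (lin (r / w) (q / w) x y))%E.
      apply/esym/(gaussn_split (F := F) (csP _ _ w0 wqr)); first by rewrite divr_gt0.
        by apply: measurable_part_powR; [mble|move=> _ x; cbv beta; pos|exact: mscv|mble].
      by move=> Z; rewrite lee_fin powR_ge0.
    transitivity (\int[gaussn m]_x \int[gaussn m]_y (part mu (f y W) (scal r \o v) x `^ a)%:E)%E.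
      apply: eq_integral => x _; apply: eq_integral => y _; apply: part_cong; rewrite (part_split _ _ _ _ w0 wqr).
      by apply: part_ext => z /=; rewrite /f; congr (_ * _); rewrite mulrAC.
    apply: (fubini_tonelli (fun z : m.-tuple mR * m.-tuple mR => (part mu (f z.2 W) (scal r \o v) z.1 `^ a)%:E)).
      by apply: measurable_part_powR; rewrite /f; [mble|move=> z x; cbv beta; pos|exact: mscv|mble].
    by move=> z; rewrite lee_fin powR_ge0.
  apply: (fubini_tonelli (fun z : n.-tuple mR * m.-tuple mR => \int[gaussn m]_Z' (part mu (f z.2 z.1) (scal r \o v) Z' `^ a)%:E)%E).
    apply: (measurable_fun_fubini_tonelli_F (fun z : (n.-tuple mR * m.-tuple mR) * m.-tuple mR => (part mu (f z.1.2 z.1.1) (scal r \o v) z.2 `^ a)%:E)) => [|z]; last by rewrite lee_fin powR_ge0.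
    by apply: measurable_part_powR; rewrite /f; [mble|move=> z x; cbv beta; pos|exact: mscv|mble].
  by move=> z; apply: integral_ge0 => Z _; rewrite lee_fin powR_ge0.
have mI l (g : X -> l.-tuple mR) : measurable_fun setT g ->
   measurable_fun setT (fun z : m.-tuple mR * n.-tuple mR => \int[gaussn l]_Z' (part mu (f z.1 z.2) g Z' `^ a)%:E)%E.
  move=> mg; apply: (measurable_fun_fubini_tonelli_F (fun z : (m.-tuple mR * n.-tuple mR) * l.-tuple mR => (part mu (f z.1.1 z.1.2) g z.2 `^ a)%:E)) => [|z]; last by rewrite lee_fin powR_ge0.
  by apply: measurable_part_powR; rewrite /f; [mble|move=> z x; cbv beta; pos|exact: mg|mble].
have mIZ l (g : X -> l.-tuple mR) Z : measurable_fun setT g ->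
   measurable_fun setT (fun W => \int[gaussn l]_Z' (part mu (f Z W) g Z' `^ a)%:E)%E.
  move=> mg; apply: (measurable_fun_fubini_tonelli_F (fun z : n.-tuple mR * l.-tuple mR => (part mu (f Z z.1) g z.2 `^ a)%:E)) => [|z]; last by rewrite lee_fin powR_ge0.
  by apply: measurable_part_powR; rewrite /f; [mble|move=> z x; cbv beta; pos|exact: mg|mble].
have I0 l (g : X -> l.-tuple mR) Z W : (0 <= \int[gaussn l]_Z' (part mu (f Z W) g Z' `^ a)%:E)%E.
  by apply: integral_ge0 => Z' _; rewrite lee_fin powR_ge0.
have mu1 := mI _ _ (mscu r); have mv1 := mI _ _ (mscv r).
rewrite -ge0_integralZl//; first last.
- by move=> Z _; apply: integral_ge0 => W _; exact: I0.
- by apply: (measurable_fun_fubini_tonelli_F (fun z : m.-tuple mR * n.-tuple mR => \int[gaussn m]_Z' (part mu (f z.1 z.2) (scal r \o v) Z' `^ a)%:E)%E).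
apply: ge0_le_integral; [exact: measurableT| | | |].
- by move=> Z _; apply: integral_ge0 => W _; exact: I0.
- by apply: (measurable_fun_fubini_tonelli_F (fun z : m.-tuple mR * n.-tuple mR => \int[gaussn n]_Z' (part mu (f z.1 z.2) (scal r \o u) Z' `^ a)%:E)%E).
- apply: emeasurable_funM; first exact: measurable_cst.
  by apply: (measurable_fun_fubini_tonelli_F (fun z : m.-tuple mR * n.-tuple mR => \int[gaussn m]_Z' (part mu (f z.1 z.2) (scal r \o v) Z' `^ a)%:E)%E).
move=> Z _.
rewrite -ge0_integralZl//; first last.
- exact: (mIZ _ _ Z (mscv r)).
apply: ge0_le_integral; [exact: measurableT| | | |].
- by move=> W _; exact: I0.
- exact: (mIZ _ _ Z (mscu r)).
- apply: emeasurable_funM; first exact: measurable_cst.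
  exact: (mIZ _ _ Z (mscv r)).
move=> W _; apply: H => //; apply: itg_part; [by move=> x; cbv beta; pos| |exact: mscu].
by apply: itg_part => //; exact: mscv.
Qed.

Lemma wt_scal0 l (b Z : l.-tuple mR) : wt (scal 0 b) Z = 1.
Proof. by rewrite /wt !dot_scall !mul0r subr0 expR0. Qed.

Lemma scal1 l (b : l.-tuple mR) : scal 1 b = b.
Proof. by apply: eq_from_tnth => i; rewrite tnth_scal mul1r. Qed.

Lemma interpolant10 : interpolant 1 0 = (\int[gaussn n]_W (part mu rho u W `^ a)%:E)%E.
Proof.
transitivity (\int[gaussn m]_Z \int[gaussn n]_W (part mu rho u W `^ a)%:E)%E.
  apply: eq_integral => Z _; apply: eq_integral => W _; apply: part_cong.
  by apply: part_ext => x /=; rewrite wt_scal0 scal1 mulr1.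
exact: integral_prob_cst.
Qed.

Lemma interpolant01 : interpolant 0 1 = (\int[gaussn m]_W (part mu rho v W `^ a)%:E)%E.
Proof.
apply: eq_integral => Z _.
transitivity (\int[gaussn n]_W (part mu rho v Z `^ a)%:E)%E.
  apply: eq_integral => W _; apply: part_cong.
  by apply: part_ext => x /=; rewrite wt_scal0 scal1 mulr1.
exact: integral_prob_cst.
Qed.

Opaque interpolant.

(* Kahane's inequality, up to a factor 2 that spares a passage to the limit. *)
Lemma gaussian_comparison :
  (\int[gaussn n]_W (part mu rho u W `^ a)%:E <=
   (2 * expR (a * (1 - a) / 2 * k))%:E * \int[gaussn m]_W (part mu rho v W `^ a)%:E)%E.
Proof.
have [K K0 [s0 s00 H]] := comparison_step a01 k0 c0.
have {}H rho' : (forall x, 0 <= rho' x) -> itg mu rho' -> forall s, 0 < s <= s0 ->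
   (\int[gaussn n]_W (part mu rho' (scal s \o u) W `^ a)%:E <=
  (expR (a * (1 - a) / 2 * k * s ^+ 2 + K * s ^+ 3))%:E *
    \int[gaussn m]_W (part mu rho' (scal s \o v) W `^ a)%:E)%E.
  by move=> r0 ir s ss; exact: H.
have {}H := interpolant_step K0 H.
have ln20 : 0 < ln (2 : R) by rewrite ln_gt0// ltr1n.
(* M > T ^+ 2 steps of size p 1 = 1 / sqrt M: the first bound makes each step at most s0, the second
   makes the accumulated error M K / sqrt M ^+ 3 = K / sqrt M at most ln 2. *)
pose T := Num.max (s0 ^- 1) (K / ln 2).
have T0 : 0 <= T by rewrite /T le_max invr_ge0 ltW.
pose M := (Num.trunc (T ^+ 2)).+1.
have MT : T ^+ 2 < M%:R by apply: truncnS_gt.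
have M0 : 0 < M%:R :> R by rewrite ltr0n.
pose p j : R := Num.sqrt (j%:R / M%:R).
have pM : p M = 1 by rewrite /p divff ?gt_eqF// sqrtr1.
have p00 : p 0%N = 0 by rewrite /p mul0r sqrtr0.
have pp j : p j ^+ 2 = j%:R / M%:R by rewrite sqr_sqrtr// divr_ge0.
have pS j : p j.+1 ^+ 2 = p j ^+ 2 + p 1%N ^+ 2 by rewrite !pp -mulrDl natr1.
have pgt j : 0 < p j.+1 by rewrite sqrtr_gt0 divr_gt0.
have sT : T < Num.sqrt M%:R by rewrite -(ger0_norm T0) -sqrtr_sqr ltr_sqrt.
have sM0 : 0 < Num.sqrt M%:R :> R by apply: le_lt_trans sT.
have p1E : p 1%N = (Num.sqrt M%:R)^-1 by rewrite /p div1r sqrtrV.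
have p1s : 0 < p 1%N <= s0.
  rewrite pgt/= p1E invf_ple ?posrE//; apply: ltW; apply: le_lt_trans sT.
  by rewrite /T le_max lexx.
pose b := a * (1 - a) / 2 * k * p 1%N ^+ 2 + K * p 1%N ^+ 3.
have ind j : (j <= M)%N -> (interpolant (p j) (p (M - j)%N) <= (expR (j%:R * b))%:E * interpolant 0 1)%E.
  elim: j => [_|j IH jM]; first by rewrite subn0 pM p00 mul0r expR0 mul1e.
  apply: (le_trans (H (p j) (p (M - j.+1)%N) (p 1%N) (p j.+1) (p (M - j)%N) p1s _ _ _ _)).
  - exact: pgt.
  - by rewrite -(subnSK jM).
  - exact: pS.
  - by rewrite -(subnSK jM).
  have -> : j.+1%:R * b = b + j%:R * b by rewrite -[in LHS]natr1 mulrDl mul1r addrC.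
  rewrite (expRD b) EFinM -muleA.
  by apply: lee_wpmul2l; [rewrite lee_fin expR_ge0|exact: IH (ltnW jM)].
have := ind M (leqnn M); rewrite subnn pM p00 interpolant10 interpolant01 => /le_trans; apply.
apply: lee_wpmul2r; first by apply: integral_ge0 => W _; rewrite lee_fin powR_ge0.
rewrite lee_fin.
have -> : M%:R * b = a * (1 - a) / 2 * k + K * p 1%N.
  rewrite /b [p 1%N ^+ 3]exprSr pp mulrDr; congr (_ + _); first by field; rewrite gt_eqF.
  by field; rewrite gt_eqF.
rewrite addrC expRD ler_wpM2r ?expR_ge0//.
rewrite -[leRHS]lnK ?posrE// ler_expR p1E ler_pdivrMr//.
rewrite -ler_pdivrMl//; apply: ltW; apply: le_lt_trans sT.
by rewrite /T le_max mulrC lexx orbT.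
Qed.

End gaussian_comparison.

(** * The scalar Gaussian channel *)

Section gauss_moments.
Variable R : realType.
Notation mR := (measurableTypeR R).

Lemma measurable_norm_comp d (T : measurableType d) (f : T -> mR) :
  measurable_fun setT f -> measurable_fun setT (fun x => `|f x| : mR).
Proof. by move=> mf; apply: (measurableT_comp (@normr_measurable R setT)). Qed.

Lemma gauss_mgf (b : R) : (\int[@gauss R]_z (expR (b * z))%:E = (expR (b ^+ 2 / 2))%:E)%E.
Proof.
have := @gauss_shift R b (fun=> 1%E) (measurable_cst _) (fun=> lee01).
rewrite integral_prob_cst => h.
transitivity (\int[@gauss R]_z ((expR (b ^+ 2 / 2))%:E * (expR (b * z - b ^+ 2 / 2))%:E))%E.
  by apply: eq_integral => z _; rewrite -EFinM -expRD; congr (expR _)%:E; ring.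
rewrite ge0_integralZl//; last by mble.
rewrite -[RHS]mule1 h; congr (_ * _)%E; apply: eq_integral => z _; rewrite mule1 //.
Qed.

Lemma itg_gauss_exp (b : R) : itg (@gauss R) (fun z => expR (b * `|z|)).
Proof.
have mz : measurable_fun setT (fun z : mR => `|z| : mR) by exact: measurable_norm_comp.
have i c : itg (@gauss R) (fun z => expR (c * z)).
  by apply: itg_ge0; [mble|move=> z; exact: expR_ge0|rewrite gauss_mgf ltry].
apply: (itg_le (g := fun z : mR => expR (b * z) + expR ((- b) * z))); [by mble| |exact: itgD].
move=> z; rewrite ger0_norm ?expR_ge0//.
have [z0|z0] := leP 0 z; first by rewrite ger0_norm// lerDl expR_ge0.
by rewrite ltr0_norm// mulrN mulNr lerDr expR_ge0.
Qed.

Lemma sqr_le_exp (x : R) : x ^+ 2 <= 2 * expR `|x|.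
Proof.
have := @expR_ge1Dxn R `|x| 1 (normr_ge0 x).
rewrite real_normK ?num_real//= (_ : (2`!)%:R = 2)//; lra.
Qed.

Lemma itg_gauss_sqr : itg (@gauss R) (fun z => z ^+ 2).
Proof.
apply: (itg_le (g := fun z : mR => 2 * expR (1 * `|z|))); [by mble| |by apply: itgZ; exact: itg_gauss_exp].
by move=> z; rewrite ger0_norm ?sqr_ge0// mul1r sqr_le_exp.
Qed.

(** Read off from [gauss_sqr_mgf] at - a: the tangent bound gives 1 - a V / 2 <= 1 / sqrt (1 + a) <=
    1 - a / 2 + a ^+ 2, hence 1 - V <= 2 a for arbitrarily small a. *)
Lemma gauss_sqr_ge1 : 1 <= \int[@gauss R]_z z ^+ 2.
Proof.
set V := \int[_]_z _; apply/ler_addgt0Pr => e e0.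
pose a : R := Num.min 1 (e / 2).
have a0 : 0 < a by rewrite lt_min ltr01 divr_gt0.
have a1 : a <= 1 by rewrite ge_min lexx.
have ae : a <= e / 2 by rewrite ge_min lexx orbT.
have i : itg (@gauss R) (fun z => expR (- a * z ^+ 2 / 2)).
  apply: itg_ge0; [by mble|by move=> z; exact: expR_ge0|].
  by rewrite gauss_sqr_mgf ?ltry//; lra.
have E : \int[@gauss R]_z expR (- a * z ^+ 2 / 2) = (Num.sqrt (1 + a))^-1.
  by apply: RintegralEFin; rewrite gauss_sqr_mgf ?opprK//; lra.
have j := itg_lin3 1 (- (a / 2)) 0 0 itg_gauss_sqr itg_gauss_sqr itg_gauss_sqr.
have := Rintegral_le j i; rewrite E Rintegral_lin3; [|exact: itg_gauss_sqr..].
have h z : 1 + - (a / 2) * z ^+ 2 + 0 * z ^+ 2 + 0 * z ^+ 2 <= expR (- a * z ^+ 2 / 2).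
  by have := expR_ge1Dx (- a * z ^+ 2 / 2); lra.
move=> /(_ h); rewrite -/V => {}h.
have sa : 0 < Num.sqrt (1 + a) by rewrite sqrtr_gt0; lra.
have : (Num.sqrt (1 + a))^-1 <= 1 - a / 2 + a ^+ 2.
  have p : 0 <= 1 - a / 2 + a ^+ 2 by have := sqr_ge0 a; lra.
  rewrite -[leLHS]mul1r ler_pdivrMr// leNgt; apply/negP => lt1.
  have : ((1 - a / 2 + a ^+ 2) * Num.sqrt (1 + a)) ^+ 2 < 1.
    by rewrite expr_lt1// mulr_ge0// ltW.
  rewrite exprMn sqr_sqrtr; last by lra.
  rewrite (_ : (1 - a / 2 + a ^+ 2) ^+ 2 * (1 + a) = 1 + a ^+ 2 * (5 / 4 + 5 / 4 * a + a ^+ 3)); last by field.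
  rewrite -subr_lt0 addrAC subrr add0r ltNge => /negP; apply.
  by apply: mulr_ge0; [exact: sqr_ge0|have := exprn_ge0 3 (ltW a0); lra].
rewrite !mul0r !addr0 in h => h2.
have : a / 2 * (1 - V) <= a / 2 * (2 * a) by rewrite expr2 in h2; lra.
by rewrite ler_pM2l ?divr_gt0//; lra.
Qed.

End gauss_moments.

Lemma probability_bound_ge0 d (T : measurableType d) (R : realType) (P : probability T R) (f : T -> R) K :
  (forall x, `|f x| <= K) -> 0 <= K.
Proof.
move=> fK; have [x _] : exists x : T, True.
  apply: contrapT => nT; have := probability_setT P; rewrite (_ : [set: T] = set0).
    by rewrite measure0 => /eqP; rewrite eqe eq_sym oner_eq0.
  by apply/seteqP; split => // x _; apply: nT; exists x.
exact: le_trans (fK x).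
Qed.

Section tilted_density.
Context d (T : measurableType d) (R : realType) (P : probability T R).
Notation mR := (measurableTypeR R).
Variables (f : T -> mR) (K : R).
Hypotheses (mf : measurable_fun setT f) (fK : forall x, `|f x| <= K).

(** The density at y, relative to N(0, 1), of the output s f(x) + z of a scalar Gaussian channel
    ([gauss_tilt]). *)
Definition tilt (s y : R) : R := \int[P]_x expR (s * y * f x - s ^+ 2 / 2 * f x ^+ 2).

Let K0 : 0 <= K. Proof. exact: (probability_bound_ge0 P fK). Qed.

Definition tilt_bound (s y : R) : R := `|s| * K * `|y| + s ^+ 2 / 2 * K ^+ 2.

Lemma tilt_exponent_le s y x :
  `|s * y * f x - s ^+ 2 / 2 * f x ^+ 2| <= tilt_bound s y.
Proof.
apply: (le_trans (ler_normB _ _)); apply: lerD.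
  rewrite !normrM mulrAC -!mulrA ler_wpM2l// ler_wpM2r//.
rewrite normrM ger0_norm; last by rewrite divr_ge0// sqr_ge0.
by rewrite ler_wpM2l ?divr_ge0 ?sqr_ge0// normrX lerXn2r ?nnegrE// K0.
Qed.

Lemma itg_tilt s y : itg P (fun x => expR (s * y * f x - s ^+ 2 / 2 * f x ^+ 2)).
Proof.
apply: (itg_le (g := fun x : T => expR (tilt_bound s y))); [by mble| |exact: itg_cst].
move=> x; rewrite ger0_norm ?expR_ge0// ler_expR.
by have := tilt_exponent_le s y x; rewrite ler_norml => /andP[].
Qed.

Lemma tilt_ge s y : expR (- tilt_bound s y) <= tilt s y.
Proof.
rewrite -[leLHS](Rintegral_prob_cst P); apply: Rintegral_le; [exact: itg_cst|exact: itg_tilt|].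
move=> x; rewrite ler_expR.
by have := tilt_exponent_le s y x; rewrite ler_norml => /andP[].
Qed.

Lemma tilt_le s y : tilt s y <= expR (tilt_bound s y).
Proof.
rewrite -[leRHS](Rintegral_prob_cst P); apply: Rintegral_le; [exact: itg_tilt|exact: itg_cst|].
move=> x; rewrite ler_expR.
by have := tilt_exponent_le s y x; rewrite ler_norml => /andP[].
Qed.

Lemma tilt_gt0 s y : 0 < tilt s y.
Proof. by apply: lt_le_trans (tilt_ge s y); exact: expR_gt0. Qed.

Lemma ln_tilt_le s y : `|ln (tilt s y)| <= tilt_bound s y.
Proof.
have e0 : 0 < expR (tilt_bound s y) by exact: expR_gt0.
have e1 : 0 < expR (- tilt_bound s y) by exact: expR_gt0.
rewrite ler_norml -{1}[- _]expRK -{2}[tilt_bound s y]expRK.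
by rewrite !ler_ln ?posrE ?tilt_gt0// tilt_ge tilt_le.
Qed.

Lemma tiltE s y : (tilt s y)%:E = (\int[P]_x (expR (s * y * f x - s ^+ 2 / 2 * f x ^+ 2))%:E)%E.
Proof. by rewrite /tilt ge0_RintegralE//; exact: itg_tilt. Qed.

Lemma measurable_tilt s : measurable_fun setT (tilt s : mR -> mR).
Proof.
apply: (@measurable_Rintegral _ _ _ _ _ P (fun (y : mR) x => expR (s * y * f x - s ^+ 2 / 2 * f x ^+ 2))).
  by mble.
by move=> y x; exact: expR_ge0.
Qed.

Lemma gauss_tilt s (F : mR -> \bar R) : measurable_fun setT F -> (forall z, 0 <= F z)%E ->
  (\int[P]_x \int[@gauss R]_z F (s * f x + z)%R = \int[@gauss R]_z ((tilt s z)%:E * F z))%E.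
Proof.
move=> mF F0.
transitivity (\int[P]_x \int[@gauss R]_z ((expR (s * z * f x - s ^+ 2 / 2 * f x ^+ 2))%:E * F z))%E.
  apply: eq_integral => x _; rewrite [LHS](gauss_shift (s * f x) mF F0); apply: eq_integral => z _.
  by congr ((expR _)%:E * _)%E; field.
rewrite (fubini_tonelli (fun w : T * mR => (expR (s * w.2 * f w.1 - s ^+ 2 / 2 * f w.1 ^+ 2))%:E * F w.2)%E)//; first last.
- by move=> w; rewrite mule_ge0// lee_fin expR_ge0.
- by mble.
apply: eq_integral => z _ /=; rewrite ge0_integralZr//; first by rewrite tiltE.
by mble.
Qed.

Lemma integral_tilt s : (\int[@gauss R]_z (tilt s z)%:E = 1)%E.
Proof.
have := @gauss_tilt s (fun=> 1%E) (measurable_cst _) (fun=> lee01).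
by rewrite !integral_prob_cst => ->; apply: eq_integral => z _; rewrite mule1.
Qed.

(** The relative entropy of the channel output with respect to N(0, 1). It is [psi] at s ^+ 2 when 0
    <= s ([psi_free_energy]). *)
Definition free_energy (s : R) : R :=
  \int[(P \x @gauss R)%E]_w ln (tilt s (s * f w.1 + w.2)).

(** Nonnegativity of relative entropy: ln q <= q - 1 for q = g / tilt, whose mean under the channel
    is the Gaussian mass of g. It gives the lower bound on [free_energy] as well as the treatment of
    negative overlaps. *)
Lemma gauss_channel_gibbs s (g : mR -> mR) : measurable_fun setT g -> (forall y, 0 < g y) ->
  (\int[@gauss R]_z (g z)%:E <= 1)%E ->
  itg (P \x @gauss R)%E (fun w => ln (g (s * f w.1 + w.2))) ->
  itg (P \x @gauss R)%E (fun w => ln (tilt s (s * f w.1 + w.2))) ->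
  \int[(P \x @gauss R)%E]_w ln (g (s * f w.1 + w.2)) <= free_energy s.
Proof.
move=> mg g0 g1 ig ie.
have me := measurable_tilt s.
have e0 := tilt_gt0 s.
pose y (w : T * mR) : mR := s * f w.1 + w.2.
pose q (z : mR) := g z * expR (- ln (tilt s z)).
have mq : measurable_fun setT q.
  apply: measurable_funM => //; apply: (measurableT_comp (@measurable_expR _)).
  by apply: measurable_funN; apply: (measurableT_comp (@measurable_ln _)).
have qE z : q z = g z / tilt s z by rewrite /q expRN lnK// posrE.
have q0 z : 0 <= q z by rewrite qE divr_ge0// ltW.
clearbody q.
have mqy : measurable_fun setT (fun w => (q (y w))%:E) by rewrite /y; mble.
have Eq : (\int[(P \x @gauss R)%E]_w (q (y w))%:E <= 1)%E.
  have -> : (\int[(P \x @gauss R)%E]_w (q (y w))%:E = \int[P]_x \int[@gauss R]_z (q (s * f x + z)%R)%:E)%E.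
    apply: (fubini_tonelli1 (fun w => (q (y w))%:E)); first exact: mqy.
    by move=> w; rewrite lee_fin.
  rewrite [leLHS](gauss_tilt s (F := fun z => (q z)%:E)); [|by mble|by move=> z; rewrite lee_fin].
  apply: le_trans g1; rewrite le_eqVlt; apply/orP; left; apply/eqP; apply: eq_integral => z _.
  by rewrite -EFinM qE mulrC divfK// gt_eqF.
have iq : itg (P \x @gauss R)%E (q \o y).
  apply: itg_ge0; [exact/measurable_EFinP|by move=> w; exact: q0|].
  by apply: le_lt_trans Eq _; rewrite ltry.
have : \int[(P \x @gauss R)%E]_w ln (g (y w)) <=
   \int[(P \x @gauss R)%E]_w (-1 + 1 * ln (tilt s (y w)) + 1 * q (y w) + 0 * q (y w)).
  apply: Rintegral_le => //; first exact: itg_lin3.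
  move=> w; have gp := g0 (y w); have ep := e0 (y w).
  have q1 : 0 < q (y w) by rewrite qE divr_gt0.
  have := le_ln1Dx (x := q (y w) - 1); rewrite [1 + _]addrC subrK qE ln_div ?posrE// -qE.
  by move=> h; have := h ltac:(lra); lra.
rewrite Rintegral_lin3// => h.
have : \int[(P \x @gauss R)%E]_w (q (y w)) <= 1.
  by rewrite -lee_fin ge0_RintegralE.
move: h; rewrite /free_energy -/(y _); lra.
Qed.

Lemma itg_prod_snd d' (U : measurableType d') (Q : probability U R) (h : U -> R) :
  (forall z, 0 <= h z) -> itg Q h -> itg (P \x Q)%E (fun w => h w.2).
Proof.
move=> h0 ih; have mh := itg_measurable ih.
have m : measurable_fun setT (fun w : T * U => (h w.2)%:E).
  by apply/measurable_EFinP; apply: (measurableT_comp mh).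
apply: itg_ge0 => //; first exact/measurable_EFinP.
have -> : (\int[(P \x Q)%E]_w (h w.2)%:E = \int[P]_x \int[Q]_z (h z)%:E)%E.
  by apply: (fubini_tonelli1 (fun w : T * U => (h w.2)%:E)) => // w; rewrite lee_fin.
by rewrite integral_prob_cst -ge0_RintegralE// ltry.
Qed.

Lemma Rintegral_prod_snd d' (U : measurableType d') (Q : probability U R) (h : U -> R) :
  (forall z, 0 <= h z) -> itg Q h -> \int[(P \x Q)%E]_w h w.2 = \int[Q]_z h z.
Proof.
move=> h0 ih; have mh := itg_measurable ih.
apply: RintegralEFin.
have -> : (\int[(P \x Q)%E]_w (h w.2)%:E = \int[P]_x \int[Q]_z (h z)%:E)%E.
  apply: (fubini_tonelli1 (fun w : T * U => (h w.2)%:E)) => [|w]; last by rewrite lee_fin.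
  by apply/measurable_EFinP; apply: (measurableT_comp mh).
by rewrite integral_prob_cst -ge0_RintegralE.
Qed.

Lemma ln_tilt_bound S s s0 w : `|s| <= S -> `|s0| <= S ->
  `|ln (tilt s (s0 * f w.1 + w.2))| <= 3 / 2 * (S * K) ^+ 2 + S * K * `|w.2|.
Proof.
move=> sS s0S; have S0 : 0 <= S by exact: le_trans s0S.
apply: (le_trans (ln_tilt_le _ _)); rewrite /tilt_bound.
have h1 : `|s0 * f w.1 + w.2| <= S * K + `|w.2|.
  apply: (le_trans (ler_normD _ _)); rewrite lerD2r normrM.
  by apply: ler_pM.
have h2 : s ^+ 2 <= S ^+ 2 by rewrite -[s ^+ 2]real_normK ?num_real// lerXn2r ?nnegrE.
have h3 : `|s| * K * `|s0 * f w.1 + w.2| <= S * K * (S * K + `|w.2|).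
  by apply: ler_pM => //; [apply: mulr_ge0 => //; exact: K0|apply: ler_wpM2r => //; exact: K0].
have h4 : s ^+ 2 / 2 * K ^+ 2 <= S ^+ 2 / 2 * K ^+ 2.
  by apply: ler_wpM2r; [exact: sqr_ge0|rewrite ler_wpM2r].
by move: h3 h4; rewrite exprMn; clear; lra.
Qed.

Lemma measurable_ln_tilt s s0 :
  measurable_fun setT (fun w : T * mR => ln (tilt s (s0 * f w.1 + w.2))).
Proof.
have me := measurable_tilt s.
apply: (measurableT_comp (@measurable_ln _)).
by apply: (measurableT_comp me); mble.
Qed.

Lemma itg_ln_tilt s s0 : itg (P \x @gauss R)%E (fun w => ln (tilt s (s0 * f w.1 + w.2))).
Proof.
pose S := Num.max `|s| `|s0|.
have sS : `|s| <= S by rewrite le_max lexx.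
have s0S : `|s0| <= S by rewrite le_max lexx orbT.
have S0 : 0 <= S by exact: le_trans s0S.
have SK0 : 0 <= S * K by rewrite mulr_ge0// K0.
apply: (itg_le (g := fun w : T * mR => 3 / 2 * (S * K) ^+ 2 + S * K * expR (1 * `|w.2|))).
- exact: measurable_ln_tilt.
- move=> w; apply: (le_trans (ln_tilt_bound w sS s0S)); rewrite lerD2l ler_wpM2l//.
  by rewrite mul1r; have := expR_ge1Dx `|w.2|; lra.
- apply: itgD; first exact: itg_cst.
  apply: itgZ; apply: (itg_prod_snd (h := fun z : mR => expR (1 * `|z|))); last exact: itg_gauss_exp.
  by move=> z; exact: expR_ge0.
Qed.

Lemma itg_gauss_tilt s t : itg (@gauss R) (fun z => tilt s (t + z)).
Proof.
apply: (itg_le (g := fun z : mR => expR (`|s| * K * `|t| + s ^+ 2 / 2 * K ^+ 2) * expR (`|s| * K * `|z|))).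
- by apply: (measurableT_comp (measurable_tilt s)); mble.
- move=> z; rewrite (ger0_norm (ltW (tilt_gt0 _ _))); apply: (le_trans (tilt_le _ _)).
  rewrite -expRD ler_expR /tilt_bound addrAC lerD2r -mulrDr.
  by apply: ler_wpM2l; [exact: mulr_ge0|exact: ler_normD].
- by apply: itgZ; exact: itg_gauss_exp.
Qed.

(** This is where small exponents pay: to first order in a only the mean of the logarithm matters.
    The strength s of the tilt and the strength s0 of the signal are kept apart because they have
    opposite signs for negative overlaps. *)
Lemma tilt_powR_le S : exists2 C, 0 <= C & forall s s0 a, `|s| <= S -> `|s0| <= S -> 0 < a < 1 ->
  (\int[P]_x \int[@gauss R]_z (tilt s (s0 * f x + z) `^ a)%:E <=
   (expR (a * (\int[(P \x @gauss R)%E]_w ln (tilt s (s0 * f w.1 + w.2))) + C * a ^+ 2))%:E)%E.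
Proof.
(* With l the logarithm, l ^+ 2 * expR |l| <= 2 * expR (2 * |l|), and |l| <= 3/2 (S K) ^+ 2 + S K
   |z| by [ln_tilt_bound]; this fixes B and D. *)
pose B := 2 * (S * K).
pose D := 2 * expR (3 * (S * K) ^+ 2).
pose h (z : mR) := expR (B * `|z|).
have ih : itg (@gauss R) h by exact: itg_gauss_exp.
have h0 z : 0 <= h z by exact: expR_ge0.
have D0 : 0 <= D by rewrite /D; pos.
exists (D * \int[@gauss R]_z h z); first by apply: mulr_ge0 => //; exact: Rintegral_ge0.
move=> s s0 a sS s0S /andP[a0 a1].
have me := measurable_tilt s.
pose l (w : T * mR) := ln (tilt s (s0 * f w.1 + w.2)).
have il : itg (P \x @gauss R)%E l by exact: itg_ln_tilt.
have ihs : itg (P \x @gauss R)%E (fun w => h w.2) by exact: itg_prod_snd.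
have le w : tilt s (s0 * f w.1 + w.2) `^ a <= 1 + a * l w + a ^+ 2 * D * h w.2 + 0 * l w.
  have lb := ln_tilt_bound w sS s0S; rewrite -/(l w) in lb.
  rewrite /powR gt_eqF ?tilt_gt0// -/(l w).
  have := expR_taylor1 (a * l w) => /ler_normlP[_ t1].
  have t2 : (a * l w) ^+ 2 * expR `|a * l w| <= a ^+ 2 * D * h w.2.
    rewrite (_ : (a * l w) ^+ 2 * _ = a ^+ 2 * (l w ^+ 2 * expR `|a * l w|)); last by ring.
    rewrite (_ : a ^+ 2 * D * h w.2 = a ^+ 2 * (D * h w.2)); last by ring.
    apply: ler_wpM2l; first exact: sqr_ge0.
    apply: (@le_trans _ _ ((2 * expR `|l w|) * expR `|l w|)).
      apply: ler_pM; [exact: sqr_ge0|exact: expR_ge0|exact: sqr_le_exp|].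
      by rewrite ler_expR normrM gtr0_norm// ler_piMl// ltW.
    rewrite -mulrA /D -mulrA ler_wpM2l// -!expRD ler_expR /B.
    by move: lb; clear; lra.
  by rewrite mul0r addr0; move: t1 t2; clear; lra.
have m : measurable_fun setT (fun w : T * mR => tilt s (s0 * f w.1 + w.2) `^ a).
  by apply: (measurableT_comp (measurable_powR _)); apply: (measurableT_comp me); mble.
have i := itg_lin3 1 a (a ^+ 2 * D) 0 il ihs il.
have ip : itg (P \x @gauss R)%E (fun w => tilt s (s0 * f w.1 + w.2) `^ a).
  by apply: itg_le m _ i => w; rewrite ger0_norm ?powR_ge0.
have -> : (\int[P]_x \int[@gauss R]_z (tilt s (s0 * f x + z) `^ a)%:E =
    \int[(P \x @gauss R)%E]_w (tilt s (s0 * f w.1 + w.2) `^ a)%:E)%E.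
  apply/esym/(fubini_tonelli1 (fun w : T * mR => (tilt s (s0 * f w.1 + w.2) `^ a)%:E)); first exact/measurable_EFinP.
  by move=> w; rewrite lee_fin powR_ge0.
rewrite -ge0_RintegralE//; last by move=> w; exact: powR_ge0.
rewrite lee_fin; apply: (le_trans (Rintegral_le ip i le)).
rewrite Rintegral_lin3// Rintegral_prod_snd// mul0r addr0.
apply: le_trans (expR_ge1Dx _); rewrite addrA lerD2l.
by rewrite (_ : D * _ * a ^+ 2 = a ^+ 2 * D * (\int[@gauss R]_z h z))//; ring.
Qed.

(** [tilt] (- s) is also a probability density, so Gibbs applies. Thus a negative overlap is no
    better than a positive one, although P may be asymmetric. *)
Lemma tilt_opp_le s : \int[(P \x @gauss R)%E]_w ln (tilt (- s) (s * f w.1 + w.2)) <= free_energy s.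
Proof.
apply: gauss_channel_gibbs; [exact: measurable_tilt|by move=> y; exact: tilt_gt0| | |].
- by rewrite integral_tilt.
- exact: itg_ln_tilt.
- exact: itg_ln_tilt.
Qed.

Hypotheses (f_mean : \int[P]_x f x = 0) (f_var : \int[P]_x (f x) ^+ 2 = 1).

(** Gibbs' inequality against the density g of N(0, 1 + r) relative to N(0, 1), the centred Gaussian
    law with the variance of the output. *)
Lemma free_energy_ge s : (s ^+ 2 - ln (1 + s ^+ 2)) / 2 <= free_energy s.
Proof.
set r := s ^+ 2; have r0 : 0 <= r by exact: sqr_ge0.
have r1 : 0 < 1 + r by lra.
pose a := r / (1 + r).
have a1 : 1 - a = (1 + r)^-1 by rewrite /a; field; rewrite gt_eqF.
have a0 : 0 <= a by rewrite divr_ge0// ltW.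
pose c := ln (1 + r) / 2.
pose g (y : mR) := expR (a * y ^+ 2 / 2 - c).
have al1 : a < 1 by rewrite -subr_gt0 a1 invr_gt0.
have ef : itg P f by apply: (itg_le (g := fun=> K)) => //; exact: itg_cst.
have ef2 : itg P (fun x => f x ^+ 2).
  apply: (itg_le (g := fun=> K ^+ 2)); [by mble| |exact: itg_cst].
  by move=> x; rewrite normrX lerXn2r ?nnegrE// K0.
pose y (w : T * mR) := s * f w.1 + w.2.
pose V := \int[@gauss R]_z z ^+ 2.
have iz : itg (@gauss R) (fun z => z).
  apply: (itg_le (g := fun z : mR => expR (1 * `|z|))); [by mble| |exact: itg_gauss_exp].
  by move=> z; rewrite mul1r; have := expR_ge1Dx `|z|; lra.
(* M multiplies the mean of f, which is zero, and so disappears from the second moment of the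
   output. *)
pose M := \int[@gauss R]_z z.
have Iy : (\int[(P \x @gauss R)%E]_w (y w ^+ 2)%:E = (r + V)%:E)%E.
  have -> : (\int[(P \x @gauss R)%E]_w (y w ^+ 2)%:E = \int[P]_x \int[@gauss R]_z ((s * f x + z) ^+ 2)%:E)%E.
    apply: (fubini_tonelli1 (fun w : T * mR => ((s * f w.1 + w.2) ^+ 2)%:E)); first by mble.
    by move=> w; rewrite lee_fin sqr_ge0.
  have inner x : (\int[@gauss R]_z ((s * f x + z) ^+ 2)%:E = (V + 2 * s * M * f x + r * f x ^+ 2 + 0 * f x)%:E)%E.
    have e z : (s * f x + z) ^+ 2 = (s * f x) ^+ 2 + 2 * (s * f x) * z + 1 * z ^+ 2 + 0 * z by ring.
    have il := itg_lin3 ((s * f x) ^+ 2) (2 * (s * f x)) 1 0 iz (@itg_gauss_sqr R) iz.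
    rewrite -ge0_RintegralE; first last.
    - by rewrite (_ : (fun z => _) = (fun z => (s * f x) ^+ 2 + 2 * (s * f x) * z + 1 * z ^+ 2 + 0 * z))//; apply/funext.
    - by move=> z; exact: sqr_ge0.
    under eq_Rintegral do rewrite e.
    rewrite Rintegral_lin3//; last exact: itg_gauss_sqr.
    by rewrite -/V -/M /r; congr EFin; ring.
  under eq_integral do rewrite inner.
  have il := itg_lin3 V (2 * s * M) r 0 ef ef2 ef.
  rewrite -ge0_RintegralE//; first by rewrite Rintegral_lin3// f_mean f_var; congr EFin; ring.
  by move=> x; rewrite -lee_fin -inner; apply: integral_ge0 => z _; rewrite lee_fin sqr_ge0.
have iy : itg (P \x @gauss R)%E (fun w => y w ^+ 2).
  by apply: itg_ge0; [rewrite /y; mble|move=> w; exact: sqr_ge0|rewrite Iy ltry].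
have il : itg (P \x @gauss R)%E (fun w => ln (g (y w))).
  have := itg_lin3 (- c) (a / 2) 0 0 iy iy iy; congr itg; apply/funext => w.
  by rewrite /g expRK; ring.
have := @gauss_channel_gibbs s g _ _ _ il (itg_ln_tilt s s).
have -> : \int[(P \x @gauss R)%E]_w ln (g (s * f w.1 + w.2)) = - c + a / 2 * (r + V).
  transitivity (\int[(P \x @gauss R)%E]_w (- c + (a / 2) * y w ^+ 2 + 0 * y w ^+ 2 + 0 * y w ^+ 2)).
    by apply: eq_Rintegral => w _; rewrite /g expRK /y; ring.
  by rewrite Rintegral_lin3// (RintegralEFin Iy); ring.
move=> h; apply: le_trans (h _ _ _).
- have V1 : 1 <= V by exact: gauss_sqr_ge1.
  have e : a * (r + 1) = r by rewrite /a [r + 1]addrC divfK// gt_eqF.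
  have : a * 1 <= a * V by apply: ler_wpM2l.
  by rewrite /c; lra.
- by rewrite /g; mble.
- by move=> z; exact: expR_gt0.
- rewrite /g; under eq_integral do rewrite expRD EFinM.
  rewrite ge0_integralZr//; last by mble.
  rewrite gauss_sqr_mgf// a1 -EFinM lee_fin /c.
  rewrite expRN; set E := expR (ln (1 + r) / 2).
  have E0 : 0 < E by exact: expR_gt0.
  have -> : 1 + r = E ^+ 2.
    by rewrite /E -expRM_natl (_ : 2%:R * _ = ln (1 + r)) ?lnK// mulrC divfK.
  by rewrite -exprVn sqrtr_sqr gtr0_norm ?invr_gt0// invrK divff// gt_eqF.
Qed.

End tilted_density.

(** * Overlap with the planted spike *)

Lemma sum_edge (R : realType) N (a : 'I_N -> R) :
  2 * (\sum_(e in edge N) a e.1 * a e.2) + \sum_i a i ^+ 2 = (\sum_i a i) ^+ 2.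
Proof.
have -> : (\sum_i a i) ^+ 2 = \sum_(e : 'I_N * 'I_N) a e.1 * a e.2.
  rewrite expr2 mulr_suml -(pair_bigA _ (fun i j => a i * a j)) /=.
  by apply: eq_bigr => i _; rewrite mulr_sumr.
rewrite [RHS](bigID (fun e : 'I_N * 'I_N => (e.1 < e.2)%N)) /=.
rewrite [X in _ = _ + X](bigID (fun e : 'I_N * 'I_N => (e.2 < e.1)%N)) /=.
rewrite mulr_natl mulr2n -addrA; congr (_ + _).
  by apply: eq_bigl => e; rewrite inE.
congr (_ + _).
  rewrite (reindex_inj (h := fun e : 'I_N * 'I_N => (e.2, e.1))) /=; last by move=> [i j] [k l] /= [-> ->].
  apply: eq_big => [[i j]|[i j] _] /=; last by rewrite mulrC.
  by rewrite inE /=; case: ltngtP.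
rewrite (eq_bigl (fun e : 'I_N * 'I_N => e.1 == e.2)); last first.
  by move=> [i j] /=; rewrite -!leqNgt -eqn_leq eq_sym.
rewrite -(pair_big_dep xpredT (fun i j : 'I_N => i == j) (fun i j => a i * a j)) /=.
by apply: eq_bigr => i _; rewrite (big_pred1 i) ?expr2// => j; rewrite eq_sym.
Qed.

Lemma powR_le1D (R : realType) (x a : R) : 0 <= x -> 0 < a < 1 -> x `^ a <= 1 + x.
Proof.
move=> x0 /andP[a0 a1]; have [h|h] := leP 1 x.
  by apply: (le_trans (ler1_powR h (ltW a1))); lra.
apply: (@le_trans _ _ (1 `^ a)); last by rewrite powR1; lra.
by apply: ge0_ler_powR; rewrite ?nnegrE//; exact: ltW.
Qed.

Lemma powR_prod (R : realType) n (F : 'I_n -> R) a : (forall i, 0 <= F i) ->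
  (\prod_(i < n) F i) `^ a = \prod_(i < n) F i `^ a.
Proof.
move=> F0; elim: n F F0 => [|n IH] F F0; first by rewrite !big_ord0 powR1.
by rewrite !big_ord_recl powRM ?IH// prodr_ge0.
Qed.

Lemma measurable_section d d' d'' (T : measurableType d) (U : measurableType d') (V : measurableType d'') (h : T -> U -> V) x :
  measurable_fun setT (fun w : T * U => h w.1 w.2) -> measurable_fun setT (h x).
Proof. by move=> mh; exact: (measurableT_comp mh (pair1_measurable x)). Qed.

(** Tensorisation: for fixed y the integral over z factorises over the coordinates, and then so does
    the integral over y. *)
Lemma integral_iid_channel d (T : measurableType d) (R : realType) (P : probability T R) d' (U : measurableType d')
    (Q : probability U R) N (h : T -> U -> R) C :
  measurable_fun setT (fun w : T * U => h w.1 w.2) -> (forall x z, 0 <= h x z) ->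
  (forall x, (\int[Q]_z (h x z)%:E < +oo)%E) ->
  (\int[P]_x \int[Q]_z (h x z)%:E <= C%:E)%E ->
  (\int[iid P N]_y \int[iid Q N]_z (\prod_(i < N) h (tnth y i) (tnth z i))%:E <= (C ^+ N)%:E)%E.
Proof.
move=> mh h0 fin hC.
have pos x : (0 <= \int[Q]_z (h x z)%:E)%E by apply: integral_ge0 => z _; rewrite lee_fin.
pose c x := fine (\int[Q]_z (h x z)%:E).
have cE x : (\int[Q]_z (h x z)%:E = (c x)%:E)%E by rewrite fineK// ge0_fin_numE.
have c0 x : 0 <= c x by exact: fine_ge0.
have mc : measurable_fun setT c.
  apply: (measurableT_comp (@fine_measurable _ setT measurableT)).
  apply: (measurable_fun_fubini_tonelli_F (fun w : T * U => (h w.1 w.2)%:E)) ; last by move=> w; rewrite lee_fin.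
  exact/measurable_EFinP.
have posx : (0 <= \int[P]_x (c x)%:E)%E by apply: integral_ge0 => x _; rewrite lee_fin.
have le : (\int[P]_x (c x)%:E <= C%:E)%E by apply: le_trans hC; under eq_integral do rewrite -cE.
pose D := fine (\int[P]_x (c x)%:E).
have DE : (\int[P]_x (c x)%:E = D%:E)%E.
  by rewrite fineK// ge0_fin_numE// (le_lt_trans le)// ltry.
rewrite (eq_integral (fun y => (\prod_(i < N) c (tnth y i))%:E)); last first.
  move=> y _; apply: (@integral_iid_prod _ U R Q N (fun i z => h (tnth y i) z)) => // i.
  exact: measurable_section.
rewrite (@integral_iid_prod _ T R P N (fun=> c) (fun=> D))//.
rewrite prodr_const card_ord lee_fin lerXn2r ?nnegrE//.
- exact: fine_ge0.
- by rewrite -lee_fin (le_trans posx).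
- by rewrite -lee_fin -DE.
Qed.

Section spike.
Context d (T : measurableType d) (R : realType) (P : probability T R).
Notation mR := (measurableTypeR R).
Notation gaussn := (iid (@gauss R)).
Variables (f : T -> mR) (K : R).
Hypotheses (mf : measurable_fun setT f) (fK : forall x, `|f x| <= K).
Variables (lam : R) (N : nat).
Hypotheses (lam0 : 0 < lam) (N0 : (0 < N)%N).

Definition overlap (x y : N.-tuple T) : R := \sum_(i < N) f (tnth x i) * f (tnth y i).

Definition spike (x : N.-tuple T) : #|edge N|.-tuple mR :=
  [tuple Num.sqrt (lam / N%:R) * f (tnth x (enum_val k).1) * f (tnth x (enum_val k).2) | k < #|edge N|].

Definition field (s : R) (x : N.-tuple T) : N.-tuple mR := [tuple s * f (tnth x i) | i < N].

Let NR0 : 0 < N%:R :> R. Proof. by rewrite ltr0n. Qed.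
Let K0 : 0 <= K. Proof. exact: (probability_bound_ge0 P fK). Qed.

Lemma measurable_coord d' (U : measurableType d') (g : U -> N.-tuple T) i :
  measurable_fun setT g -> measurable_fun setT (fun x => f (tnth (g x) i)).
Proof.
move=> mg; apply: (measurableT_comp mf).
exact: (measurableT_comp (@measurable_tnth _ T N i) mg).
Qed.

Lemma measurable_spike : measurable_fun setT spike.
Proof.
apply/measurable_fun_tnthP => k.
apply: (eq_measurable_fun (fun x => Num.sqrt (lam / N%:R) * f (tnth x (enum_val k).1) * f (tnth x (enum_val k).2))).
  by move=> x _ /=; rewrite tnth_mktuple.
by apply: measurable_funM; [apply: measurable_funM|]; do ?exact: measurable_cst; exact: measurable_coord.
Qed.

Lemma measurable_field s : measurable_fun setT (field s).
Proof.
apply/measurable_fun_tnthP => k.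
apply: (eq_measurable_fun (fun x => s * f (tnth x k))).
  by move=> x _ /=; rewrite tnth_mktuple.
by apply: measurable_funM; [exact: measurable_cst|exact: measurable_coord].
Qed.

Lemma measurable_overlap d' (U : measurableType d') (g h : U -> N.-tuple T) :
  measurable_fun setT g -> measurable_fun setT h ->
  measurable_fun setT (fun x => overlap (g x) (h x) : mR).
Proof.
move=> mg mh; apply: measurable_sum => i.
by apply: measurable_funM; exact: measurable_coord.
Qed.

Lemma overlapC x y : overlap x y = overlap y x.
Proof. by apply: eq_bigr => i _; rewrite mulrC. Qed.

Lemma overlap_bound x y : `|overlap x y| <= N%:R * K ^+ 2.
Proof.
apply: (le_trans (ler_norm_sum _ _ _)).
apply: (@le_trans _ _ (\sum_(i < N) K ^+ 2)); last by rewrite sumr_const card_ord mulr_natl.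
by apply: ler_sum => i _; rewrite normrM expr2 ler_pM.
Qed.

Lemma dot_field s x y : dot (field s x) (field s y) = s ^+ 2 * overlap x y.
Proof.
rewrite /dot /overlap mulr_sumr; apply: eq_bigr => i _.
by rewrite !tnth_mktuple; ring.
Qed.

(** Only pairs i < j are observed, so the diagonal leaves the square of the overlap. It is at most N
    K ^+ 4, a bounded correction after division by N. *)
Lemma dot_spike x y : dot (spike x) (spike y) =
  lam / (2 * N%:R) * (overlap x y ^+ 2 - \sum_(i < N) (f (tnth x i) * f (tnth y i)) ^+ 2).
Proof.
rewrite /overlap -sum_edge addrK.
rewrite /dot (big_enum_val (fun e : 'I_N * 'I_N => f (tnth x e.1) * f (tnth y e.1) * (f (tnth x e.2) * f (tnth y e.2)))) /=.
rewrite mulr_sumr mulr_sumr; apply: eq_bigr => k _.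
rewrite !tnth_mktuple.
have := sqr_sqrtr (divr_ge0 (ltW lam0) (ltW NR0)).
set t := Num.sqrt _ => t2.
transitivity (t ^+ 2 * (f (tnth x (enum_val k).1) * f (tnth y (enum_val k).1) * (f (tnth x (enum_val k).2) * f (tnth y (enum_val k).2)))); first by ring.
by rewrite t2; field; rewrite gt_eqF.
Qed.

Lemma sum_sqr_bound x y : 0 <= \sum_(i < N) (f (tnth x i) * f (tnth y i)) ^+ 2 <= N%:R * K ^+ 4.
Proof.
apply/andP; split; first by apply: sumr_ge0 => i _; exact: sqr_ge0.
apply: (@le_trans _ _ (\sum_(i < N) K ^+ 4)); last by rewrite sumr_const card_ord mulr_natl.
apply: ler_sum => i _; rewrite -real_normK ?num_real// normrM.
rewrite (_ : K ^+ 4 = (K * K) ^+ 2); last by ring.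
by rewrite lerXn2r ?nnegrE ?mulr_ge0// ler_pM.
Qed.

Lemma dot_spike_le x y : dot (spike x) (spike y) <= lam / (2 * N%:R) * overlap x y ^+ 2.
Proof.
rewrite dot_spike; apply: ler_wpM2l; first by rewrite divr_ge0 ?mulr_ge0 ?ltW.
by have /andP[] := sum_sqr_bound x y; rewrite gerBl.
Qed.

Lemma dot_spike_ge x y : lam / (2 * N%:R) * overlap x y ^+ 2 - lam * K ^+ 4 / 2 <= dot (spike x) (spike y).
Proof.
rewrite dot_spike mulrBr lerD2l lerN2.
have -> : lam * K ^+ 4 / 2 = lam / (2 * N%:R) * (N%:R * K ^+ 4) by field; rewrite gt_eqF.
apply: ler_wpM2l; first by rewrite divr_ge0 ?mulr_ge0 ?ltW.
by have /andP[] := sum_sqr_bound x y.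
Qed.

Lemma overlap_sqr_le x y : overlap x y ^+ 2 <= N%:R ^+ 2 * K ^+ 4.
Proof.
rewrite -real_normK ?num_real//.
rewrite (_ : N%:R ^+ 2 * K ^+ 4 = (N%:R * K ^+ 2) ^+ 2); last by ring.
by rewrite lerXn2r ?nnegrE ?mulr_ge0 ?sqr_ge0// overlap_bound.
Qed.

Lemma dot_spike_bound x y : dot (spike x) (spike y) <= lam / 2 * N%:R * K ^+ 4.
Proof.
apply: (le_trans (dot_spike_le x y)).
have -> : lam / 2 * N%:R * K ^+ 4 = lam / (2 * N%:R) * (N%:R ^+ 2 * K ^+ 4) by field; rewrite gt_eqF.
apply: ler_wpM2l; first by rewrite divr_ge0 ?mulr_ge0 ?ltW.
exact: overlap_sqr_le.
Qed.

(** The coefficient lam * m of a planted tilt factors as ([sg] m * [sr] m) * [sr] m: a channel with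
    signal strength [sr] m, decoded with the sign of m. The sign of 0 is taken to be 1. *)
Let sg (m : R) : R := if 0 <= m then 1 else -1.
Let sr (m : R) : R := Num.sqrt (lam * `|m|).

(** The purpose of the comparison field: it acts on each coordinate separately, and the planted tilt
    becomes the signal of N independent scalar channels. *)
Lemma field_partE m (y : N.-tuple T) (z : N.-tuple mR) :
  part (iid P N) (fun x => expR (lam * m * overlap y x)) (field (sg m * sr m)) z =
  \prod_(i < N) tilt P f (sg m * sr m) (sr m * f (tnth y i) + tnth z i).
Proof.
have h : lam * m = sg m * sr m * sr m.
  rewrite -mulrA -expr2 sqr_sqrtr ?mulr_ge0 ?(ltW lam0)// /sg.
  by case: ifPn => [m0|]; rewrite -?ltNge; [rewrite ger0_norm//|move=> m0; rewrite ltr0_norm//]; ring.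
rewrite /part; apply: RintegralEFin.
have <- := @integral_iid_prod _ T R P N (fun i x => expR (sg m * sr m * (sr m * f (tnth y i) + tnth z i) * f x - (sg m * sr m) ^+ 2 / 2 * f x ^+ 2)) (fun i => tilt P f (sg m * sr m) (sr m * f (tnth y i) + tnth z i)).
- apply: eq_integral => x _; congr EFin.
  rewrite -expR_sum /wt -expRD; congr expR.
  rewrite dot_field /dot /overlap mulr_sumr mulr_sumr mulr_suml -sumrB -big_split/=.
  apply: eq_bigr => i _; rewrite tnth_mktuple h; ring.
- by move=> i; mble.
- by move=> i x; exact: expR_ge0.
- by move=> i; rewrite (tiltE P mf fK).
Qed.

(** Comparison of the spike with [field], followed by tensorisation. The covariance excess k is lam
    N m ^+ 2 / 2 plus the bounded correction of the missing diagonal; the scalar channels contribute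
    the free energy at signal-to-noise ratio lam |m|. *)
Lemma cell_bound M C a m : (forall s s0 a, `|s| <= Num.sqrt (lam * M) -> `|s0| <= Num.sqrt (lam * M) -> 0 < a < 1 ->
  (\int[P]_x \int[@gauss R]_z (tilt P f s (s0 * f x + z) `^ a)%:E <=
   (expR (a * (\int[(P \x @gauss R)%E]_w ln (tilt P f s (s0 * f w.1 + w.2))) + C * a ^+ 2))%:E)%E) ->
  0 < a < 1 -> `|m| <= M ->
  (\int[iid P N]_y \int[gaussn #|edge N|]_W
     (part (iid P N) (fun x => expR (lam * m * overlap y x)) spike W `^ a)%:E <=
   (2 * expR (a * (1 - a) / 2 * (lam * N%:R * m ^+ 2 / 2 + lam * K ^+ 4 / 2)) *
      expR (N%:R * (a * free_energy P f (Num.sqrt (lam * `|m|)) + C * a ^+ 2)))%:E)%E.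
Proof.
move=> HC a01 mM; rewrite -/(sr m).
have M0 : 0 <= M by exact: le_trans mM.
have sgn : `|sg m| = 1 by rewrite /sg; case: ifP; rewrite ?normrN normr1.
have srm : `|sr m| <= Num.sqrt (lam * M).
  by rewrite ger0_norm ?sqrtr_ge0//; apply: ler_wsqrtr; rewrite ler_wpM2l// ltW.
have ssm : `|sg m * sr m| <= Num.sqrt (lam * M) by rewrite normrM sgn mul1r.
have s2 : (sg m * sr m) ^+ 2 = lam * `|m|.
  by rewrite exprMn sqr_sqrtr ?mulr_ge0 ?(ltW lam0)// -(real_normK (num_real (sg m))) sgn expr1n mul1r.
set k := lam * N%:R * m ^+ 2 / 2 + lam * K ^+ 4 / 2.
have k0 : 0 <= k by rewrite /k; have l0 := ltW lam0; pos.
pose rho (y x : N.-tuple T) : mR := expR (lam * m * overlap y x).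
have mrho y : measurable_fun setT (rho y).
  apply: (measurableT_comp (@measurable_expR _)); apply: measurable_funM; first exact: measurable_cst.
  by apply: measurable_overlap; [exact: measurable_cst|exact: measurable_id].
have irho y : itg (iid P N) (rho y).
  apply: (itg_le (g := fun=> expR (`|lam * m| * (N%:R * K ^+ 2)))); [exact: mrho| |exact: itg_cst].
  move=> x; rewrite ger0_norm ?expR_ge0// ler_expR; apply: (le_trans (ler_norm _)); rewrite normrM.
  by apply: ler_wpM2l => //; exact: overlap_bound.
pose c := lam / 2 * N%:R * K ^+ 4 + lam * `|m| * (N%:R * K ^+ 2).
have c1 : 0 <= lam / 2 * N%:R * K ^+ 4 by have := ltW lam0 => ?; pos.
have c2 : 0 <= lam * `|m| * (N%:R * K ^+ 2) by have := ltW lam0 => ?; pos.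
have comp y := gaussian_comparison (k := k) (c := c) a01 (fun x => expR_ge0 (lam * m * overlap y x)) (irho y) measurable_spike
  (measurable_field (sg m * sr m)) k0 (addr_ge0 c1 c2).
have ineq x y : dot (field (sg m * sr m) x) (field (sg m * sr m) y) <= dot (spike x) (spike y) + k.
  rewrite dot_field s2 /k.
  have := dot_spike_ge x y; set S := overlap x y => h.
  (* The difference is lam / (2 N) * (S - N |m|) ^+ 2: the linear covariance is tangent to the
     quadratic one at S = N |m|. *)
  suff : lam * `|m| * S <= lam / (2 * N%:R) * S ^+ 2 + lam * N%:R * m ^+ 2 / 2.
    by move: h; set A := lam / _ * _; set B := lam * _ * _ / 2; set D := lam * _ / 2; lra.
  rewrite -[m ^+ 2]real_normK ?num_real// -subr_ge0.
  have -> : lam / (2 * N%:R) * S ^+ 2 + lam * N%:R * `|m| ^+ 2 / 2 - lam * `|m| * S = lam / (2 * N%:R) * (S - N%:R * `|m|) ^+ 2.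
    by field; rewrite gt_eqF.
  by rewrite mulr_ge0 ?sqr_ge0// divr_ge0 ?mulr_ge0 ?ltW.
have {}comp y := comp y (fun x x' => le_trans (dot_spike_bound x x') (ler_wpDr c2 (lexx _))).
have vc x y : dot (field (sg m * sr m) x) (field (sg m * sr m) y) <= c.
  rewrite dot_field s2 /c; apply: ler_wpDl => //; apply: ler_wpM2l; first by rewrite mulr_ge0// ltW.
  by apply: (le_trans (ler_norm _)); exact: overlap_bound.
have {}comp y := comp y vc ineq.
have mjoint n (u : N.-tuple T -> n.-tuple mR) : measurable_fun setT u ->
   measurable_fun setT (fun z : N.-tuple T * n.-tuple mR => (part (iid P N) (rho z.1) u z.2 `^ a)%:E).
  move=> mu; apply: (@measurable_part_powR R _ _ (iid P N) a _ _ n (fun z => rho z.1)) => //.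
  - apply: (measurableT_comp (@measurable_expR _)); apply: measurable_funM; first exact: measurable_cst.
    by apply: measurable_overlap; mble.
  - by move=> z x; exact: expR_ge0.
set e := 2 * _.
have e0 : 0 <= e by rewrite /e; pos.
apply: (@le_trans _ _ (\int[iid P N]_y (e%:E * \int[gaussn N]_z (part (iid P N) (rho y) (field (sg m * sr m)) z `^ a)%:E))%E).
  apply: ge0_le_integral; [exact: measurableT| | | |].
  - by move=> y _; apply: integral_ge0 => W _; rewrite lee_fin powR_ge0.
  - by apply: (measurable_fun_fubini_tonelli_F _ (mjoint _ _ measurable_spike)) => z; rewrite lee_fin powR_ge0.
  - apply: emeasurable_funM; first exact: measurable_cst.
    by apply: (measurable_fun_fubini_tonelli_F _ (mjoint _ _ (measurable_field _))) => z; rewrite lee_fin powR_ge0.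
  - by move=> y _; exact: comp.
rewrite ge0_integralZl//; first last.
- by move=> y _; apply: integral_ge0 => W _; rewrite lee_fin powR_ge0.
- by apply: (measurable_fun_fubini_tonelli_F _ (mjoint _ _ (measurable_field _))) => z; rewrite lee_fin powR_ge0.
rewrite [in leRHS]EFinM; apply: lee_wpmul2l; first by rewrite lee_fin.
pose h (x : T) (z : mR) := tilt P f (sg m * sr m) (sr m * f x + z) `^ a.
have h0 x z : 0 <= h x z by exact: powR_ge0.
have me := measurable_tilt P mf (sg m * sr m).
have mh : measurable_fun setT (fun w : T * mR => h w.1 w.2).
  by apply: (measurableT_comp (measurable_powR _)); apply: (measurableT_comp me); mble.
have srm0 : `|sr m| <= Num.sqrt (lam * M) by exact: srm.
have HQ := HC (sg m * sr m) (sr m) a ssm srm0 a01.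
have fin x : (\int[@gauss R]_z (h x z)%:E < +oo)%E.
  have it := itg_gauss_tilt P mf fK (sg m * sr m) (sr m * f x).
  have : itg (@gauss R) (h x).
    apply: (itg_le (g := fun z : mR => 1 + tilt P f (sg m * sr m) (sr m * f x + z))).
    - exact: measurable_section.
    - move=> z; rewrite ger0_norm// /h.
      have := tilt_gt0 P mf fK (sg m * sr m) (sr m * f x + z); set I := tilt _ _ _ _ => I0.
      exact: powR_le1D (ltW I0) a01.
    - by apply: itgD; [exact: itg_cst|].
  by move=> i; rewrite -ge0_RintegralE// ltry.
have := integral_iid_channel N mh h0 fin HQ.
rewrite -expRM_natl => H.
apply: le_trans (le_trans H _).
  rewrite le_eqVlt; apply/orP; left; apply/eqP.
  apply: eq_integral => y _; apply: eq_integral => z _; congr EFin.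
  rewrite field_partE powR_prod// => i.
  exact/ltW/(tilt_gt0 P mf fK).
rewrite lee_fin ler_expR; apply: ler_wpM2l; first exact: ler0n.
rewrite lerD2r.
apply: ler_wpM2l; first by case/andP: a01 => /ltW.
rewrite /sg; case: ifP => _; first by rewrite mul1r.
by rewrite mulN1r; exact: tilt_opp_le.
Qed.

End spike.

(** Rounding |s| down to a multiple of eta stays below M and, as eta <= e / 2, above e / 2; staying
    away from 0 keeps a definite exponential gain at every grid point. *)
Lemma finite_grid (R : realType) (e M eta : R) : 0 < eta -> eta <= e / 2 ->
  exists ms : seq R, (forall m, m \in ms -> e / 2 <= `|m| <= M) /\
    forall s, e < `|s| <= M -> exists2 m, m \in ms & `|s - m| <= eta.
Proof.
move=> eta0 etae.
pose J := Num.truncn (M / eta).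
pose g := [seq eta * j%:R | j <- iota 0 J.+1].
exists [seq m <- g ++ [seq - m | m <- g] | e / 2 <= `|m| <= M]; split.
  by move=> m; rewrite mem_filter => /andP[].
have key s : e < s <= M -> exists2 j, (j <= J)%N & e / 2 <= eta * j%:R <= M /\ `|s - eta * j%:R| <= eta.
  move=> /andP[es sM]; pose j := Num.truncn (s / eta).
  have s0 : 0 <= s / eta by rewrite divr_ge0//; lra.
  have /andP[h1 h2] := truncn_itv s0; rewrite -/j in h1 h2.
  have k1 : eta * j%:R <= s by move: h1; rewrite ler_pdivlMr// mulrC.
  have k2 : s < eta * j%:R + eta by move: h2; rewrite ltr_pdivrMr// -natr1 mulrC mulrDr mulr1.
  exists j; first by apply: le_truncn; rewrite ler_pM2r// invr_gt0.
  by split; [lra|rewrite ger0_norm; lra].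
move=> s; have [s0|s0] := leP 0 s.
  rewrite (ger0_norm s0) => /key[j jJ [/andP[j1 j2] j3]]; exists (eta * j%:R) => //.
  rewrite mem_filter ger0_norm ?mulr_ge0 ?(ltW eta0)// j1 j2 mem_cat; apply/orP; left.
  by apply/mapP; exists j => //; rewrite mem_iota.
rewrite (ltr0_norm s0) => /key[j jJ [/andP[j1 j2] j3]]; exists (- (eta * j%:R)) => //.
  rewrite mem_filter normrN ger0_norm ?mulr_ge0 ?(ltW eta0)// j1 j2 mem_cat; apply/orP; right.
  by apply/mapP; exists (eta * j%:R) => //; apply/mapP; exists j => //; rewrite mem_iota.
by rewrite -normrN opprB addrC.
Qed.

Lemma powR_subadditive (R : realType) (a x y : R) : 0 < a < 1 -> 0 <= x -> 0 <= y ->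
  (x + y) `^ a <= x `^ a + y `^ a.
Proof.
move=> /andP[a0 a1] x0 y0.
have key t s : 0 <= t -> 0 < s -> t <= s -> t / s * s `^ a <= t `^ a.
  move=> t0 s0 ts; move: t0; rewrite le_eqVlt => /orP[/eqP<-|t0]; first by rewrite !mul0r powR_ge0.
  have r01 : 0 < t / s <= 1 by rewrite divr_gt0// ler_pdivrMr// mul1r.
  have tE : t = t / s * s by rewrite divfK// gt_eqF.
  have r0 : 0 <= t / s by case/andP: r01 => /ltW.
  rewrite [in leRHS]tE (powRM _ r0 (ltW s0)) ler_wpM2r ?powR_ge0//.
  by apply: ger1_powR => //; exact: ltW.
have : 0 <= x + y by exact: addr_ge0.
rewrite le_eqVlt => /orP[/eqP<-|s0]; first by rewrite powR0 ?gt_eqF// addr_ge0 ?powR_ge0.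
have h1 := key x _ x0 s0 (ler_wpDr y0 (lexx x)).
have h2 := key y _ y0 s0 (ler_wpDl x0 (lexx y)).
apply: le_trans (lerD h1 h2); rewrite -mulrDl -mulrDl divff ?gt_eqF//; lra.
Qed.

Lemma powR_sum_le (R : realType) (I : Type) (ms : seq I) (F : I -> R) a : 0 < a < 1 -> (forall i, 0 <= F i) ->
  (\sum_(i <- ms) F i) `^ a <= \sum_(i <- ms) F i `^ a.
Proof.
move=> a01 F0; elim: ms => [|i ms IH].
  by rewrite !big_nil powR0// gt_eqF//; case/andP: a01.
rewrite !big_cons; apply: (le_trans (powR_subadditive a01 (F0 i) (sumr_ge0 _ (fun i _ => F0 i)))).
by rewrite lerD2l.
Qed.

Lemma ratio_le (R : realType) (Z L b a : R) : 0 <= Z -> 0 < L -> Z <= L -> 0 < a < 1 ->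
  Z * L `^ (-1) <= expR (- b) * L `^ (-1) + expR (a * b) * Z `^ a.
Proof.
move=> Z0 L0 ZL /andP[a0 a1]; rewrite (powR_inv1 (ltW L0)).
have Li : 0 < L^-1 by rewrite invr_gt0.
have p : 0 <= expR (a * b) * Z `^ a by rewrite mulr_ge0 ?expR_ge0 ?powR_ge0.
have [h|h] := leP Z (expR (- b)).
  by apply: ler_wpDr => //; apply: ler_wpM2r => //; exact: ltW.
have Z1 : 0 < Z by apply: lt_trans h; exact: expR_gt0.
apply: ler_wpDl; first by rewrite mulr_ge0 ?expR_ge0// ltW.
apply: (@le_trans _ _ 1); first by rewrite ler_pdivrMr// mul1r.
rewrite /powR gt_eqF// -expRD -expR0 ler_expR -mulrDr; apply: mulr_ge0; first exact: ltW.
have := ltW h; rewrite -{1}(lnK (x := Z)) ?posrE// ler_expR; lra.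
Qed.

Section expectation_sums.
Context d (T : measurableType d) (R : realType) (P : probability T R).

Lemma itg_sum (I : Type) (s : seq I) (F : I -> T -> R) : (forall i, itg P (F i)) ->
  itg P (fun x => \sum_(i <- s) F i x).
Proof.
move=> h; elim: s => [|i s IH].
  by under eq_fun do rewrite big_nil; exact: itg_cst.
by under eq_fun do rewrite big_cons; exact: itgD.
Qed.

Lemma Rintegral_sum (I : Type) (s : seq I) (F : I -> T -> R) : (forall i, itg P (F i)) ->
  \int[P]_x (\sum_(i <- s) F i x) = \sum_(i <- s) \int[P]_x F i x.
Proof.
move=> h; elim: s => [|i s IH].
  by rewrite big_nil; under eq_Rintegral do rewrite big_nil; exact: Rintegral_prob_cst.
rewrite big_cons -IH -RintegralD//; [|exact: h|exact: itg_sum].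
by apply: eq_Rintegral => x _; rewrite big_cons.
Qed.

End expectation_sums.

Lemma integral_sum_le d (T : measurableType d) (R : realType) (P : probability T R) (I : eqType) (ms : seq I)
    (F : I -> T -> R) B : (forall i, measurable_fun setT (F i)) -> (forall i x, 0 <= F i x) ->
  (forall i, i \in ms -> (\int[P]_x (F i x)%:E <= B%:E)%E) ->
  (\int[P]_x (\sum_(i <- ms) F i x)%:E <= ((size ms)%:R * B)%:E)%E.
Proof.
move=> mF F0; elim: ms => [|i ms IH] h.
  by rewrite mul0r; under eq_integral do rewrite big_nil; rewrite integral0.
have -> : (\int[P]_x (\sum_(j <- i :: ms) F j x)%:E = \int[P]_x ((F i x)%:E + (\sum_(j <- ms) F j x)%:E))%E.
  by apply: eq_integral => x _; rewrite big_cons EFinD.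
rewrite ge0_integralD//; first last.
- by apply/measurable_EFinP; exact: measurable_sum.
- by move=> x _; rewrite lee_fin sumr_ge0.
- exact/measurable_EFinP.
- by move=> x _; rewrite lee_fin.
have -> : ((size (i :: ms))%:R * B)%:E = (B%:E + ((size ms)%:R * B)%:E)%E.
  by rewrite /= -natr1 -EFinD; congr EFin; ring.
apply: leeD; first by apply: h; rewrite mem_head.
by apply: IH => j jms; apply: h; rewrite in_cons jms orbT.
Qed.

Lemma integral2E d d' (T : measurableType d) (U : measurableType d') (R : realType) (P : probability T R)
    (Q : probability U R) (F : T -> U -> R) :
  measurable_fun setT (fun z : T * U => F z.1 z.2) -> (forall x y, 0 <= F x y) ->
  (\int[P]_x \int[Q]_y (F x y)%:E = \int[(P \x Q)%E]_z (F z.1 z.2)%:E)%E.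
Proof.
move=> mF F0; apply/esym/(fubini_tonelli1 (fun z : T * U => (F z.1 z.2)%:E)); first exact/measurable_EFinP.
by move=> z; rewrite lee_fin.
Qed.

Lemma integral2_swap d d' (T : measurableType d) (U : measurableType d') (R : realType) (P : probability T R)
    (Q : probability U R) (F : T -> U -> R) :
  measurable_fun setT (fun z : T * U => F z.1 z.2) -> (forall x y, 0 <= F x y) ->
  (\int[P]_x \int[Q]_y (F x y)%:E = \int[Q]_y \int[P]_x (F x y)%:E)%E.
Proof.
move=> mF F0; apply: (fubini_tonelli (fun z : T * U => (F z.1 z.2)%:E)); first exact/measurable_EFinP.
by move=> z; rewrite lee_fin.
Qed.

(** * Change of measure between null and planted laws *)

Section planting.
Context d (X : measurableType d) (R : realType) (mu : probability X R).
Notation mR := (measurableTypeR R).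
Notation gaussn := (iid (@gauss R)).
Variables (n : nat) (u : X -> n.-tuple mR).
Hypothesis mu_u : measurable_fun setT u.

Lemma integral_planted (F : X -> n.-tuple mR -> R) :
  measurable_fun setT (fun z : X * n.-tuple mR => F z.1 z.2) -> (forall y W, 0 <= F y W) ->
  (\int[mu]_y \int[gaussn n]_W (F y (lin 1 1 (u y) W))%:E =
   \int[gaussn n]_W \int[mu]_y (wt (u y) W * F y W)%:E)%E.
Proof.
move=> mF F0.
transitivity (\int[mu]_y \int[gaussn n]_W (wt (u y) W * F y W)%:E)%E.
  apply: eq_integral => y _.
  rewrite (@gaussn_shift R n (u y) (fun W => (F y W)%:E)).
  - by apply: eq_integral => W _; rewrite -EFinM.
  - by apply/measurable_EFinP; exact: measurable_section.
  - by move=> W; rewrite lee_fin.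
apply: (fubini_tonelli (fun z : X * n.-tuple mR => (wt (u z.1) z.2 * F z.1 z.2)%:E)).
- by apply/measurable_EFinP; apply: measurable_funM => //; mble.
- by move=> z; rewrite lee_fin mulr_ge0 ?wt_ge0.
Qed.

Lemma integral_planted_part (F : n.-tuple mR -> R) :
  measurable_fun setT F -> (forall W, 0 <= F W) ->
  (\int[mu]_y \int[gaussn n]_W (F (lin 1 1 (u y) W))%:E =
   \int[gaussn n]_W (part mu (fun=> 1) u W * F W)%:E)%E.
Proof.
move=> mF F0; rewrite (@integral_planted (fun=> F))//; last exact: (measurableT_comp mF measurable_snd).
apply: eq_integral => W _.
rewrite EFinM partE//; last exact: itg_cst.
rewrite -ge0_integralZr//.
- by apply: eq_integral => y _; rewrite mul1r EFinM.
- by mble.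
- by move=> y _; rewrite lee_fin mul1r wt_ge0.
- by rewrite lee_fin.
Qed.

Lemma part1_gt0 c W : (forall x, dot (u x) (u x) <= c) -> 0 < part mu (fun=> 1) u W.
Proof.
move=> uc; have i := itg_part (fun=> ler01 : 0 <= (1 : R)) (itg_cst mu 1) mu_u W.
apply: (@lt_le_trans _ _ (expR (- c - dot W W / 2))); first exact: expR_gt0.
rewrite -[leLHS](Rintegral_prob_cst mu); apply: Rintegral_le => //; first exact: itg_cst.
move=> x; rewrite mul1r ler_expR.
have := uc x; have := dot_amgm (scal (-1) (u x)) W.
rewrite !dot_scall dot_scalr; lra.
Qed.

End planting.

Lemma measurable_part_joint d d' (X : measurableType d) (T : measurableType d') (R : realType)
    (mu : probability X R) n (rho : T -> X -> measurableTypeR R)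
    (u : X -> n.-tuple (measurableTypeR R)) (f : T -> n.-tuple (measurableTypeR R)) :
  measurable_fun setT (fun z : T * X => rho z.1 z.2) -> (forall t x, 0 <= rho t x) ->
  measurable_fun setT u -> measurable_fun setT f ->
  measurable_fun setT (fun t => part mu (rho t) u (f t)).
Proof.
move=> mr r0 mfu mf.
apply: (@measurable_Rintegral _ _ _ _ _ mu (fun t x => rho t x * wt (u x) (f t))).
  by apply: measurable_funM => //; mble.
by move=> t x; rewrite mulr_ge0// wt_ge0.
Qed.

(** In units of a n, the terms - lam m2 / 2 + lam m2 / 4 + F are at most - lam / 4 * (1 - lam /
    lam') * m2 <= - g, and the grid error and the fractional error take back g / 4 each. What
    remains, from the missing diagonal, is bounded in n. *)
Lemma planted_exponent (R : realType) (a lam lam' n m2 eta2 g C K4 F : R) : 0 < a <= 1 -> 0 <= n -> 0 <= lam ->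
  0 <= m2 -> 0 <= K4 -> lam * eta2 / 2 <= g / 4 -> C * a <= g / 4 -> F <= lam ^+ 2 * m2 / (4 * lam') ->
  g <= lam / 4 * (1 - lam / lam') * m2 -> lam' != 0 ->
  a * (lam * n / 2 * (eta2 - m2)) + a * (1 - a) / 2 * (lam * n * m2 / 2 + lam * K4 / 2) + n * (a * F + C * a ^+ 2)
   <= lam * K4 / 4 - a * g / 2 * n.
Proof.
move=> /andP[a0 a1] n0 l0 m0 K0 h1 h2 h3 h4 l'.
have E : lam / 4 * (1 - lam / lam') * m2 = lam * m2 / 4 - lam ^+ 2 * m2 / (4 * lam') by field.
have p1 : a * n * (lam * eta2 / 2 - lam * m2 / 2 + lam * m2 / 4 + F + C * a) <= a * n * (- g / 2).
  by apply: ler_wpM2l; [rewrite mulr_ge0// ltW|lra].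
have p2 : 0 <= a * a * n * (lam * m2) by have a0' := ltW a0; pos.
have p3 : a * (1 - a) * (lam * K4) <= 1 * (lam * K4).
  apply: ler_wpM2r; first by rewrite mulr_ge0.
  have : 0 <= a * a by rewrite mulr_ge0// ltW.
  by lra.
rewrite -subr_ge0.
have -> : lam * K4 / 4 - a * g / 2 * n - (a * (lam * n / 2 * (eta2 - m2)) + a * (1 - a) / 2 * (lam * n * m2 / 2 + lam * K4 / 2) + n * (a * F + C * a ^+ 2)) =
  (a * n * (- g / 2) - a * n * (lam * eta2 / 2 - lam * m2 / 2 + lam * m2 / 4 + F + C * a)) + a * a * n * (lam * m2) / 4 + (1 * (lam * K4) - a * (1 - a) * (lam * K4)) / 4.
  by field.
apply: addr_ge0; first apply: addr_ge0; first by rewrite subr_ge0.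
- by rewrite divr_ge0.
- by rewrite divr_ge0// subr_ge0.
Qed.

Section planted_overlap.
Context d (T : measurableType d) (R : realType) (P : probability T R).
Notation mR := (measurableTypeR R).
Notation gaussn := (iid (@gauss R)).
Variables (f : T -> mR) (K : R).
Hypotheses (mf : measurable_fun setT f) (fK : forall x, `|f x| <= K).
Variables (lam : R).
Hypotheses (lam0 : 0 < lam).

Definition far (e t : R) : R := (e < `|t|)%R%:R.

Lemma far_ge0 e t : 0 <= far e t. Proof. exact: ler0n. Qed.

Lemma far_le1 e t : far e t <= 1. Proof. by rewrite /far lern1 leq_b1. Qed.

Lemma measurable_far e d' (U : measurableType d') (g : U -> mR) :
  measurable_fun setT g -> measurable_fun setT (fun x => far e (g x) : mR).
Proof.
move=> mg; have -> : (fun x => far e (g x) : mR) = \1_[set x | e < `|g x|].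
  by apply/funext => x; rewrite /far indicE; congr (nat_of_bool _)%:R; apply/idP/idP; rewrite inE.
apply: measurable_indic.
have := @measurable_fun_ltr _ _ _ setT (fun=> e) (fun x => `|g x|) (measurable_cst _) (measurable_norm_comp mg).
by move=> /(_ measurableT [set true] I); rewrite setTI.
Qed.

Definition likelihood N := part (iid P N) (fun=> 1) (@spike _ T R f lam N).

(** Divided by [likelihood], this is the posterior probability of an overlap with y beyond e N. *)
Definition far_likelihood N e (y : N.-tuple T) :=
  part (iid P N) (fun x => far (e * N%:R) (overlap f y x)) (@spike _ T R f lam N).

Let msp N := @measurable_spike _ T R f mf lam N.

Lemma itg_far N e (y : N.-tuple T) : itg (iid P N) (fun x => far (e * N%:R) (overlap f y x)).
Proof.
apply: (itg_le (g := fun=> 1)); [|by move=> x; rewrite ger0_norm ?far_ge0 ?far_le1|exact: itg_cst].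
by apply: measurable_far; apply: measurable_overlap; [exact: mf|exact: measurable_cst|exact: measurable_id].
Qed.

Lemma likelihood_gt0 N W : (0 < N)%N -> 0 < @likelihood N W.
Proof. by move=> N0; apply: part1_gt0 => [|x]; [exact: msp|exact: (dot_spike_bound P fK lam0 N0)]. Qed.

Lemma measurable_likelihood N : measurable_fun setT (@likelihood N).
Proof. by apply: measurable_part => //; [exact: itg_cst|exact: msp]. Qed.

Lemma far_likelihood_ge0 N e y W : 0 <= @far_likelihood N e y W.
Proof. by apply: part_ge0 => x; exact: far_ge0. Qed.

Lemma far_likelihood_le N e y W : @far_likelihood N e y W <= @likelihood N W.
Proof.
apply: Rintegral_le.
- by apply: itg_part; [move=> x; exact: far_ge0|exact: itg_far|exact: msp].
- by apply: itg_part => //; [exact: itg_cst|exact: msp].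
- by move=> x; rewrite ler_wpM2r ?wt_ge0 ?far_le1.
Qed.

Lemma measurable_far_likelihood N e d' (U : measurableType d') (g : U -> N.-tuple T)
   (h : U -> #|edge N|.-tuple mR) : measurable_fun setT g -> measurable_fun setT h ->
  measurable_fun setT (fun z => far_likelihood e (g z) (h z)).
Proof.
move=> mg mh; apply: measurable_part_joint; [|by move=> *; exact: far_ge0|exact: msp|exact: mh].
apply: measurable_far; apply: measurable_overlap; [exact: mf| |exact: measurable_snd].
exact: (measurableT_comp mg measurable_fst).
Qed.

(* Linearises the square: s ^+ 2 <= 2 m s - m ^+ 2 + eta ^+ 2 for the grid point m
   nearest to s = S / N, so each term is a planted tilt of fixed overlap. *)
Lemma far_expR_le N e eta (ms : seq R) S D : (0 < N)%N -> `|S| <= N%:R * K ^+ 2 ->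
  D <= lam / (2 * N%:R) * S ^+ 2 ->
  (forall s, e < `|s| <= K ^+ 2 -> exists2 m, m \in ms & `|s - m| <= eta) ->
  far (e * N%:R) S * expR D <=
  \sum_(m <- ms) expR (lam * N%:R / 2 * (eta ^+ 2 - m ^+ 2)) * expR (lam * m * S).
Proof.
move=> N0 SK DS grid; have NR : 0 < N%:R :> R by rewrite ltr0n.
have F0 m : 0 <= expR (lam * N%:R / 2 * (eta ^+ 2 - m ^+ 2)) * expR (lam * m * S) by pos.
rewrite /far; case: ltP => [eS|_]; last by rewrite mul0r; apply: sumr_ge0.
have [|m mms me] := grid (S / N%:R).
  rewrite normrM normfV (ger0_norm (ltW NR)) ltr_pdivlMr// eS/=.
  by rewrite ler_pdivrMr// mulrC.
rewrite mul1r (big_rem m)//=; apply: ler_wpDr; first exact: sumr_ge0.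
rewrite -expRD ler_expR; apply: (le_trans DS).
set s := S / N%:R in me; have -> : S = N%:R * s by rewrite /s mulrCA divff ?mulr1// gt_eqF.
have -> : lam / (2 * N%:R) * (N%:R * s) ^+ 2 = lam * N%:R / 2 * s ^+ 2 by field; rewrite gt_eqF.
have : (s - m) ^+ 2 <= eta ^+ 2.
  by rewrite -[(s - m) ^+ 2]real_normK ?num_real// lerXn2r ?nnegrE// (le_trans _ me).
move=> h; rewrite -subr_ge0.
have -> : lam * N%:R / 2 * (eta ^+ 2 - m ^+ 2) + lam * m * (N%:R * s) - lam * N%:R / 2 * s ^+ 2 =
  lam * N%:R / 2 * (eta ^+ 2 - (s - m) ^+ 2) by field.
by rewrite mulr_ge0 ?subr_ge0//; have l0 := ltW lam0; pos.
Qed.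

(** Planting y multiplies the weight of x by expR (dot (spike y) (spike x)). The grid replaces this
    by finitely many tilts linear in the overlap, and subadditivity of the power a separates
    them. *)
Lemma far_likelihood_planted N e eta (ms : seq R) a (y : N.-tuple T) W : (0 < N)%N -> 0 < a < 1 ->
  (forall s, e < `|s| <= K ^+ 2 -> exists2 m, m \in ms & `|s - m| <= eta) ->
  far_likelihood e y (lin 1 1 (spike f lam y) W) `^ a <=
  \sum_(m <- ms) expR (a * (lam * N%:R / 2 * (eta ^+ 2 - m ^+ 2))) *
    part (iid P N) (fun x => expR (lam * m * overlap f y x)) (spike f lam (N := N)) W `^ a.
Proof.
move=> N0 a01 grid.
pose c m := expR (lam * N%:R / 2 * (eta ^+ 2 - m ^+ 2)).
pose rho m (x : N.-tuple T) : mR := expR (lam * m * overlap f y x).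
have irho m : itg (iid P N) (rho m).
  apply: (itg_le (g := fun=> expR (`|lam * m| * (N%:R * K ^+ 2)))); [| |exact: itg_cst].
    apply: (measurableT_comp (@measurable_expR _)); apply: measurable_funM; first exact: measurable_cst.
    by apply: measurable_overlap; [exact: mf|exact: measurable_cst|exact: measurable_id].
  move=> x; rewrite ger0_norm ?expR_ge0// ler_expR; apply: (le_trans (ler_norm _)); rewrite normrM.
  by apply: ler_wpM2l => //; exact: (overlap_bound fK).
have rho0 m x : 0 <= rho m x by exact: expR_ge0.
have p0 m : 0 <= part (iid P N) (rho m) (spike f lam (N := N)) W by exact: part_ge0.
apply: (@le_trans _ _ ((\sum_(m <- ms) c m * part (iid P N) (rho m) (spike f lam (N := N)) W) `^ a)).
  apply: ge0_ler_powR; rewrite ?nnegrE ?far_likelihood_ge0 ?sumr_ge0//.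
  - by case/andP: a01 => /ltW.
  - by move=> m _; rewrite mulr_ge0 ?expR_ge0.
  have ip m : itg (iid P N) (fun x => c m * (rho m x * wt (spike f lam x) W)).
    by apply: itgZ; apply: itg_part; [exact: rho0|exact: irho|exact: msp].
  apply: (@le_trans _ _ (\int[iid P N]_x \sum_(m <- ms) (c m * (rho m x * wt (spike f lam x) W)))); last first.
    by rewrite Rintegral_sum//; apply: ler_sum => m _; rewrite RintegralZl//; apply: itg_part; [exact: rho0|exact: irho|exact: msp].
  apply: Rintegral_le; [|exact: itg_sum|].
    by apply: itg_part; [move=> x; exact: far_ge0|exact: itg_far|exact: msp].
  move=> x; have -> : wt (spike f lam x) (lin 1 1 (spike f lam y) W) =
      expR (dot (spike f lam y) (spike f lam x)) * wt (spike f lam x) W.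
    by rewrite /wt -expRD dot_linr (dotC (spike f lam y)); congr expR; ring.
  rewrite mulrA.
  under eq_bigr do rewrite mulrA.
  rewrite -mulr_suml; apply: ler_wpM2r; first exact: wt_ge0.
  apply: far_expR_le => //; first exact: (overlap_bound fK).
  exact: (dot_spike_le P fK).
apply: (le_trans (powR_sum_le _ a01 _)) => [m|]; first by rewrite mulr_ge0 ?expR_ge0.
apply: ler_sum => m _; rewrite powRM ?expR_ge0// /c -/(rho m) [in leLHS]/powR gt_eqF ?expR_gt0// expRK.
by rewrite /rho.
Qed.


(** The left side is the planted mean of the posterior probability that a replica has overlap beyond
    e N with the planted spike. *)
Lemma planted_overlap lam' e : lam < lam' -> (forall s, 0 <= s -> free_energy P f s <= s ^+ 4 / (4 * lam')) -> 0 < e ->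
  exists2 C, 0 <= C & exists2 c, 0 < c & forall N, (0 < N)%N ->
  (\int[iid P N]_y \int[gaussn #|edge N|]_W
     (far_likelihood e y (lin 1 1 (spike f lam y) W) * likelihood (lin 1 1 (spike f lam y) W) `^ (-1))%:E
   <= (C * expR (- (c * N%:R)))%:E)%E.
Proof.
move=> ll' FE e0.
have half1 : (1 / 2 : R) < 1 by lra.
have l'0 : 0 < lam' by exact: lt_trans ll'.
(* The gain lam / 4 * (1 - lam / lam') * m ^+ 2 at |m| = e / 2, the smallest modulus on the grid. *)
pose g := lam / 16 * (1 - lam / lam') * e ^+ 2.
have r0 : 0 < 1 - lam / lam' by rewrite subr_gt0 ltr_pdivrMr// mul1r.
have g0 : 0 < g by rewrite /g !mulr_gt0// ?exprn_gt0// ?invr_gt0//; lra.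
(* eta <= 1 gives eta ^+ 2 <= eta <= g / (2 lam), so that the grid error lam * eta ^+ 2 / 2 is at
   most g / 4. *)
pose eta := Num.min (e / 2) (Num.min 1 (g / (2 * lam))).
have eta0 : 0 < eta by rewrite !lt_min !divr_gt0//= ?mulr_gt0// ltr01.
have eta1 : eta <= e / 2 by rewrite ge_min lexx.
have eta2 : eta <= 1 by rewrite !ge_min lexx orbT.
have eta3 : eta <= g / (2 * lam) by rewrite !ge_min lexx !orbT.
have [ms [msb grid]] := finite_grid (K ^+ 2) eta0 eta1.
have [C0 C00 HC] := tilt_powR_le P mf fK (Num.sqrt (lam * K ^+ 2)).
(* Keeps the second order error C0 * a of the fractional moment below g / 4; C0 + 1 avoids a
   division by zero. *)
pose a := Num.min (1 / 2) (g / (4 * (C0 + 1))).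
have C1 : 0 < C0 + 1 by exact: ltr_pwDr.
have a0 : 0 < a by rewrite lt_min !divr_gt0//= mulr_gt0.
have ah : a <= 1 / 2 by rewrite ge_min lexx.
have a2 : a <= g / (4 * (C0 + 1)) by rewrite ge_min lexx orbT.
have a01 : 0 < a < 1 by rewrite a0; exact: le_lt_trans ah half1.
have Ca : C0 * a <= g / 4.
  apply: (@le_trans _ _ ((C0 + 1) * a)); first by rewrite ler_wpM2r ?(ltW a0)// lerDl.
  apply: (@le_trans _ _ ((C0 + 1) * (g / (4 * (C0 + 1))))); first by rewrite ler_wpM2l// ltW.
  by rewrite le_eqVlt; apply/orP; left; apply/eqP; field; rewrite gt_eqF.
have le : lam * eta ^+ 2 / 2 <= g / 4.
  have : lam * eta ^+ 2 <= lam * (g / (2 * lam)).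
    apply: ler_wpM2l; first exact: ltW.
    apply: le_trans eta3; rewrite expr2 -[leRHS]mulr1; apply: ler_wpM2l => //; exact: ltW.
  have -> : lam * (g / (2 * lam)) = g / 2 by field; rewrite gt_eqF.
  by lra.
pose B := 2 * expR (lam * K ^+ 4 / 4).
have B0 : 0 <= B by rewrite /B; pos.
exists (1 + (size ms)%:R * B); first by rewrite addr_ge0// mulr_ge0.
exists (a * g / 4); first by rewrite divr_gt0// mulr_gt0.
move=> N N0; have NR : 0 < N%:R :> R by rewrite ltr0n.
(* In [ratio_le] the factor expR (a b) spends half of the gain a g N / 2, and the first term expR (-
   b) is at most expR (- a b), the rate announced. *)
pose b := g / 4 * N%:R.
pose sp := @spike _ T R f lam N.
have mL := @measurable_likelihood N.
have Lp W : 0 < likelihood (N := N) W by exact: likelihood_gt0.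
pose A (W : #|edge N|.-tuple mR) := expR (- b) * likelihood W `^ (-1).
have A0 W : 0 <= A W by rewrite /A; pos.
have mLi : measurable_fun setT (fun W => likelihood (N := N) W `^ (-1)).
  exact: (measurableT_comp (measurable_powR _)).
have mA0 : measurable_fun setT A by apply: measurable_funM => //; exact: measurable_cst.
have mshift : measurable_fun setT (fun z : N.-tuple T * #|edge N|.-tuple mR => lin 1 1 (spike f lam z.1) z.2).
  have ms0 := measurable_spike mf lam (N := N).
  by mble.
have mA : measurable_fun setT (fun z : N.-tuple T * #|edge N|.-tuple mR => A (lin 1 1 (spike f lam z.1) z.2)).
  exact: (measurableT_comp mA0 mshift).
have mZ : measurable_fun setT (fun z : N.-tuple T * #|edge N|.-tuple mR =>
    far_likelihood e z.1 (lin 1 1 (spike f lam z.1) z.2) * likelihood (lin 1 1 (spike f lam z.1) z.2) `^ (-1)).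
  apply: measurable_funM; last exact: (measurableT_comp mLi mshift).
  exact: (measurable_far_likelihood _ measurable_fst mshift).
pose ov m y x := expR (lam * m * overlap f (N := N) y x).
pose D m y W := expR (a * b) * (expR (a * (lam * N%:R / 2 * (eta ^+ 2 - m ^+ 2))) *
    part (iid P N) (ov m y) sp W `^ a).
have mp m : measurable_fun setT (fun z : N.-tuple T * #|edge N|.-tuple mR => part (iid P N) (ov m z.1) sp z.2 `^ a).
  apply: (measurableT_comp (measurable_powR _)).
  apply: (measurable_part_joint (iid P N) (rho := fun z => ov m z.1)); [|by move=> *; exact: expR_ge0|exact: measurable_spike|exact: measurable_snd].
  apply: (measurableT_comp (@measurable_expR _)); apply: measurable_funM; first exact: measurable_cst.
  by apply: measurable_overlap; [exact: mf|exact: (measurableT_comp measurable_fst measurable_fst)|exact: measurable_snd].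
have mD m : measurable_fun setT (fun z : N.-tuple T * #|edge N|.-tuple mR => D m z.1 z.2).
  apply: measurable_funM; first exact: measurable_cst.
  by apply: measurable_funM; [exact: measurable_cst|exact: mp].
have D0 m y W : 0 <= D m y W by rewrite /D; pos.
have cell m : m \in ms -> (\int[(iid P N \x gaussn #|edge N|)%E]_z (D m z.1 z.2)%:E <= (B * expR (- (a * g / 4 * N%:R)))%:E)%E.
  move=> /msb/andP[m1 m2].
  rewrite /D; under eq_integral do rewrite mulrA EFinM.
  rewrite ge0_integralZl//; first last.
  - by move=> z _; rewrite lee_fin powR_ge0.
  - by apply/measurable_EFinP; exact: mp.
  rewrite -(integral2E _ _ (F := fun y W => part (iid P N) (ov m y) sp W `^ a)); [|exact: mp|by move=> *; exact: powR_ge0].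
  have cb := cell_bound mf fK lam0 N0 HC a01 m2.
  apply: le_trans (lee_wpmul2l _ cb) _; first by rewrite lee_fin; pos.
  rewrite -EFinM lee_fin /B -!expRD.
  have E x y z : x * (2 * y * z) = 2 * (x * y * z) :> R by ring.
  rewrite E -[leRHS]mulrA -!expRD ler_pM2l// ler_expR.
  have := @planted_exponent R a lam lam' N%:R (m ^+ 2) (eta ^+ 2) g C0 (K ^+ 4) (free_energy P f (Num.sqrt (lam * `|m|))).
  rewrite a0 (ltW NR) (ltW lam0) sqr_ge0 gt_eqF//= => H.
  have a1 : a <= 1 by exact: le_trans ah (ltW half1).
  have Kge : 0 <= K ^+ 4 by exact: exprn_even_ge0.
  have FEm : free_energy P f (Num.sqrt (lam * `|m|)) <= lam ^+ 2 * m ^+ 2 / (4 * lam').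
    apply: (le_trans (FE _ (sqrtr_ge0 _))).
    rewrite (_ : 4%N = 2 * 2)%N// exprM sqr_sqrtr ?mulr_ge0 ?(ltW lam0)// exprMn real_normK ?num_real//.
  have gm : g <= lam / 4 * (1 - lam / lam') * m ^+ 2.
    have em : (e / 2) ^+ 2 <= m ^+ 2 by rewrite -[m ^+ 2]real_normK ?num_real// lerXn2r// nnegrE// ltW// divr_gt0.
    have -> : g = lam / 4 * (1 - lam / lam') * (e / 2) ^+ 2 by rewrite /g; field; rewrite gt_eqF.
    by apply: ler_wpM2l => //; rewrite mulr_ge0 ?divr_ge0 ?(ltW lam0)// ltW.
  have {}H := H a1 isT isT isT Kge le Ca FEm gm isT.
  set X := a * (lam * _ / 2 * _) in H *; set Y := a * (1 - a) / 2 * _ in H *; set Z := N%:R * _ in H *.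
  have -> : a * b + X + Y + Z = X + Y + Z + a * b by ring.
  have -> : lam * K ^+ 4 / 4 + - (a * g / 4 * N%:R) = lam * K ^+ 4 / 4 - a * g / 2 * N%:R + a * b by rewrite /b; field.
  by rewrite lerD2r.
rewrite (integral2E _ _ (F := fun y W => far_likelihood e y (lin 1 1 (spike f lam y) W) * likelihood (lin 1 1 (spike f lam y) W) `^ (-1))); first last.
- by move=> y W; rewrite mulr_ge0 ?powR_ge0 ?far_likelihood_ge0.
- exact: mZ.
apply: (@le_trans _ _ (\int[(iid P N \x gaussn #|edge N|)%E]_z ((A (lin 1 1 (spike f lam z.1) z.2))%:E + (\sum_(m <- ms) D m z.1 z.2)%:E))%E).
  apply: ge0_le_integral; [exact: measurableT| | | |].
  - by move=> z _; rewrite lee_fin mulr_ge0 ?powR_ge0 ?far_likelihood_ge0.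
  - by apply/measurable_EFinP; exact: mZ.
  - by apply: emeasurable_funD; apply/measurable_EFinP; [exact: mA|exact: measurable_sum].
  - move=> [y W] _ /=; rewrite -EFinD lee_fin.
    apply: (le_trans (ratio_le b (far_likelihood_ge0 _ _ _) (Lp _) (far_likelihood_le _ _ _) a01)).
    rewrite lerD2l /D -mulr_sumr ler_wpM2l ?expR_ge0//.
    exact: far_likelihood_planted.
rewrite ge0_integralD//; first last.
- by apply/measurable_EFinP; exact: measurable_sum.
- by move=> z _; rewrite lee_fin sumr_ge0.
- by apply/measurable_EFinP; exact: mA.
- by move=> z _; rewrite lee_fin A0.
rewrite mulrDl mul1r EFinD; apply: leeD; last first.
  have := @integral_sum_le _ _ R (iid P N \x gaussn #|edge N|)%E R ms (fun m z => D m z.1 z.2) _ mD (fun m z => D0 m z.1 z.2) cell.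
  by rewrite mulrA.
rewrite -(integral2E _ _ (F := fun y W => A (lin 1 1 (spike f lam y) W))); [|exact: mA|by move=> *; exact: A0].
rewrite (integral_planted_part (iid P N) (measurable_spike mf lam (N := N)) mA0 A0).
rewrite (eq_integral (fun=> (expR (- b))%:E)); last first.
  move=> W _; congr EFin; rewrite /A mulrCA (powR_inv1 (ltW (Lp W))) divff ?mulr1//.
  by rewrite gt_eqF// Lp.
rewrite integral_prob_cst lee_fin ler_expR lerN2.
have -> : a * g / 4 * N%:R = a * b by rewrite /b; ring.
apply: ler_piMl; first by apply: mulr_ge0 => //; rewrite divr_ge0// ltW.
exact: le_trans ah (ltW half1).
Qed.

End planted_overlap.

(** * The truncated second moment *)

Section near.
Variable R : realType.
Notation mR := (measurableTypeR R).

Definition near_ind (e t : R) : R := 1 - far e t.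

Lemma near_ind_ge0 e t : 0 <= near_ind e t.
Proof. by rewrite /near_ind subr_ge0 far_le1. Qed.

Lemma near_ind_le1 e t : near_ind e t <= 1.
Proof. by rewrite /near_ind gerBl far_ge0. Qed.

Lemma near_ind_eq1 e t : `|t| <= e -> near_ind e t = 1.
Proof. by rewrite /near_ind /far ltNge => ->; rewrite subr0. Qed.

Lemma near_ind_eq0 e t : e < `|t| -> near_ind e t = 0.
Proof. by rewrite /near_ind /far => ->; rewrite subrr. Qed.

Lemma measurable_near_ind e d (U : measurableType d) (g : U -> mR) :
  measurable_fun setT g -> measurable_fun setT (fun x => near_ind e (g x) : mR).
Proof. by move=> mg; apply: measurable_funB; [exact: measurable_cst|exact: measurable_far]. Qed.

(* Hubbard-Stratonovich: exp (s^2 / 2) is the mean of exp (s g) for a standard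
   Gaussian g; when |s| <= tau half of that mean comes from |g| <= 2 tau. *)
Lemma expR_sqr_le_gauss tau s : `|s| <= tau -> 2 * (\int[@gauss R]_z z ^+ 2) <= tau ^+ 2 -> 0 < tau ->
  ((expR (s ^+ 2 / 2))%:E <= 2%:E * \int[@gauss R]_z (near_ind (2 * tau) z * expR (s * z))%:E)%E.
Proof.
move=> st Vt tau0.
have mn : measurable_fun setT (near_ind (2 * tau) : mR -> mR) by apply: measurable_near_ind; exact: measurable_id.
have := @gauss_shift R s (fun z => (near_ind (2 * tau) z)%:E).
move=> /(_ _ _)-H.
have {}H := H (iffRL (measurable_EFinP _ _) mn) (fun z => near_ind_ge0 _ _ : (0 <= (near_ind _ _)%:E)%E).
have -> : (\int[@gauss R]_z (near_ind (2 * tau) z * expR (s * z))%:E =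
   (expR (s ^+ 2 / 2))%:E * \int[@gauss R]_z (near_ind (2 * tau) (s + z))%:E)%E.
  rewrite H -ge0_integralZl//.
  - by apply: eq_integral => z _; rewrite -!EFinM mulrA -expRD mulrC; congr (expR _ * _)%:E; ring.
  - apply/measurable_EFinP; apply: measurable_funM => //; mble.
  - by move=> z _; rewrite -EFinM lee_fin mulr_ge0 ?near_ind_ge0 ?expR_ge0.
rewrite muleCA -[leLHS]mule1; apply: lee_wpmul2l; first by rewrite lee_fin expR_ge0.
have ms : measurable_fun setT (fun z : mR => near_ind (2 * tau) (s + z) : mR) by apply: measurable_near_ind; mble.
have ig : itg (@gauss R) (fun z => near_ind (2 * tau) (s + z)).
  apply: (itg_le (g := fun=> 1)) => //; last exact: itg_cst.
  by move=> z; rewrite ger0_norm ?near_ind_ge0 ?near_ind_le1.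
rewrite -ge0_RintegralE//; last by move=> z; exact: near_ind_ge0.
rewrite -EFinM lee_fin.
have t2 : 0 < tau ^+ 2 by exact: exprn_gt0.
have i2 := @itg_gauss_sqr R.
(* Chebyshev: |z| <= tau implies |s + z| <= 2 tau, and the complement has probability at most V /
   tau ^+ 2 <= 1/2, V being the second moment. *)
have h : 1 + - (tau ^+ 2)^-1 * \int[@gauss R]_z z ^+ 2 <= \int[@gauss R]_z near_ind (2 * tau) (s + z).
  have := Rintegral_lin3 1 (- (tau ^+ 2)^-1) 0 0 i2 i2 i2; rewrite !mul0r !addr0 => <-.
  apply: Rintegral_le => //; first exact: itg_lin3.
  move=> z; rewrite !mul0r !addr0.
  have [zt|zt] := leP `|z| tau.
    rewrite near_ind_eq1; last by apply: (le_trans (ler_normD _ _)); lra.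
    by rewrite mulNr gerBl mulr_ge0// ?sqr_ge0// invr_ge0 ltW.
  apply: le_trans (near_ind_ge0 _ _); rewrite mulNr subr_le0 mulrC ler_pdivlMr// mul1r.
  by rewrite -[leRHS]real_normK ?num_real// lerXn2r ?nnegrE//; exact: ltW.
have : (tau ^+ 2)^-1 * (2 * \int[@gauss R]_z z ^+ 2) <= 1 by rewrite mulrC ler_pdivrMr// mul1r.
lra.
Qed.

End near.

(** * The overlap of two independent spikes *)

Section replica.
Context d (T : measurableType d) (R : realType) (P : probability T R).
Notation mR := (measurableTypeR R).
Notation gaussn := (iid (@gauss R)).
Variables (f : T -> mR) (K : R).
Hypotheses (mf : measurable_fun setT f) (fK : forall x, `|f x| <= K).
Hypotheses (f_mean : \int[P]_x f x = 0) (f_var : \int[P]_x (f x) ^+ 2 = 1).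

(** Taylor to second order: the zero mean kills the linear term, the unit variance makes the
    quadratic one t ^+ 2 / 2, and the slack k absorbs the cubic error for small t. *)
Lemma replica_mgf_le k : 0 < k -> exists2 t0, 0 < t0 & forall t, `|t| <= t0 ->
  (\int[P]_y \int[P]_x (expR (t * (f y * f x)))%:E <= (expR ((1 + k) * t ^+ 2 / 2))%:E)%E.
Proof.
move=> k0.
have K0 := probability_bound_ge0 P fK.
pose B := (K ^+ 2) ^+ 3 * expR (K ^+ 2).
have B0 : 0 <= B by rewrite /B; pos.
pose t0 := Num.min 1 (k / (2 * (B + 1))).
have t00 : 0 < t0 by rewrite lt_min ltr01 divr_gt0// mulr_gt0// ltr_pwDr.
exists t0 => // t tt0.
have t1 : `|t| <= 1 by apply: (le_trans tt0); rewrite ge_min lexx.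
have t2 : `|t| <= k / (2 * (B + 1)) by apply: (le_trans tt0); rewrite ge_min lexx orbT.
pose c := `|t| ^+ 3 * B.
have c0 : 0 <= c by rewrite /c; pos.
have ck : c <= k * t ^+ 2 / 2.
  have : `|t| * B <= k / 2.
    apply: (@le_trans _ _ (k / (2 * (B + 1)) * (B + 1))).
      by apply: ler_pM => //; rewrite lerDl.
    by rewrite le_eqVlt; apply/orP; left; apply/eqP; field; rewrite gt_eqF// ltr_pwDr.
  rewrite /c exprSr real_normK ?num_real// -mulrA => h.
  have : t ^+ 2 * (`|t| * B) <= t ^+ 2 * (k / 2) by apply: ler_wpM2l => //; exact: sqr_ge0.
  by lra.
have i1 : itg P f by apply: (itg_le (g := fun=> K)) => //; exact: itg_cst.
have i2 : itg P (fun x => f x ^+ 2).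
  apply: (itg_le (g := fun=> K ^+ 2)); [by mble| |exact: itg_cst].
  by move=> x; rewrite ger0_norm ?sqr_ge0// -real_normK ?num_real// lerXn2r ?nnegrE.
have pt y x : expR (t * (f y * f x)) <= (1 + c) + (t * f y) * f x + (t ^+ 2 / 2 * f y ^+ 2) * f x ^+ 2 + 0 * f x.
  set z := f y * f x.
  have zK : `|z| <= K ^+ 2 by rewrite /z normrM expr2 ler_pM.
  have := expR_taylor2 (t * z) => /ler_normlP[_ h].
  have : `|t * z| ^+ 3 * expR `|t * z| <= c.
    rewrite normrM exprMn /c /B [leRHS]mulrA; apply: ler_pM; [pos|exact: expR_ge0| |].
      by apply: ler_wpM2l; [pos|rewrite lerXn2r ?nnegrE ?sqr_ge0].
    by rewrite ler_expR -[leRHS]mul1r; apply: ler_pM.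
  move: h; rewrite (_ : t * f y * f x = t * z); last by rewrite /z; ring.
  rewrite (_ : t ^+ 2 / 2 * f y ^+ 2 * f x ^+ 2 = (t * z) ^+ 2 / 2); last by rewrite /z; ring.
  by move=> *; lra.
have inner y : (\int[P]_x (expR (t * (f y * f x)))%:E <= ((1 + c) + t ^+ 2 / 2 * f y ^+ 2 + 0 * f y + 0 * f y)%:E)%E.
  have ie : itg P (fun x => expR (t * (f y * f x))).
    apply: (itg_le (g := fun=> expR (`|t| * K ^+ 2))); [by mble| |exact: itg_cst].
    move=> x; rewrite ger0_norm ?expR_ge0// ler_expR; apply: (le_trans (ler_norm _)).
    by rewrite normrM ler_wpM2l// normrM expr2 ler_pM.
  rewrite -ge0_RintegralE//.
  have := Rintegral_le ie (itg_lin3 (1 + c) (t * f y) (t ^+ 2 / 2 * f y ^+ 2) 0 i1 i2 i1) (pt y).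
  by rewrite Rintegral_lin3// f_mean f_var lee_fin; lra.
have j := itg_lin3 (1 + c) (t ^+ 2 / 2) 0 0 i2 i1 i1.
apply: (@le_trans _ _ (\int[P]_y ((1 + c) + t ^+ 2 / 2 * f y ^+ 2 + 0 * f y + 0 * f y)%:E)%E).
  apply: ge0_le_integral; [exact: measurableT| | | |].
  - by move=> y _; apply: integral_ge0 => x _; rewrite lee_fin expR_ge0.
  - by apply: (measurable_fun_fubini_tonelli_F (fun z : T * T => (expR (t * (f z.1 * f z.2)))%:E)) => [|z]; [mble|rewrite lee_fin expR_ge0].
  - exact/measurable_EFinP/(itg_measurable j).
  - by move=> y _; exact: inner.
rewrite -ge0_RintegralE//; last first.
  by move=> y; rewrite !mul0r !addr0; pos.
rewrite Rintegral_lin3// f_mean f_var lee_fin.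
apply: le_trans (expR_ge1Dx _); lra.
Qed.

Lemma overlap_mgf_le k : 0 < k -> exists2 t0, 0 < t0 & forall N t, `|t| <= t0 ->
  (\int[iid P N]_y \int[iid P N]_x (expR (t * overlap f y x))%:E <= (expR (N%:R * ((1 + k) * t ^+ 2 / 2)))%:E)%E.
Proof.
move=> k0; have [t0 t00 H] := replica_mgf_le k0; exists t0 => // N t tt.
have mh : measurable_fun setT (fun w : T * T => expR (t * (f w.1 * f w.2))) by mble.
rewrite expRM_natl.
apply: le_trans (integral_iid_channel N mh (fun _ _ => expR_ge0 _) _ (H t tt)).
  rewrite le_eqVlt; apply/orP; left; apply/eqP.
  apply: eq_integral => y _; apply: eq_integral => x _; congr EFin.
  by rewrite -expR_sum /overlap mulr_sumr.
move=> y; have ie : itg P (fun x => expR (t * (f y * f x))).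
  apply: (itg_le (g := fun=> expR (`|t| * K ^+ 2))); [by mble| |exact: itg_cst].
  move=> x; rewrite ger0_norm ?expR_ge0// ler_expR; apply: (le_trans (ler_norm _)).
  by rewrite normrM ler_wpM2l// normrM expr2 ler_pM.
by rewrite -ge0_RintegralE ?ltry// => x; exact: expR_ge0.
Qed.

(** [expR_sqr_le_gauss] replaces the square of the overlap S by a Gaussian mixture of expR (b z S),
    to which [overlap_mgf_le] applies. There remains the mean of expR ((1 + k) lam1 z ^+ 2 / 2),
    finite since (1 + k) lam1 < 1. *)
Lemma near_moment lam1 : 0 < lam1 < 1 -> exists2 e, 0 < e & exists C N0, forall N, (N0 <= N)%N ->
  (\int[iid P N]_y \int[iid P N]_x
     (near_ind (e * N%:R) (overlap f y x) * expR (lam1 / (2 * N%:R) * overlap f y x ^+ 2))%:E <= C%:E)%E.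
Proof.
move=> /andP[l0 l1].
pose k := (1 - lam1) / 2.
have k0 : 0 < k by rewrite /k; lra.
have l2 : (1 + k) * lam1 < 1 by rewrite /k; nra.
have [t0 t00 H] := overlap_mgf_le k0.
(* For |z| <= 2 tau the exponent satisfies |b z| <= 2 b tau = 2 e lam1 = t0 lam1 <= t0, within reach
   of [overlap_mgf_le]. *)
pose e := t0 / 2; have e0 : 0 < e by rewrite divr_gt0.
exists e => //.
set V := \int[@gauss R]_z z ^+ 2.
exists (2 * (Num.sqrt (1 - (1 + k) * lam1))^-1).
have V1 : 1 <= V by exact: gauss_sqr_ge1.
(* Equivalent to 2 V <= tau ^+ 2, the condition of [expR_sqr_le_gauss], since tau ^+ 2 = e ^+ 2 lam1
   N. *)
exists (Num.truncn (2 * V / (e ^+ 2 * lam1))).+1 => N NN.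
have NR : 2 * V / (e ^+ 2 * lam1) <= N%:R.
  by apply: ltW; apply: (lt_le_trans (truncnS_gt _)); rewrite ler_nat.
have N0 : 0 < N%:R :> R by rewrite ltr0n; exact: leq_trans NN.
have el : 0 < e ^+ 2 * lam1 by rewrite mulr_gt0// exprn_gt0.
pose tau := e * Num.sqrt (lam1 * N%:R).
pose b := Num.sqrt (lam1 / N%:R).
have b2 : b ^+ 2 = lam1 / N%:R by rewrite sqr_sqrtr// divr_ge0 ?ltW.
have tau2 : tau ^+ 2 = e ^+ 2 * lam1 * N%:R by rewrite exprMn sqr_sqrtr ?mulr_ge0 ?ltW//; ring.
have tau0 : 0 < tau by rewrite mulr_gt0// sqrtr_gt0 mulr_gt0.
have b0 : 0 < b by rewrite sqrtr_gt0 divr_gt0.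
have Vt : 2 * V <= tau ^+ 2 by rewrite tau2 [leRHS]mulrC -ler_pdivrMr.
have btau : b * tau = e * lam1.
  rewrite mulrCA -sqrtrM ?divr_ge0 ?ltW//.
  have -> : lam1 / N%:R * (lam1 * N%:R) = lam1 ^+ 2 by field; rewrite gt_eqF.
  by rewrite sqrtr_sqr gtr0_norm.
have bN : b * N%:R * e = tau.
  have -> : b * N%:R * e = e * (b * N%:R) by ring.
  congr (_ * _); rewrite -{1}(ger0_norm (ltW N0)) -sqrtr_sqr -sqrtrM ?divr_ge0 ?ltW//.
  by congr (Num.sqrt _); field; rewrite gt_eqF.
pose PP : probability _ R := (iid P N \x iid P N)%E.
have mov : measurable_fun setT (fun w : N.-tuple T * N.-tuple T => overlap f w.1 w.2 : mR).
  by apply: measurable_overlap; [exact: mf|exact: measurable_fst|exact: measurable_snd].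
have pt w : ((near_ind (e * N%:R) (overlap f w.1 w.2) * expR (lam1 / (2 * N%:R) * overlap f w.1 w.2 ^+ 2))%:E <=
   2%:E * \int[@gauss R]_z (near_ind (2 * tau) z * expR (b * z * overlap f w.1 w.2))%:E)%E.
  set S := overlap f _ _.
  have p : (0 <= 2%:E * \int[@gauss R]_z (near_ind (2 * tau) z * expR (b * z * S))%:E)%E.
    apply: mule_ge0 => //; apply: integral_ge0 => z _; by rewrite lee_fin mulr_ge0 ?near_ind_ge0 ?expR_ge0.
  have [Se|Se] := leP `|S| (e * N%:R); last by rewrite near_ind_eq0// mul0r.
  rewrite near_ind_eq1// mul1r.
  have -> : lam1 / (2 * N%:R) * S ^+ 2 = (b * S) ^+ 2 / 2 by rewrite exprMn b2; field; rewrite gt_eqF.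
  have -> : (\int[@gauss R]_z (near_ind (2 * tau) z * expR (b * z * S))%:E = \int[@gauss R]_z (near_ind (2 * tau) z * expR (b * S * z))%:E)%E.
    by apply: eq_integral => z _; rewrite mulrAC.
  apply: expR_sqr_le_gauss => //.
  rewrite normrM (gtr0_norm b0) -bN.
  by have := ler_wpM2l (ltW b0) Se; rewrite (_ : b * (e * N%:R) = b * N%:R * e)//; ring.
have mF : measurable_fun setT (fun q : (N.-tuple T * N.-tuple T) * mR => near_ind (2 * tau) q.2 * expR (b * q.2 * overlap f q.1.1 q.1.2)).
  apply: measurable_funM; first by apply: measurable_near_ind; exact: measurable_snd.
  apply: (measurableT_comp (@measurable_expR _)); apply: measurable_funM; first by mble.
  exact: (measurableT_comp mov measurable_fst).
have F0 q z : 0 <= near_ind (2 * tau) z * expR (b * z * overlap f (N := N) q.1 q.2).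
  by rewrite mulr_ge0 ?near_ind_ge0 ?expR_ge0.
rewrite (integral2E (iid P N) (iid P N) (F := fun y x => near_ind (e * N%:R) (overlap f y x) * expR (lam1 / (2 * N%:R) * overlap f y x ^+ 2))); first last.
- by move=> y x; rewrite mulr_ge0 ?near_ind_ge0 ?expR_ge0.
- by apply: measurable_funM; [exact: measurable_near_ind|mble].
apply: (@le_trans _ _ (\int[PP]_w (2%:E * \int[@gauss R]_z (near_ind (2 * tau) z * expR (b * z * overlap f w.1 w.2))%:E))%E).
  apply: ge0_le_integral; [exact: measurableT| | | |].
  - by move=> w _; rewrite lee_fin mulr_ge0 ?near_ind_ge0 ?expR_ge0.
  - by apply/measurable_EFinP/measurable_funM; [exact: measurable_near_ind|mble].
  - apply: emeasurable_funM; first exact: measurable_cst.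
    by apply: (measurable_fun_fubini_tonelli_F _ (iffRL (measurable_EFinP _ _) mF)) => q; rewrite lee_fin F0.
  - by move=> w _; exact: pt.
rewrite ge0_integralZl//; first last.
- by move=> w _; apply: integral_ge0 => z _; rewrite lee_fin F0.
- by apply: (measurable_fun_fubini_tonelli_F _ (iffRL (measurable_EFinP _ _) mF)) => q; rewrite lee_fin F0.
rewrite EFinM; apply: lee_wpmul2l => //.
have -> : (\int[PP]_w \int[@gauss R]_z (near_ind (2 * tau) z * expR (b * z * overlap f w.1 w.2))%:E =
    \int[@gauss R]_z \int[PP]_w (near_ind (2 * tau) z * expR (b * z * overlap f w.1 w.2))%:E)%E.
  exact: (integral2_swap PP (@gauss R) mF).
rewrite -gauss_sqr_mgf//.
apply: ge0_le_integral; [exact: measurableT| | | |].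
- by move=> z _; apply: integral_ge0 => q _; rewrite lee_fin F0.
- by apply: (measurable_fun_fubini_tonelli_G _ (iffRL (measurable_EFinP _ _) mF)) => q; rewrite lee_fin F0.
- by mble.
- move=> z _ /=.
  have [zt|zt] := leP `|z| (2 * tau); last first.
    by under eq_integral do rewrite near_ind_eq0// mul0r; rewrite integral0 lee_fin expR_ge0.
  under eq_integral do rewrite near_ind_eq1// mul1r.
  rewrite -(integral2E (iid P N) (iid P N) (F := fun y x => expR (b * z * overlap f y x))); [|by mble|by move=> *; exact: expR_ge0].
  apply: le_trans (H _ _ _) _.
    rewrite normrM (gtr0_norm b0); apply: (le_trans (ler_wpM2l (ltW b0) zt)).
    rewrite mulrCA btau /e.
    have -> : 2 * (t0 / 2 * lam1) = t0 * lam1 by field.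
    by rewrite ler_piMr// ltW.
  rewrite lee_fin ler_expR exprMn b2 le_eqVlt; apply/orP; left; apply/eqP.
  by field; rewrite gt_eqF.
Qed.

End replica.

Lemma truncated_moment_arith (R : realType) (n k q F Nn M Q : R) : 2 <= n -> 0 <= k -> n * F <= q ->
  Q <= (1 + n * k) * F -> q = Nn + F -> Nn <= M -> 0 <= F -> M + Q <= (3 + 2 * k) * M.
Proof.
move=> n2 k0 nF QF qE NM F0.
have h1 : 2 * F <= n * F by rewrite ler_wpM2r.
have qM : q <= 2 * M by lra.
have h2 : k * (n * F) <= k * (2 * M) by rewrite ler_wpM2l// (le_trans nF).
have e1 : (1 + n * k) * F = F + k * (n * F) by ring.
have e2 : (3 + 2 * k) * M = 3 * M + k * (2 * M) by ring.
by rewrite e1 in QF; rewrite e2; move: QF h2; set x := k * _; set y := k * _; lra.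
Qed.

(** * Two replicas drawn from the posterior *)

Section replica_pair.
Context d (T : measurableType d) (R : realType) (P : probability T R).
Notation mR := (measurableTypeR R).
Notation gaussn := (iid (@gauss R)).
Variables (f : T -> mR) (K : R).
Hypotheses (mf : measurable_fun setT f) (fK : forall x, `|f x| <= K).
Variables (lam : R) (N : nat).
Hypotheses (lam0 : 0 < lam) (N0 : (0 < N)%N).

Local Notation u := (@spike _ T R f lam N).
Local Notation L := (@likelihood _ T R P f lam N).

Let mu_u : measurable_fun setT u. Proof. exact: measurable_spike. Qed.
Let NR : 0 < N%:R :> R. Proof. by rewrite ltr0n. Qed.

(* The unnormalised mean of g (overlap) under two independent replicas drawn
   from the posterior given W. *)
Definition pair_moment (g : R -> R) (W : #|edge N|.-tuple mR) : R :=
  \int[iid P N]_y (wt (u y) W * part (iid P N) (fun x => g (overlap f y x)) u W).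

(** Boundedness is asked only on the range of the overlap, so that s ^+ 2 / N qualifies. *)
Definition admissible (g : R -> R) :=
  [/\ measurable_fun setT (g : mR -> mR), (forall s, 0 <= g s) &
      exists B, forall s, `|s| <= N%:R * K ^+ 2 -> g s <= B].

Section one.
Variable g : R -> R.
Hypothesis adg : admissible g.

Lemma measurable_admissible d' (U : measurableType d') (a b : U -> N.-tuple T) :
  measurable_fun setT a -> measurable_fun setT b ->
  measurable_fun setT (fun z => g (overlap f (a z) (b z)) : mR).
Proof.
by case: adg => mg _ _ ma mb; apply: (measurableT_comp mg); exact: measurable_overlap.
Qed.

Lemma itg_admissible y : itg (iid P N) (fun x => g (overlap f y x)).
Proof.
case: adg => mg g0 [B gB].
apply: (itg_le (g := fun=> B)); [|by move=> x; rewrite ger0_norm// gB// overlap_bound|exact: itg_cst].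
by apply: measurable_admissible; [exact: measurable_cst|exact: measurable_id].
Qed.

Let g0 y x : 0 <= g (overlap f (N := N) y x). Proof. by case: adg. Qed.

Lemma measurable_pair_integrand d' (U : measurableType d') (a : U -> N.-tuple T) (h : U -> #|edge N|.-tuple mR) :
  measurable_fun setT a -> measurable_fun setT h ->
  measurable_fun setT (fun z => wt (u (a z)) (h z) * part (iid P N) (fun x => g (overlap f (a z) x)) u (h z)).
Proof.
move=> ma mh; apply: measurable_funM; first by mble.
apply: (measurable_part_joint (iid P N) (rho := fun z x => g (overlap f (a z) x))) => //.
apply: measurable_admissible; last exact: measurable_snd.
exact: (measurableT_comp ma measurable_fst).
Qed.

Lemma pair_integrand_ge0 y W : 0 <= wt (u y) W * part (iid P N) (fun x => g (overlap f y x)) u W.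
Proof. by rewrite mulr_ge0 ?wt_ge0 ?part_ge0. Qed.

Lemma itg_pair W : itg (iid P N) (fun y => wt (u y) W * part (iid P N) (fun x => g (overlap f y x)) u W).
Proof.
case: adg => mg gp [B gB].
have iL : itg (iid P N) (fun y => B * (L W * (1 * wt (u y) W))).
  by apply: itgZ; apply: itgZ; apply: itg_part => //; exact: itg_cst.
apply: itg_le iL; first by apply: measurable_pair_integrand; [exact: measurable_id|exact: measurable_cst].
move=> y; rewrite ger0_norm ?pair_integrand_ge0//.
have : part (iid P N) (fun x => g (overlap f y x)) u W <= B * L W.
  rewrite /L /part -RintegralZl//; last by apply: itg_part => //; exact: itg_cst.
  apply: Rintegral_le.
  - by apply: itg_part => //; exact: itg_admissible.
  - by apply: itgZ; apply: itg_part => //; exact: itg_cst.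
  - by move=> x; rewrite mul1r ler_wpM2r ?wt_ge0// gB// overlap_bound.
move=> h; have := ler_wpM2l (wt_ge0 (u y) W) h.
by rewrite (_ : wt (u y) W * (B * L W) = B * (L W * (1 * wt (u y) W)))//; ring.
Qed.

Lemma pair_moment_ge0 W : 0 <= pair_moment g W.
Proof. by apply: Rintegral_ge0 => y _; exact: pair_integrand_ge0. Qed.

Lemma measurable_pair_moment : measurable_fun setT (pair_moment g).
Proof.
apply: measurable_Rintegral; last by move=> W y; exact: pair_integrand_ge0.
by apply: measurable_pair_integrand; [exact: measurable_snd|exact: measurable_fst].
Qed.

Lemma pair_momentE W : (pair_moment g W)%:E =
  (\int[iid P N]_y (wt (u y) W * part (iid P N) (fun x => g (overlap f y x)) u W)%:E)%E.
Proof. by rewrite ge0_RintegralE//; [move=> y; exact: pair_integrand_ge0|exact: itg_pair]. Qed.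

Lemma integral_pair_moment : (\int[gaussn #|edge N|]_W (pair_moment g W)%:E =
  \int[iid P N]_y \int[iid P N]_x (g (overlap f y x) * expR (dot (u x) (u y)))%:E)%E.
Proof.
transitivity (\int[gaussn #|edge N|]_W \int[iid P N]_y (wt (u y) W * part (iid P N) (fun x => g (overlap f y x)) u W)%:E)%E.
  by apply: eq_integral => W _; exact: pair_momentE.
rewrite (integral2_swap _ _ (F := fun W y => wt (u y) W * part (iid P N) (fun x => g (overlap f y x)) u W)).
- apply: eq_integral => y _.
  rewrite -(integral_part_wt (fun x => g0 y x) (itg_admissible y) mu_u).
  by apply: eq_integral => W _; rewrite mulrC.
- by apply: measurable_pair_integrand; [exact: measurable_snd|exact: measurable_fst].
- by move=> W y; exact: pair_integrand_ge0.
Qed.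

End one.

Lemma pair_moment_le c g h W : admissible g -> admissible h ->
  (forall s, `|s| <= N%:R * K ^+ 2 -> g s <= c * h s) -> pair_moment g W <= c * pair_moment h W.
Proof.
move=> ag ah gh; rewrite /pair_moment -RintegralZl//; last exact: itg_pair.
apply: Rintegral_le; [exact: itg_pair|by apply: itgZ; exact: itg_pair|].
move=> y; rewrite mulrCA; apply: ler_wpM2l; first exact: wt_ge0.
have ig := itg_admissible ag y; have ih := itg_admissible ah y.
have g0 x : 0 <= g (overlap f y x) by case: ag.
have h0 x : 0 <= h (overlap f y x) by case: ah.
rewrite /part -RintegralZl//; last exact: itg_part.
apply: Rintegral_le; [exact: itg_part|by apply: itgZ; exact: itg_part|].
by move=> x; rewrite mulrA ler_wpM2r ?wt_ge0// gh// overlap_bound.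
Qed.

Lemma pair_momentD g h W : admissible g -> admissible h ->
  pair_moment (fun s => g s + h s) W = pair_moment g W + pair_moment h W.
Proof.
move=> ag ah; rewrite /pair_moment -RintegralD//; [|exact: itg_pair..].
apply: eq_Rintegral => y _; rewrite -mulrDr; congr (_ * _).
have ig := itg_admissible ag y; have ih := itg_admissible ah y.
have g0 x : 0 <= g (overlap f y x) by case: ag.
have h0 x : 0 <= h (overlap f y x) by case: ah.
rewrite /part -RintegralD//; [|exact: itg_part..].
by apply: eq_Rintegral => x _; rewrite mulrDl.
Qed.

Lemma pair_moment1 W : pair_moment (fun=> 1) W = L W ^+ 2.
Proof.
rewrite /pair_moment -[part _ _ _ _]/(L W).
have i : itg (iid P N) (fun y => 1 * wt (u y) W) by apply: itg_part => //; exact: itg_cst.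
transitivity (\int[iid P N]_y (L W * (1 * wt (u y) W))); last by rewrite RintegralZl// expr2.
by apply: eq_Rintegral => y _; rewrite mul1r mulrC.
Qed.

Lemma admissible_cst c : 0 <= c -> admissible (fun=> c).
Proof. by move=> c0; split => //; exists c. Qed.

Lemma admissible_far e : admissible (far e).
Proof.
split; [by apply: measurable_far; exact: measurable_id|exact: far_ge0|].
by exists 1 => s _; exact: far_le1.
Qed.

Lemma admissible_near e : admissible (near_ind e).
Proof.
split; [by apply: measurable_near_ind; exact: measurable_id|exact: near_ind_ge0|].
by exists 1 => s _; exact: near_ind_le1.
Qed.

Lemma admissible_sqr : admissible (fun s => s ^+ 2 / N%:R).
Proof.
split; [by mble|by move=> s; rewrite divr_ge0// sqr_ge0|].
exists ((N%:R * K ^+ 2) ^+ 2 / N%:R) => s sN.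
rewrite ler_pM2r ?invr_gt0// -real_normK ?num_real// lerXn2r ?nnegrE//.
exact: le_trans sN.
Qed.

Lemma admissibleD g h : admissible g -> admissible h -> admissible (fun s => g s + h s).
Proof.
move=> [mg g0 [B gB]] [mh h0 [C hC]]; split; [exact: measurable_funD|by move=> s; rewrite addr_ge0|].
by exists (B + C) => s sN; rewrite lerD ?gB ?hC.
Qed.

Lemma admissibleM g h : admissible g -> admissible h -> admissible (fun s => g s * h s).
Proof.
move=> [mg g0 [B gB]] [mh h0 [C hC]]; split; [exact: measurable_funM|by move=> s; rewrite mulr_ge0|].
by exists (B * C) => s sN; rewrite ler_pM ?gB ?hC.
Qed.

(* Far overlaps contribute little to L ^+ 2; on this event, of high planted
   probability, second moments behave as if the far overlaps were removed. *)
Definition good e := [set W : #|edge N|.-tuple mR | N%:R * pair_moment (far (e * N%:R)) W <= L W ^+ 2].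

Lemma measurable_good e : measurable (good e).
Proof.
have m1 : measurable_fun setT (fun W => N%:R * pair_moment (far (e * N%:R)) W).
  by apply: measurable_funM; [exact: measurable_cst|apply: measurable_pair_moment; exact: admissible_far].
have m2 : measurable_fun setT (fun W => L W ^+ 2).
  by apply: measurable_funX; exact: measurable_likelihood.
have := measurable_fun_ler m1 m2.
by move=> /(_ measurableT [set true] I); rewrite setTI.
Qed.

(** Dominates both 1, whose pair moment is L ^+ 2, and s ^+ 2 / N, which bounds the squared gradient
    of ln L; a single estimate then controls both. *)
Definition spread s := 1 + s ^+ 2 / N%:R : R.

Lemma admissible_spread : admissible spread.
Proof. by apply: admissibleD; [exact: admissible_cst|exact: admissible_sqr]. Qed.

(** The factor N in [good] pays for [spread], which is at most 1 + N K ^+ 4 on the range of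
    overlaps: the far part of its pair moment is O(L ^+ 2). For N >= 2 far overlaps also carry at
    most half of L ^+ 2, hence L ^+ 2 is at most twice the near part. *)
Lemma good_pair_moment_le e W : (2 <= N)%N -> good e W ->
  pair_moment spread W <= (3 + 2 * K ^+ 4) * pair_moment (fun s => near_ind (e * N%:R) s * spread s) W.
Proof.
move=> N2; rewrite /good /= => gW.
have aF := admissible_far (e * N%:R); have aN := admissible_near (e * N%:R).
have aS := admissible_spread.
have aNS := admissibleM aN aS; have aFS := admissibleM aF aS.
set MN := pair_moment (fun s => near_ind _ s * _) W.
have N2R : 2 <= N%:R :> R by rewrite ler_nat.
have E : pair_moment spread W = MN + pair_moment (fun s => far (e * N%:R) s * spread s) W.
  rewrite /MN -(pair_momentD W aNS aFS).
  have sE : spread = fun s => near_ind (e * N%:R) s * spread s + far (e * N%:R) s * spread s.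
    by apply/funext => s; rewrite /near_ind; ring.
  exact: (congr1 (fun g => pair_moment g W) sE).
have spread_le s : `|s| <= N%:R * K ^+ 2 -> spread s <= 1 + N%:R * K ^+ 4.
  move=> sN; rewrite /spread lerD2l ler_pdivrMr//.
  rewrite -real_normK ?num_real// (_ : N%:R * K ^+ 4 * N%:R = (N%:R * K ^+ 2) ^+ 2); last by ring.
  by rewrite lerXn2r ?nnegrE// (le_trans _ sN).
have F1 : pair_moment (fun s => far (e * N%:R) s * spread s) W <= (1 + N%:R * K ^+ 4) * pair_moment (far (e * N%:R)) W.
  by apply: pair_moment_le => // s sN; rewrite mulrC ler_wpM2r ?far_ge0// spread_le.
have LF : L W ^+ 2 = pair_moment (near_ind (e * N%:R)) W + pair_moment (far (e * N%:R)) W.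
  rewrite -pair_moment1 -(pair_momentD W aN aF).
  have oneE : (fun=> 1) = fun s => near_ind (e * N%:R) s + far (e * N%:R) s.
    by apply/funext => s; rewrite /near_ind subrK.
  exact: (congr1 (fun g => pair_moment g W) oneE).
have N1 : pair_moment (near_ind (e * N%:R)) W <= 1 * MN.
  apply: pair_moment_le => // s sN; rewrite mul1r -[leLHS]mulr1 ler_wpM2l ?near_ind_ge0//.
  by rewrite /spread lerDl divr_ge0 ?sqr_ge0.
have PF0 := pair_moment_ge0 aF W; have PN0 := pair_moment_ge0 aN W.
move: gW F1 LF N1; rewrite E.
set F := pair_moment (far _) W; set Nn := pair_moment (near_ind _) W; set Q := pair_moment _ W.
move=> gW F1 LF; rewrite mul1r => N1.
by apply: truncated_moment_arith gW F1 LF N1 PF0 => //; exact: exprn_even_ge0.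
Qed.

(** Markov under the planted law. Off [good], L < N F / L with F the far pair moment, and by Bayes
    the null integral of F / L is the planted mean of the posterior probability of a far overlap. *)
Lemma likelihood_bad e : (\int[gaussn #|edge N|]_W (L W * \1_(~` good e) W)%:E <=
  N%:R%:E * \int[iid P N]_y \int[gaussn #|edge N|]_W
     (far_likelihood P f lam e y (lin 1 1 (u y) W) * L (lin 1 1 (u y) W) `^ (-1))%:E)%E.
Proof.
have mL := @measurable_likelihood _ T R P f mf lam N.
have Lp W : 0 < L W by exact: (likelihood_gt0 P mf fK).
have mLi : measurable_fun setT (fun W => L W `^ (-1)) by exact: (measurableT_comp (measurable_powR _)).
have aF := admissible_far (e * N%:R).
have mI : measurable_fun setT (fun z : N.-tuple T * #|edge N|.-tuple mR =>
    far_likelihood P f lam e z.1 z.2 * L z.2 `^ (-1)).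
  apply: measurable_funM; last exact: (measurableT_comp mLi measurable_snd).
  by apply: (measurable_far_likelihood P mf); [exact: measurable_fst|exact: measurable_snd].
have I0 y W : 0 <= far_likelihood P f lam e y W * L W `^ (-1).
  by rewrite mulr_ge0 ?powR_ge0 ?far_likelihood_ge0.
rewrite (integral_planted (iid P N) mu_u mI I0).
have inner W : (\int[iid P N]_y (wt (u y) W * (far_likelihood P f lam e y W * L W `^ (-1)))%:E =
   (pair_moment (far (e * N%:R)) W * L W `^ (-1))%:E)%E.
  rewrite EFinM pair_momentE// -ge0_integralZr//.
  - by apply: eq_integral => y _; rewrite mulrA EFinM.
  - apply/measurable_EFinP.
    by apply: (measurable_pair_integrand aF); [exact: measurable_id|exact: measurable_cst].
  - by move=> y _; rewrite lee_fin pair_integrand_ge0.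
  - by rewrite lee_fin powR_ge0.
under [in leRHS]eq_integral do rewrite inner.
have mp := measurable_pair_moment aF.
rewrite -ge0_integralZl//; first last.
- by move=> W _; rewrite lee_fin mulr_ge0 ?powR_ge0// pair_moment_ge0.
- by apply/measurable_EFinP/measurable_funM.
apply: ge0_le_integral; [exact: measurableT| | | |].
- by move=> W _; rewrite lee_fin mulr_ge0// ltW.
- apply/measurable_EFinP/measurable_funM => //.
  by apply: measurable_indic; apply: measurableC; exact: measurable_good.
- apply: emeasurable_funM; first exact: measurable_cst.
  by apply/measurable_EFinP/measurable_funM.
- move=> W _; rewrite -EFinM lee_fin indicE.
  have [/set_mem|_] := boolP (W \in _); last first.
    by rewrite mulr0 !mulr_ge0 ?powR_ge0// pair_moment_ge0.
  rewrite /good /= => /negP; rewrite -ltNge => h.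
  rewrite mulr1 (powR_inv1 (ltW (Lp W))) mulrA ler_pdivlMr// -expr2; exact: ltW.
Qed.

End replica_pair.

Lemma linear_expR_small (R : realType) (C c eta : R) : 0 <= C -> 0 < c -> 0 < eta ->
  exists N0, forall N, (N0 <= N)%N -> N%:R * (C * expR (- (c * N%:R))) <= eta.
Proof.
move=> C0 c0 eta0.
exists (Num.truncn (2 * C / (c ^+ 2 * eta))).+1 => N NN.
have N0 : 0 < N%:R :> R by rewrite ltr0n; exact: leq_trans NN.
have c2 : 0 < c ^+ 2 by exact: exprn_gt0.
have h : 2 * C / (c ^+ 2 * eta) <= N%:R.
  by apply: ltW; apply: (lt_le_trans (truncnS_gt _)); rewrite ler_nat.
rewrite ler_pdivrMr ?mulr_gt0// in h.
have e := @expR_ge1Dxn R (c * N%:R) 1 (mulr_ge0 (ltW c0) (ltW N0)).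
rewrite (_ : (2`!)%:R = 2)// in e.
rewrite expRN mulrA ler_pdivrMr ?expR_gt0//.
apply: (@le_trans _ _ (eta * ((c * N%:R) ^+ 2 / 2))); last by rewrite ler_wpM2l ?(ltW eta0)//; lra.
rewrite -subr_ge0.
have -> : eta * ((c * N%:R) ^+ 2 / 2) - N%:R * C = N%:R * (N%:R * (c ^+ 2 * eta) - 2 * C) / 2 by field.
by rewrite divr_ge0// mulr_ge0// ?(ltW N0)// subr_ge0.
Qed.

Lemma quarter_le (R : realType) (z : R) : 1 <= 4^-1 + (4^-1 + (4^-1 + z)) -> 1 <= 4 * z.
Proof. lra. Qed.

(** * The planted law is contiguous to the null law; a typical set under the null law *)

Section good_event.
Context d (T : measurableType d) (R : realType) (P : probability T R).
Notation mR := (measurableTypeR R).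
Notation gaussn := (iid (@gauss R)).
Variables (f : T -> mR) (K : R).
Hypotheses (mf : measurable_fun setT f) (fK : forall x, `|f x| <= K).
Hypotheses (f_mean : \int[P]_x f x = 0) (f_var : \int[P]_x (f x) ^+ 2 = 1).
Variables (lam lam' : R).
Hypotheses (lam0 : 0 < lam) (lam1 : lam < 1) (lamlam' : lam < lam').
Hypothesis free_energy_le : forall s, 0 <= s -> free_energy P f s <= s ^+ 4 / (4 * lam').

Local Notation L N := (@likelihood _ T R P f lam N).
Local Notation spr N := (@pair_moment _ T R P f lam N (@spread R N)).

Lemma pair_moment_spread_ge N W : (0 < N)%N -> L N W ^+ 2 <= spr N W.
Proof.
move=> N0; rewrite -(pair_moment1 P mf lam) -[leRHS]mul1r.
apply: (pair_moment_le P mf fK) => [||s _].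
- exact: admissible_cst.
- exact: (admissible_spread _ N0).
- by rewrite mul1r /spread lerDl divr_ge0 ?sqr_ge0.
Qed.

Lemma good_event_bounds : exists2 e, 0 < e & exists2 C, 0 <= C & forall eta, 0 < eta ->
  exists N0, forall N, (N0 <= N)%N -> [/\ (2 <= N)%N,
    (\int[gaussn #|edge N|]_W (L N W * \1_(~` good P f lam e) W)%:E <= eta%:E)%E &
    (\int[gaussn #|edge N|]_W (\1_(good P f lam e) W * spr N W)%:E <= C%:E)%E].
Proof.
(* The room between lam and l1 absorbs the factor [spread], while l1 < 1 still allows
   [near_moment]. *)
pose l1 := (lam + 1) / 2.
have l1b : 0 < l1 < 1 by apply/andP; split; rewrite /l1; move: lam0 lam1; lra.
have [e e0 [C1 [N1 H1]]] := near_moment mf fK f_mean f_var l1b.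
have [C2 C20 [c c0 H2]] := planted_overlap mf fK lam0 lamlam' free_energy_le e0.
pose k := l1 - lam.
have k0 : 0 < k by rewrite /k /l1; move: lam1; lra.
(* Chosen so that 1 + x / N <= D * (1 + k x / (2 N)) <= D * expR (k x / (2 N)) for x = S ^+ 2. *)
pose D := 1 + 2 / k.
have D0 : 0 <= D by rewrite /D addr_ge0// divr_ge0// ltW.
pose A := 3 + 2 * K ^+ 4.
have A0 : 0 <= A by rewrite /A addr_ge0// mulr_ge0// exprn_even_ge0.
exists e => //; exists (A * (D * `|C1|)); first by rewrite !mulr_ge0.
move=> eta eta0.
have [N3 H3] := linear_expR_small C20 c0 eta0.
exists (maxn (maxn N1 N3) 2) => N; rewrite !geq_max => /andP[/andP[N1N N3N] N2].
have N0 : (0 < N)%N by exact: ltn_trans N2.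
have NR : 0 < N%:R :> R by rewrite ltr0n.
split => //.
  apply: (le_trans (likelihood_bad P mf fK lam0 N0 e)).
  apply: (@le_trans _ _ (N%:R%:E * (C2 * expR (- (c * N%:R)))%:E)%E).
    by apply: lee_wpmul2l; [rewrite lee_fin ltW|exact: H2].
  by rewrite -EFinM lee_fin; exact: H3.
have aS := admissible_spread K N0.
have aN := admissible_near K N (e * N%:R).
have aNS := admissibleM aN aS.
apply: (@le_trans _ _ (\int[gaussn #|edge N|]_W (A%:E * (@pair_moment _ T R P f lam N (fun s => near_ind (e * N%:R) s * @spread R N s) W)%:E))%E).
  apply: ge0_le_integral; [exact: measurableT| | | |].
  - by move=> W _; rewrite lee_fin mulr_ge0// (pair_moment_ge0 P f lam aS).
  - apply/measurable_EFinP/measurable_funM; last exact: (measurable_pair_moment P mf lam aS).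
    by apply: measurable_indic; exact: (measurable_good P K mf).
  - apply: emeasurable_funM; first exact: measurable_cst.
    by apply/measurable_EFinP; exact: (measurable_pair_moment P mf lam aNS).
  - move=> W _; rewrite -EFinM lee_fin indicE.
    have [/set_mem gW|_] := boolP (W \in _).
      by rewrite mul1r; exact: (good_pair_moment_le mf fK N0).
    by rewrite mul0r mulr_ge0// (pair_moment_ge0 P f lam aNS).
rewrite ge0_integralZl//; first last.
- by move=> W _; rewrite lee_fin (pair_moment_ge0 P f lam aNS).
- by apply/measurable_EFinP; exact: (measurable_pair_moment P mf lam aNS).
rewrite [in leRHS]EFinM; apply: lee_wpmul2l; first by rewrite lee_fin.
rewrite (integral_pair_moment P mf fK lam aNS).
pose G y x := near_ind (e * N%:R) (overlap f (N := N) y x) * expR (l1 / (2 * N%:R) * overlap f y x ^+ 2).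
have mG : measurable_fun setT (fun z : N.-tuple T * N.-tuple T => G z.1 z.2).
  have mo : measurable_fun setT (fun z : N.-tuple T * N.-tuple T => overlap f z.1 z.2 : mR).
    by apply: measurable_overlap; [exact: mf|exact: measurable_fst|exact: measurable_snd].
  by apply: measurable_funM; [exact: measurable_near_ind|mble].
have G0 y x : 0 <= G y x by rewrite mulr_ge0 ?near_ind_ge0 ?expR_ge0.
have {}H1 := H1 N N1N.
apply: (@le_trans _ _ (D%:E * \int[iid P N]_y \int[iid P N]_x (G y x)%:E)%E); last first.
  rewrite EFinM; apply: lee_wpmul2l; first by rewrite lee_fin.
  by apply: (le_trans H1); rewrite lee_fin ler_norm.
have mus := @measurable_spike _ T R f mf lam N.
have mE : measurable_fun setT (fun z : N.-tuple T * N.-tuple T =>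
    (near_ind (e * N%:R) (overlap f z.1 z.2) * spread N (overlap f z.1 z.2)) * expR (dot (spike f lam z.2) (spike f lam z.1))).
  apply: measurable_funM; last by mble.
  by apply: (measurable_admissible mf aNS); [exact: measurable_fst|exact: measurable_snd].
have E0 y x : 0 <= (near_ind (e * N%:R) (overlap f (N := N) y x) * spread N (overlap f y x)) * expR (dot (spike f lam x) (spike f lam y)).
  by case: aNS => _ h _; rewrite mulr_ge0 ?expR_ge0.
rewrite (integral2E _ _ mE E0) (integral2E _ _ mG G0) -ge0_integralZl//; first last.
- by move=> z _; rewrite lee_fin.
- exact/measurable_EFinP.
apply: ge0_le_integral; [exact: measurableT| | | |].
- by move=> z _; rewrite lee_fin.
- exact/measurable_EFinP.
- by apply: emeasurable_funM; [exact: measurable_cst|exact/measurable_EFinP].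
- move=> z _; rewrite -EFinM lee_fin /G.
  have := dot_spike_le P fK lam0 N0 z.2 z.1; rewrite overlapC.
  set S := overlap f _ _ => dS.
  rewrite mulrCA -mulrA; apply: ler_wpM2l; first exact: near_ind_ge0.
  apply: (@le_trans _ _ (D * expR (k / (2 * N%:R) * S ^+ 2) * expR (lam / (2 * N%:R) * S ^+ 2))).
    apply: ler_pM; [by rewrite /spread addr_ge0// divr_ge0 ?sqr_ge0|exact: expR_ge0| |by rewrite ler_expR].
    have := expR_ge1Dx (k / (2 * N%:R) * S ^+ 2); set E := expR _ => h.
    apply: le_trans (ler_wpM2l D0 h).
    have q0 : 0 <= k / (2 * N%:R) * S ^+ 2 by rewrite mulr_ge0 ?sqr_ge0// divr_ge0 ?mulr_ge0// ltW.
    rewrite /D /spread.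
    have -> : (1 + 2 / k) * (1 + k / (2 * N%:R) * S ^+ 2) = 1 + S ^+ 2 / N%:R + 2 / k + k / (2 * N%:R) * S ^+ 2.
      by field; rewrite !gt_eqF.
    by rewrite -!addrA lerD2l lerDl addr_ge0// divr_ge0// ltW.
  rewrite -mulrA -expRD le_eqVlt; apply/orP; left; apply/eqP; congr (_ * expR _).
  by rewrite /k; field; rewrite gt_eqF.
Qed.

Let mL N : measurable_fun setT (L N).
Proof. exact: measurable_likelihood. Qed.

Let mgood N e : measurable (good P f lam e : set (#|edge N|.-tuple mR)).
Proof. exact: (measurable_good P K mf). Qed.

Let mspr N : (0 < N)%N -> measurable_fun setT (spr N).
Proof. by move=> N0; exact: (measurable_pair_moment P mf lam (admissible_spread K N0)). Qed.

Let spr0 N W : (0 < N)%N -> 0 <= spr N W.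
Proof. by move=> N0; exact: (pair_moment_ge0 P f lam (admissible_spread K N0)). Qed.

(** Uniform integrability of L: its mass off [good] is small, and on [good] its second moment is
    bounded, with L <= t L ^+ 2 + 1 / t used on A. *)
Lemma planted_le_null eta : 0 < eta -> exists2 delta, 0 < delta & exists N0, forall N, (N0 <= N)%N ->
  forall A, measurable A -> (gaussn #|edge N| A <= delta%:E)%E ->
  (\int[gaussn #|edge N|]_W (L N W * \1_A W)%:E <= eta%:E)%E.
Proof.
move=> eta0; have [e e0 [C C0 H]] := good_event_bounds.
(* Three shares of eta / 3: the mass off [good], t C on [good], and delta / t on A. *)
pose t := eta / (3 * (C + 1)).
have C1 : 0 < C + 1 by exact: ltr_pwDr.
have t0 : 0 < t by rewrite divr_gt0// mulr_gt0.
exists (t * (eta / 3)); first by rewrite mulr_gt0// divr_gt0.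
have [|N0 {}H] := H (eta / 3); first by rewrite divr_gt0.
exists N0 => N /H[N2 Hb Hg] A mA Ad.
have N0' : (0 < N)%N by exact: ltn_trans N2.
have Lp W : 0 < L N W by exact: (likelihood_gt0 P mf fK).
have m1 : measurable_fun setT (fun W => L N W * \1_(~` good P f lam e) W).
  by apply: measurable_funM; [exact: mL|apply: measurable_indic; apply: measurableC; exact: mgood].
have m2 : measurable_fun setT (fun W => \1_(good P f lam e) W * spr N W).
  by apply: measurable_funM; [apply: measurable_indic; exact: mgood|exact: mspr].
have m3 : measurable_fun setT (\1_A : #|edge N|.-tuple mR -> R) by exact: measurable_indic.
pose F1 W := (L N W * \1_(~` good P f lam e) W)%:E.
pose F2 W := (t%:E * (\1_(good P f lam e) W * spr N W)%:E)%E.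
pose F3 (W : #|edge N|.-tuple mR) := (t^-1%:E * (\1_A W)%:E)%E.
have F10 W : (0 <= F1 W)%E by rewrite lee_fin mulr_ge0// ltW.
have F20 W : (0 <= F2 W)%E by rewrite /F2 -EFinM lee_fin; apply: mulr_ge0; [exact: ltW|apply: mulr_ge0 => //; exact: spr0].
have F30 W : (0 <= F3 W)%E by rewrite /F3 -EFinM lee_fin mulr_ge0// invr_ge0 ltW.
have mF1 : measurable_fun setT F1 by exact/measurable_EFinP.
have mF2 : measurable_fun setT F2 by apply: emeasurable_funM; [exact: measurable_cst|exact/measurable_EFinP].
have mF3 : measurable_fun setT F3 by apply: emeasurable_funM; [exact: measurable_cst|exact/measurable_EFinP].
apply: (@le_trans _ _ (\int[gaussn #|edge N|]_W (F1 W + (F2 W + F3 W)))%E).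
  apply: ge0_le_integral; [exact: measurableT| | | |].
  - by move=> W _; rewrite lee_fin mulr_ge0// ltW.
  - by apply/measurable_EFinP; apply: measurable_funM => //; exact: mL.
  - by apply: emeasurable_funD => //; exact: emeasurable_funD.
  - move=> W _; rewrite /F1 /F2 /F3 -!EFinM -!EFinD lee_fin !indicE in_setC.
    have LW := Lp W; have Lspr := pair_moment_spread_ge W N0'.
    have ti : 0 < t^-1 by rewrite invr_gt0.
    have sp := spr0 W N0'.
    case: (W \in A); case: (W \in good _ _ _ _) => /=; rewrite ?mulr0 ?mulr1 ?mul0r ?mul1r ?addr0 ?add0r ?mulr0 ?addr0//.
    + have h : t * L N W ^+ 2 <= t * spr N W by rewrite ler_wpM2l// ltW.
      apply: (@le_trans _ _ (t * L N W ^+ 2 + t^-1)); last by rewrite lerD2r.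
      have -> : t * L N W ^+ 2 + t^-1 = L N W + t * (L N W - t^-1 / 2) ^+ 2 + 3 / 4 * t^-1.
        by field; rewrite gt_eqF.
      by rewrite -addrA lerDl addr_ge0// mulr_ge0 ?sqr_ge0// ltW.
    + by rewrite add0r lerDl ltW.
    + by rewrite mulr_ge0// ltW.
    + exact: ltW.
rewrite ge0_integralD//; first last.
- exact: emeasurable_funD.
- by move=> W _; rewrite adde_ge0.
rewrite ge0_integralD//.
rewrite ge0_integralZl//; first last.
- by rewrite lee_fin ltW.
- by move=> W _; rewrite lee_fin; apply: mulr_ge0 => //; exact: spr0.
- exact/measurable_EFinP.
rewrite ge0_integralZl//; first last.
- by rewrite lee_fin invr_ge0 ltW.
- exact/measurable_EFinP.
rewrite integral_indic// setIT.
have -> : eta%:E = ((eta / 3)%:E + ((eta / 3)%:E + (eta / 3)%:E))%E by rewrite -!EFinD; congr EFin; field.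
apply: leeD => //; apply: leeD.
  apply: (@le_trans _ _ (t%:E * C%:E)%E); first by apply: lee_wpmul2l => //; rewrite lee_fin ltW.
  rewrite -EFinM lee_fin /t mulrAC ler_pdivrMr ?mulr_gt0//.
  have -> : eta / 3 * (3 * (C + 1)) = eta * C + eta by field.
  by rewrite lerDl ltW.
apply: (@le_trans _ _ (t^-1%:E * (t * (eta / 3))%:E)%E).
  by apply: lee_wpmul2l => //; rewrite lee_fin invr_ge0 ltW.
by rewrite -EFinM lee_fin mulKf// gt_eqF.
Qed.

(** On this set ln L is bounded below and, by [posterior_mean_sqr_le], its gradient is bounded, both
    uniformly in N. *)
Definition typical N s := [set W | 4^-1 <= L N W /\ spr N W <= s ^+ 2].
Arguments typical N s : clear implicits.

Lemma measurable_typical N s : (0 < N)%N -> measurable (typical N s).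
Proof.
move=> N0; apply: measurableI.
  have := measurable_fun_ler (measurable_cst (4^-1 : R)) (@mL N).
  by move=> /(_ measurableT [set true] I); rewrite setTI.
have := measurable_fun_ler (@mspr N N0) (measurable_cst (s ^+ 2)).
by move=> /(_ measurableT [set true] I); rewrite setTI.
Qed.

(** A Paley-Zygmund argument: the unit mean of L is at most 1/4 where L <= 1/4, plus its mass off
    [good], plus the mean of spr / s on [good], plus s times the probability of [typical], where L
    <= s. *)
Lemma typical_mass : exists2 s, 0 < s & exists N0, forall N, (N0 <= N)%N ->
  (2 <= N)%N /\ ((4 * s)^-1%:E <= gaussn #|edge N| (typical N s))%E.
Proof.
have [e e0 [C C0 H]] := good_event_bounds.
(* Makes C / s at most 1/4; the first three shares then total at most 3/4, leaving 1/4 for s times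
   the probability sought. *)
pose s := 4 * (C + 1).
have s0 : 0 < s by rewrite mulr_gt0// ltr_pwDr.
exists s => //.
have [|N0 {}H] := H 4^-1; first by rewrite invr_gt0.
exists N0 => N /H[N2 Hb Hg]; split => //.
have N0' : (0 < N)%N by exact: ltn_trans N2.
have Lp W : 0 < L N W by exact: (likelihood_gt0 P mf fK).
have mT := measurable_typical s N0'.
have m1 : measurable_fun setT (fun W => L N W * \1_(~` good P f lam e) W).
  by apply: measurable_funM; [exact: mL|apply: measurable_indic; apply: measurableC; exact: mgood].
have m2 : measurable_fun setT (fun W => \1_(good P f lam e) W * spr N W).
  by apply: measurable_funM; [apply: measurable_indic; exact: mgood|exact: mspr].
have m3 : measurable_fun setT (\1_(typical N s) : #|edge N|.-tuple mR -> R) by exact: measurable_indic.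
pose F1 W := (L N W * \1_(~` good P f lam e) W)%:E.
pose F2 W := (s^-1%:E * (\1_(good P f lam e) W * spr N W)%:E)%E.
pose F3 (W : #|edge N|.-tuple mR) := (s%:E * (\1_(typical N s) W)%:E)%E.
have si : 0 < s^-1 by rewrite invr_gt0.
have F10 W : (0 <= F1 W)%E by rewrite lee_fin mulr_ge0// ltW.
have F20 W : (0 <= F2 W)%E by rewrite /F2 -EFinM lee_fin; apply: mulr_ge0; [exact: ltW|apply: mulr_ge0 => //; exact: spr0].
have F30 W : (0 <= F3 W)%E by rewrite /F3 -EFinM lee_fin mulr_ge0// ltW.
have mF1 : measurable_fun setT F1 by exact/measurable_EFinP.
have mF2 : measurable_fun setT F2 by apply: emeasurable_funM; [exact: measurable_cst|exact/measurable_EFinP].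
have mF3 : measurable_fun setT F3 by apply: emeasurable_funM; [exact: measurable_cst|exact/measurable_EFinP].
have : (\int[gaussn #|edge N|]_W (L N W)%:E <= \int[gaussn #|edge N|]_W (4^-1%:E + (F1 W + (F2 W + F3 W))))%E.
  apply: ge0_le_integral; [exact: measurableT| | | |].
  - by move=> W _; rewrite lee_fin ltW.
  - by apply/measurable_EFinP; exact: mL.
  - apply: emeasurable_funD; first exact: measurable_cst.
    by apply: emeasurable_funD => //; exact: emeasurable_funD.
  - move=> W _; rewrite /F1 /F2 /F3 -!EFinM -!EFinD lee_fin !indicE in_setC.
    have LW := Lp W; have Lspr := pair_moment_spread_ge W N0'.
    have sp := spr0 W N0'.
    have [gW|gW] := boolP (W \in good _ _ _ _); last first.
      rewrite /= mulr1 mul0r mulr0 add0r addrCA lerDl addr_ge0//.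
      by rewrite mulr_ge0// ltW.
    rewrite /= mulr0 add0r mul1r.
    have [LW4|LW4] := leP (L N W) 4^-1.
      by apply: (le_trans LW4); rewrite lerDl addr_ge0// mulr_ge0// ltW.
    apply: ler_wpDl; first by rewrite invr_ge0.
    have [tW|tW] := boolP (W \in typical N s).
      rewrite mulr1; apply: ler_wpDl; first by rewrite mulr_ge0// ltW.
      move/set_mem: tW => [_ h].
      by rewrite -(ler_pXn2r (ltn0Sn 1)) ?nnegrE; [exact: le_trans Lspr h|exact: ltW|exact: ltW].
    (* L <= spr / s in both cases, because L ^+ 2 <= spr and s ^+ 2 < spr *)
    rewrite mulr0 addr0 mulrC ler_pdivlMr//.
    have : s ^+ 2 < spr N W.
      by rewrite ltNge; apply: contra tW => h; apply/mem_set; split => //; exact: ltW.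
    move=> h; have [Ls|Ls] := leP (L N W) s.
      by apply: le_trans (ltW h); rewrite expr2 ler_wpM2r// ltW.
    by apply: le_trans Lspr; rewrite expr2 ler_wpM2l// ltW.
have -> : (\int[gaussn #|edge N|]_W (L N W)%:E = 1)%E.
  rewrite integral_part//; [|exact: itg_cst|exact: measurable_spike].
  by rewrite integral_prob_cst.
rewrite ge0_integralD//; first last.
- by apply: emeasurable_funD => //; exact: emeasurable_funD.
- by move=> W _; rewrite !adde_ge0.
rewrite integral_prob_cst ge0_integralD//; first last.
- exact: emeasurable_funD.
- by move=> W _; rewrite adde_ge0.
rewrite ge0_integralD//.
rewrite ge0_integralZl//; first last.
- by rewrite lee_fin ltW.
- by move=> W _; rewrite lee_fin mulr_ge0// spr0.
- exact/measurable_EFinP.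
rewrite ge0_integralZl//; first last.
- by rewrite lee_fin ltW.
- exact/measurable_EFinP.
rewrite integral_indic// setIT.
have fB : (gaussn #|edge N| (typical N s)) \is a fin_num by exact: fin_num_measure.
rewrite -(fineK fB); set b := fine _ => h.
have : (1 <= 4^-1%:E + (4^-1%:E + (4^-1%:E + s%:E * b%:E)))%E.
  apply: (le_trans h); apply: leeD => //; apply: leeD => //; apply: leeD; last by rewrite /b fineK.
  apply: (@le_trans _ _ (s^-1%:E * C%:E)%E); first by apply: lee_wpmul2l => //; rewrite lee_fin ltW.
  by rewrite -EFinM lee_fin mulrC ler_pdivrMr// /s mulKf// lerDl.
rewrite -EFinM -!EFinD !lee_fin => {}h.
have {}h : 1 <= 4 * s * b by rewrite -mulrA; exact: quarter_le.
have s4 : 0 < 4 * s by rewrite mulr_gt0.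
by rewrite -[leLHS]mul1r (ler_pdivrMr _ _ s4) [b * _]mulrC.
Qed.

End good_event.

(** * Lower deviations of convex functions of a Gaussian vector *)

Section trigonometry.
Variable R : realType.

Lemma sin_le_id (x : R) : 0 <= x -> sin x <= x.
Proof.
rewrite le_eqVlt => /orP[/eqP<-|x0]; first by rewrite sin0.
have cf : {within `[0, x], continuous (sin : R -> R)}.
  by apply: derivable_within_continuous => t _; apply: ex_derive.
have [c _] := MVT x0 (fun t _ => is_derive_sin t) cf.
rewrite sin0 !subr0 => ->; rewrite -[leRHS]mul1r ler_wpM2r ?cos_le1//; exact: ltW.
Qed.

Lemma sin_sqr_le (x : R) : 0 <= x <= pi -> sin x ^+ 2 <= x ^+ 2.
Proof.
move=> /andP[x0 xp]; rewrite lerXn2r ?nnegrE// ?sin_le_id// sin_ge0_pi//.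
by rewrite x0.
Qed.

Lemma one_sub_cos_sqr_le (x : R) : 0 <= x <= pi -> (1 - cos x) ^+ 2 <= (x ^+ 2 / 2) ^+ 2.
Proof.
move=> /andP[x0 xp]; rewrite lerXn2r ?nnegrE ?divr_ge0 ?sqr_ge0 ?subr_ge0 ?cos_le1//.
have -> : x = (x / 2) *+ 2 by rewrite -mulr_natr divfK.
rewrite cos_mulr2n cos2sin2.
have : sin (x / 2) ^+ 2 <= (x / 2) ^+ 2.
  by apply: sin_sqr_le; rewrite divr_ge0//=; lra.
set y := x / 2; set s := sin y ^+ 2 => h.
have -> : 1 - ((1 - s) *+ 2 - 1) = 2 * s by ring.
by have -> : (y *+ 2) ^+ 2 / 2 = 2 * y ^+ 2 by [field]; rewrite ler_pM2l.
Qed.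

End trigonometry.

Lemma dot_cauchy_schwarz (R : realType) n (a b : n.-tuple (measurableTypeR R)) :
  dot a b ^+ 2 <= dot a a * dot b b.
Proof.
have := dot_ge0 b; rewrite le_eqVlt => /orP[/eqP/esym b0|b0].
  have : dot a b = 0.
    apply: big1 => k _.
    have : tnth b k * tnth b k = 0.
      apply/eqP; have := b0; rewrite /dot => /eqP; rewrite psumr_eq0; last by move=> i _; rewrite -expr2 sqr_ge0.
      by move=> /allP /(_ k (mem_index_enum k)) /implyP /(_ isT).
    by move=> /eqP; rewrite mulf_eq0 orbb => /eqP ->; rewrite mulr0.
  by move=> ->; rewrite b0 expr0n/= mulr0.
have := dot_ge0 (lin (dot b b) (- dot a b) a b).
rewrite dot_linl !dot_linr [dot b a]dotC => h.
have : 0 <= dot b b * (dot a a * dot b b - dot a b ^+ 2).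
  by apply: le_trans h _; rewrite le_eqVlt; apply/orP; left; apply/eqP; ring.
by rewrite pmulr_rge0// subr_ge0.
Qed.

Lemma sqr_sum_le (R : realType) n (x : 'I_n -> R) : (\sum_i x i) ^+ 2 <= n%:R * \sum_i x i ^+ 2.
Proof.
have -> : n%:R * \sum_i x i ^+ 2 = \sum_(i < n) \sum_(j < n) (x i ^+ 2 + x j ^+ 2) / 2.
  rewrite [RHS](eq_bigr (fun i => x i ^+ 2 * (n%:R / 2) + (\sum_j x j ^+ 2) / 2)); last first.
    move=> i _; transitivity (\sum_(j < n) (x i ^+ 2 / 2 + x j ^+ 2 / 2)).
      by apply: eq_bigr => j _; rewrite mulrDl.
    by rewrite big_split /= sumr_const card_ord -mulr_suml -mulr_natr; congr (_ + _); ring.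
  by rewrite big_split /= -mulr_suml sumr_const card_ord -mulr_natr; field.
rewrite expr2 mulr_suml; apply: ler_sum => i _; rewrite mulr_sumr; apply: ler_sum => j _.
by have := sqr_ge0 (x i - x j); lra.
Qed.

Section gauss_dot.
Variable R : realType.
Notation mR := (measurableTypeR R).
Notation gaussn := (iid (@gauss R)).

Lemma sqr_le_cosh (x : R) : x ^+ 2 <= 2 * (expR x + expR (- x)).
Proof.
apply: (le_trans (sqr_le_exp x)); rewrite ler_pM2l//.
have [x0|x0] := leP 0 x; first by rewrite ger0_norm// lerDl expR_ge0.
by rewrite ltr0_norm// lerDr expR_ge0.
Qed.

(** Free of the dimension. The constant 8 comes from x ^+ 2 <= 2 (e^x + e^(-x)) after scaling a into
    the unit ball, where both exponentials have mean at most expR (1 / 2) <= 2. *)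
Lemma integral_dot_sqr_le n (a : n.-tuple mR) C : 0 < C -> dot a a <= C ^+ 2 ->
  (\int[gaussn n]_Y (dot a Y ^+ 2)%:E <= (8 * C ^+ 2)%:E)%E.
Proof.
move=> C0 aC.
pose b := scal C^-1 a.
have b1 : dot b b <= 1.
  rewrite dot_scall dot_scalr mulrA -expr2 exprVn ler_pdivrMl ?exprn_gt0//.
  by rewrite mulr1.
have e2 : expR (1 / 2) <= 2 :> R by have := expR_sub1_le (1 / 2 : R); lra.
have pt Y : dot a Y ^+ 2 <= 2 * C ^+ 2 * expR (1 / 2) * wt b Y + 2 * C ^+ 2 * expR (1 / 2) * wt (scal (-1) b) Y.
  have -> : dot a Y = C * dot b Y by rewrite dot_scall mulVKf// gt_eqF.
  rewrite exprMn -mulrDr (_ : 2 * C ^+ 2 * expR (1 / 2) = C ^+ 2 * (2 * expR (1 / 2))); last by ring.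
  rewrite -[leRHS]mulrA ler_wpM2l ?sqr_ge0//; apply: (le_trans (sqr_le_cosh _)).
  rewrite -mulrA ler_pM2l// mulrDr /wt -!expRD.
  rewrite !dot_scall !dot_scalr.
  apply: lerD; rewrite ler_expR; rewrite /b !dot_scall !dot_scalr in b1 *; lra.
apply: (@le_trans _ _ (\int[gaussn n]_Y ((2 * C ^+ 2 * expR (1 / 2))%:E * (wt b Y)%:E + (2 * C ^+ 2 * expR (1 / 2))%:E * (wt (scal (-1) b) Y)%:E))%E).
  apply: ge0_le_integral; [exact: measurableT| | | |].
  - by move=> Y _; rewrite lee_fin sqr_ge0.
  - by mble.
  - by apply: emeasurable_funD; apply: emeasurable_funM; try exact: measurable_cst; mble.
  - by move=> Y _; rewrite -!EFinM -EFinD lee_fin.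
have c0 : 0 <= 2 * C ^+ 2 * expR (1 / 2) by pos.
rewrite ge0_integralD//; first last.
- by apply: emeasurable_funM; try exact: measurable_cst; mble.
- by move=> Y _; rewrite -EFinM lee_fin; pos.
- by apply: emeasurable_funM; try exact: measurable_cst; mble.
- by move=> Y _; rewrite -EFinM lee_fin; pos.
rewrite !ge0_integralZl//; first last.
- by move=> Y _; rewrite lee_fin; pos.
- by mble.
- by move=> Y _; rewrite lee_fin; pos.
- by mble.
rewrite !gaussn_wt !mule1 -EFinD lee_fin.
have : C ^+ 2 * expR (1 / 2) <= C ^+ 2 * 2 by rewrite ler_wpM2l// sqr_ge0.
lra.
Qed.

(** Growth in n is harmless here: the bound meets only the factor delta ^+ 2 of a vanishing rotation
    angle and the radius of a net. *)
Lemma integral_dot_self_le n :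
  (\int[gaussn n]_Y (dot Y Y)%:E <= (4 * (Num.sqrt (1 - 1 / 2))^-1 ^+ n)%:E)%E.
Proof.
have h : (1 / 2 : R) < 1 by lra.
apply: (@le_trans _ _ (\int[gaussn n]_Y (4%:E * (\prod_(i < n) expR (1 / 2 * tnth Y i ^+ 2 / 2))%:E))%E).
  apply: ge0_le_integral; [exact: measurableT| | | |].
  - by move=> Y _; rewrite lee_fin dot_ge0.
  - by mble.
  - apply: emeasurable_funM; first exact: measurable_cst.
    by apply/measurable_EFinP; apply: measurable_prod => i _; mble.
  - move=> Y _; rewrite -EFinM lee_fin -expR_sum.
    have -> : \sum_(i < n) 1 / 2 * tnth Y i ^+ 2 / 2 = dot Y Y / 4.
      by rewrite /dot mulr_suml; apply: eq_bigr => i _; field.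
    by have := expR_ge1Dx (dot Y Y / 4); lra.
rewrite ge0_integralZl//; first last.
- by move=> Y _; rewrite lee_fin prodr_ge0// => i _; exact: expR_ge0.
- by apply/measurable_EFinP; apply: measurable_prod => i _; mble.
rewrite EFinM; apply: lee_wpmul2l => //.
rewrite (@integral_iid_prod _ mR R (@gauss R) n (fun=> fun z => expR (1 / 2 * z ^+ 2 / 2)) (fun=> (Num.sqrt (1 - 1 / 2))^-1)).
- by rewrite prodr_const card_ord.
- by move=> i; mble.
- by move=> i z; exact: expR_ge0.
- by move=> i; exact: gauss_sqr_mgf.
Qed.

End gauss_dot.

Section gaussian_deviation.
Variables (R : realType) (n : nat).
Notation mR := (measurableTypeR R).
Notation gaussn := (iid (@gauss R)).
Variables (H : n.-tuple mR -> mR) (v : n.-tuple mR -> n.-tuple mR) (C : R).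
Hypotheses (mH : measurable_fun setT H) (mv : measurable_fun setT v) (C0 : 0 < C).
Hypothesis vC : forall y, dot (v y) (v y) <= C ^+ 2.
Hypothesis supp : forall y w, H y + (dot (v y) w - dot (v y) y) <= H w.

(** The bound that [supp] gives on the decrease of H when z.1 moves to c z.1 + s z.2. *)
Let X (c s : R) (z : n.-tuple mR * n.-tuple mR) := (1 - c) * dot (v z.1) z.1 - s * dot (v z.1) z.2.

Let mX c s : measurable_fun setT (X c s).
Proof. by rewrite /X; mble. Qed.

Let M : R := 4 * (Num.sqrt (1 - 1 / 2))^-1 ^+ n.

Lemma rotation_step_sqr_le delta : 0 <= delta <= pi ->
  (\int[gaussn n]_x \int[gaussn n]_y (X (cos delta) (sin delta) (x, y) ^+ 2)%:E <=
   (delta ^+ 2 * C ^+ 2 * (delta ^+ 2 * M / 2 + 16))%:E)%E.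
Proof.
move=> dpi; have h1 := one_sub_cos_sqr_le dpi; have h2 := sin_sqr_le dpi.
pose A := delta ^+ 4 * C ^+ 2 / 2.
have A0 : 0 <= A by rewrite /A divr_ge0// mulr_ge0 ?sqr_ge0// exprn_even_ge0.
have pt x y : X (cos delta) (sin delta) (x, y) ^+ 2 <= A * dot x x + 2 * delta ^+ 2 * dot (v x) y ^+ 2.
  rewrite /X /=.
  have a1 : ((1 - cos delta) * dot (v x) x - sin delta * dot (v x) y) ^+ 2 <=
     2 * ((1 - cos delta) ^+ 2 * dot (v x) x ^+ 2) + 2 * (sin delta ^+ 2 * dot (v x) y ^+ 2).
    rewrite -!exprMn; set a := (1 - cos delta) * _; set b := sin delta * _.
    by have := sqr_ge0 (a + b); rewrite -subr_ge0 => h; rewrite -subr_ge0 (_ : _ - _ = (a + b) ^+ 2 - 0)//; ring.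
  apply: (le_trans a1); apply: lerD; last first.
    by rewrite -mulrA ler_pM2l// ler_wpM2r ?sqr_ge0.
  have -> : A * dot x x = 2 * ((delta ^+ 2 / 2) ^+ 2 * (C ^+ 2 * dot x x)) by rewrite /A; field.
  rewrite ler_pM2l//; apply: ler_pM; [exact: sqr_ge0|exact: sqr_ge0|exact: h1|].
  by apply: (le_trans (dot_cauchy_schwarz _ _)); rewrite ler_wpM2r ?dot_ge0.
have inner x : (\int[gaussn n]_y (X (cos delta) (sin delta) (x, y) ^+ 2)%:E <= (A * dot x x + 16 * delta ^+ 2 * C ^+ 2)%:E)%E.
  apply: (@le_trans _ _ (\int[gaussn n]_y ((A * dot x x)%:E + (2 * delta ^+ 2)%:E * (dot (v x) y ^+ 2)%:E))%E).
    apply: ge0_le_integral; [exact: measurableT| | | |].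
    - by move=> y _; rewrite lee_fin sqr_ge0.
    - apply/measurable_EFinP; apply: measurable_funX.
      exact: (measurableT_comp (mX _ _) (pair1_measurable x)).
    - apply: emeasurable_funD; first exact: measurable_cst.
      by apply: emeasurable_funM; [exact: measurable_cst|mble].
    - by move=> y _; rewrite -EFinM -EFinD lee_fin.
  rewrite ge0_integralD//; first last.
  - by apply: emeasurable_funM; [exact: measurable_cst|mble].
  - by move=> y _; rewrite -EFinM lee_fin mulr_ge0 ?sqr_ge0// mulr_ge0 ?sqr_ge0.
  - by move=> y _; rewrite lee_fin mulr_ge0 ?dot_ge0.
  rewrite integral_prob_cst ge0_integralZl//; first last.
  - by rewrite lee_fin mulr_ge0 ?sqr_ge0.
  - by move=> y _; rewrite lee_fin sqr_ge0.
  - by mble.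
  rewrite [leRHS]EFinD; apply: leeD => //.
  apply: (@le_trans _ _ ((2 * delta ^+ 2)%:E * (8 * C ^+ 2)%:E)%E).
    by apply: lee_wpmul2l; [rewrite lee_fin mulr_ge0 ?sqr_ge0|exact: integral_dot_sqr_le].
  by rewrite -EFinM lee_fin le_eqVlt; apply/orP; left; apply/eqP; ring.
apply: (@le_trans _ _ (\int[gaussn n]_x ((16 * delta ^+ 2 * C ^+ 2)%:E + A%:E * (dot x x)%:E))%E).
  apply: ge0_le_integral; [exact: measurableT| | | |].
  - by move=> x _; apply: integral_ge0 => y _; rewrite lee_fin sqr_ge0.
  - apply: (measurable_fun_fubini_tonelli_F (fun z : n.-tuple mR * n.-tuple mR => (X (cos delta) (sin delta) (z.1, z.2) ^+ 2)%:E)) => [|z]; last by rewrite lee_fin sqr_ge0.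
    by apply/measurable_EFinP; apply: measurable_funX; apply: (eq_measurable_fun _ _ (mX (cos delta) (sin delta))) => -[].
  - apply: emeasurable_funD; first exact: measurable_cst.
    by apply: emeasurable_funM; [exact: measurable_cst|mble].
  - by move=> x _; rewrite -EFinM -EFinD addrC; exact: inner.
rewrite ge0_integralD//; first last.
- by apply: emeasurable_funM; [exact: measurable_cst|mble].
- by move=> y _; rewrite -EFinM lee_fin mulr_ge0 ?dot_ge0.
- by move=> y _; rewrite lee_fin; pos.
rewrite integral_prob_cst ge0_integralZl//; first last.
- by move=> y _; rewrite lee_fin dot_ge0.
- by mble.
apply: (@le_trans _ _ ((16 * delta ^+ 2 * C ^+ 2)%:E + A%:E * M%:E)%E).
  by apply: leeD => //; apply: lee_wpmul2l; [rewrite lee_fin|exact: integral_dot_self_le].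
by rewrite -EFinM -EFinD lee_fin le_eqVlt; apply/orP; left; apply/eqP; rewrite /A; field.
Qed.

Lemma lin_lin c s c' s' (x y : n.-tuple mR) :
  lin c' s' (lin c s x y) (lin c (- s) y x) = lin (c * c' - s * s') (s * c' + c * s') x y.
Proof. by apply: eq_from_tnth => k; rewrite !tnth_lin; ring. Qed.

Lemma rotation_telescope K' delta (x y : n.-tuple mR) : K'%:R * delta = pi / 2 ->
  H x - H y <= \sum_(k < K') X (cos delta) (sin delta)
    (lin (cos (k%:R * delta)) (sin (k%:R * delta)) x y, lin (cos (k%:R * delta)) (- sin (k%:R * delta)) y x).
Proof.
move=> Kd; pose p k := lin (cos (k%:R * delta)) (sin (k%:R * delta)) x y.
have p0 : p 0 = x by apply: eq_from_tnth => i; rewrite tnth_lin mul0r cos0 sin0; ring.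
have pK : p K' = y.
  apply: eq_from_tnth => i; rewrite tnth_lin.
  by rewrite Kd cos_pihalf sin_pihalf; ring.
rewrite -{1}p0 -{1}pK.
have -> : H (p 0) - H (p K') = \sum_(k < K') (H (p k) - H (p k.+1)).
  clear; elim: K' => [|m IH]; first by rewrite big_ord0 subrr.
  by rewrite big_ord_recr /= -IH; ring.
apply: ler_sum => k _.
have := supp (p k) (p k.+1).
have -> : p k.+1 = lin (cos delta) (sin delta) (p k) (lin (cos (k%:R * delta)) (- sin (k%:R * delta)) y x).
  by rewrite /p lin_lin -natr1 mulrDl mul1r cosD sinD.
rewrite dot_linr /X /= -/(p k); lra.
Qed.

(* Turn Y into an independent copy Y' by K' rotations of angle delta. Each step costs
   at most (1 - cos delta) |v . Y_k| + sin delta |v . Y'_k|: the second term is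
   dimension free, and the first one is O(delta ^+ 2), hence negligible for K' large. *)
Lemma gaussian_deviation a t : 0 < t ->
  ((t ^+ 2)%:E * (gaussn n [set y | (a <= H y)%R] * gaussn n [set y | (H y < a - t)%R]) <= (68 * C ^+ 2)%:E)%E.
Proof.
move=> t0.
set A1 := [set y | _]; set A2 := [set y | _].
have mA1 : measurable A1.
  have := measurable_fun_ler (measurable_cst a) mH.
  by move=> /(_ measurableT [set true] I); rewrite setTI.
have mA2 : measurable A2.
  have := measurable_fun_ltr mH (measurable_cst (a - t)).
  by move=> /(_ measurableT [set true] I); rewrite setTI.
have M0 : 0 <= M by rewrite /M mulr_ge0// exprn_ge0// invr_ge0 sqrtr_ge0.
(* K' >= 2 M and K' delta = pi / 2 <= 2 give delta ^+ 2 M / 2 <= 1, so the term that depends on n is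
   at most 1 next to 16; the final constant is 4 * 17 = 68. *)
pose K' := (Num.truncn (2 * M)).+1.
have KR : 0 < K'%:R :> R by rewrite ltr0n.
have K1 : 1 <= K'%:R :> R by rewrite ler1n.
have KM : 2 * M <= K'%:R by apply: ltW; exact: truncnS_gt.
pose delta : R := pi / 2 / K'%:R.
have p2 := pihalf_02 R.
have d0 : 0 < delta by rewrite divr_gt0//; case/andP: p2.
have Kd : K'%:R * delta = pi / 2 by rewrite /delta mulrC divfK// gt_eqF.
have dpi : 0 <= delta <= pi.
  rewrite ltW//=; have : 1 * delta <= K'%:R * delta by rewrite ler_wpM2r// ltW.
  by rewrite Kd; have := @pi_gt0 R; lra.
pose B := delta ^+ 2 * C ^+ 2 * (delta ^+ 2 * M / 2 + 16).
have KB : K'%:R * (K'%:R * B) <= 68 * C ^+ 2.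
  have -> : K'%:R * (K'%:R * B) = (K'%:R * delta) ^+ 2 * (C ^+ 2 * (delta ^+ 2 * M / 2 + 16)) by rewrite /B; ring.
  have q1 : (K'%:R * delta) ^+ 2 <= 4.
    by rewrite Kd (_ : 4 = 2 ^+ 2); [rewrite lerXn2r ?nnegrE//; case/andP: p2 => *; exact: ltW|ring].
  have q2 : delta ^+ 2 * M / 2 <= 1.
    have : delta ^+ 2 * (2 * M) <= delta ^+ 2 * K'%:R by rewrite ler_wpM2l ?sqr_ge0.
    have : delta ^+ 2 * K'%:R <= (K'%:R * delta) ^+ 2.
      have -> : (K'%:R * delta) ^+ 2 = delta ^+ 2 * (K'%:R * K'%:R) by ring.
      by apply: ler_wpM2l; [exact: sqr_ge0|apply: ler_peMr => //; exact: ltW].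
    move=> h h'; have : delta ^+ 2 * (2 * M) <= 4 by apply: (le_trans h'); exact: (le_trans h).
    by rewrite (_ : delta ^+ 2 * (2 * M) = 4 * (delta ^+ 2 * M / 2)); [move=> ?; lra|field].
  have -> : 68 * C ^+ 2 = 4 * (C ^+ 2 * 17) by ring.
  apply: ler_pM => //; first exact: sqr_ge0.
    by rewrite mulr_ge0 ?sqr_ge0// addr_ge0// divr_ge0// mulr_ge0// sqr_ge0.
  by rewrite ler_wpM2l ?sqr_ge0//; lra.
pose c k := cos (k%:R * delta); pose s k := sin (k%:R * delta).
pose Y k (z : n.-tuple mR * n.-tuple mR) := (lin (c k) (s k) z.1 z.2, lin (c k) (- s k) z.2 z.1).
pose G z := X (cos delta) (sin delta) z ^+ 2.
have mG : measurable_fun setT G by apply: measurable_funX; exact: mX.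
have G0 z : 0 <= G z by exact: sqr_ge0.
have mY k : measurable_fun setT (Y k) by rewrite /Y; mble.
have rot k : (k < K')%N -> (\int[gaussn n]_x \int[gaussn n]_y (G (Y k (x, y)))%:E <= B%:E)%E.
  move=> kK; have cs : c k ^+ 2 + s k ^+ 2 = 1 by exact: cos2Dsin2.
  have ck : 0 < c k.
    apply: cos_gt0_pihalf.
    have k1 : 0 <= k%:R * delta by rewrite mulr_ge0// ltW.
    have k2 : k%:R * delta < pi / 2 by rewrite -Kd ltr_pM2r// ltr_nat.
    by rewrite k2 andbT; apply: lt_le_trans k1; rewrite oppr_lt0; case/andP: p2.
  have := @gaussn_rotation R n (c k) (s k) (fun z => (G z)%:E) cs ck.
  rewrite /Y /= => ->; first exact: (rotation_step_sqr_le dpi).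
  - exact/measurable_EFinP.
  - by move=> z; rewrite lee_fin.
pose PP : probability _ R := (gaussn n \x gaussn n)%E.
have mGY k : measurable_fun setT (fun z : n.-tuple mR * n.-tuple mR => G (Y k z)) by exact: (measurableT_comp mG (mY k)).
have sumle : (\int[PP]_z (\sum_(k <- iota 0 K') G (Y k z))%:E <= ((size (iota 0 K'))%:R * B)%:E)%E.
  apply: (integral_sum_le (F := fun k z => G (Y k z))) => [k|k z|k]; [exact: mGY|exact: G0|].
  rewrite mem_iota add0n => /andP[_ kK].
  rewrite -(integral2E (gaussn n) (gaussn n) (F := fun x y => G (Y k (x, y)))); [exact: rot| |by []].
  by apply: (eq_measurable_fun _ _ (mGY k)) => -[].
rewrite size_iota in sumle.
have ind0 (A : set (n.-tuple mR)) x : 0 <= (\1_A x : R) by rewrite indicE.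
have prodE : (gaussn n A1 * gaussn n A2 = \int[PP]_z (\1_A1 z.1 * \1_A2 z.2)%:E)%E.
  rewrite -(integral2E _ _ (F := fun x y => \1_A1 x * \1_A2 y)); first last.
  - by move=> x y; rewrite mulr_ge0.
  - by apply: measurable_funM; (apply: measurableT_comp; first exact: measurable_indic) => //.
  transitivity (\int[gaussn n]_x ((\1_A1 x)%:E * gaussn n A2))%E.
    by rewrite ge0_integralZr// ?integral_indic ?setIT//; apply/measurable_EFinP; exact: measurable_indic.
  apply: eq_integral => x _; under eq_integral do rewrite EFinM.
  rewrite ge0_integralZl// ?integral_indic ?setIT//; by apply/measurable_EFinP; exact: measurable_indic.
rewrite prodE.
have mI : measurable_fun setT (fun z : n.-tuple mR * n.-tuple mR => \1_A1 z.1 * \1_A2 z.2 : R).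
  by apply: measurable_funM; (apply: measurableT_comp; first exact: measurable_indic) => //.
rewrite -ge0_integralZl//; first last.
- by rewrite lee_fin sqr_ge0.
- exact/measurable_EFinP.
apply: (@le_trans _ _ (K'%:R%:E * \int[PP]_z (\sum_(k <- iota 0 K') G (Y k z))%:E)%E); last first.
  apply: (@le_trans _ _ (K'%:R%:E * (K'%:R * B)%:E)%E); first by apply: lee_wpmul2l.
  by rewrite -EFinM lee_fin.
have mS : measurable_fun setT (fun z => \sum_(k <- iota 0 K') G (Y k z)) by exact: measurable_sum.
rewrite -ge0_integralZl//; first last.
- by move=> z _; rewrite lee_fin sumr_ge0.
- exact/measurable_EFinP.
apply: ge0_le_integral; [exact: measurableT| | | |].
- by move=> z _; rewrite -EFinM lee_fin; apply: mulr_ge0; [exact: sqr_ge0|exact: mulr_ge0].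
- by apply: emeasurable_funM; [exact: measurable_cst|exact/measurable_EFinP].
- by apply: emeasurable_funM; [exact: measurable_cst|exact/measurable_EFinP].
- move=> [x y] _ /=; rewrite -!EFinM lee_fin !indicE.
  have S0 : 0 <= K'%:R * \sum_(k <- iota 0 K') G (Y k (x, y)) by rewrite mulr_ge0// sumr_ge0.
  have [/set_mem xA|_] := boolP (x \in A1); last by rewrite mul0r mulr0.
  have [/set_mem yA|_] := boolP (y \in A2); last by rewrite mulr0 mulr0.
  rewrite !mulr1.
  have -> : \sum_(k <- iota 0 K') G (Y k (x, y)) = \sum_(k < K') G (Y k (x, y)).
    by rewrite -(big_mkord xpredT (fun k => G (Y k (x, y)))) /index_iota subn0.
  apply: le_trans (sqr_sum_le _).
  have h := rotation_telescope x y Kd.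
  have tH : t <= H x - H y.
    by rewrite lerBrDl; apply: le_trans xA; rewrite -lerBrDr; exact: ltW.
  have {}h := le_trans tH h.
  by rewrite lerXn2r ?nnegrE ?(ltW t0)// (le_trans (ltW t0)).
Qed.

End gaussian_deviation.

(** * Soft maximum of finitely many affine functions *)

Section softmax.
Variables (R : realType) (n : nat) (I : finType) (i0 : I).
Notation mR := (measurableTypeR R).
Variables (b : I -> R) (w : I -> n.-tuple mR) (C : R).
Hypothesis wC : forall i, dot (w i) (w i) <= C ^+ 2.

Definition plane i (y : n.-tuple mR) : R := b i + dot (w i) y.

Local Notation beta := (#|I|%:R : R).

Definition plane_sum y : R := \sum_i expR (beta * plane i y).

(** With the number of planes as inverse temperature, the excess over the maximum is at most ln #|I|
    / #|I|, hence at most 1 however many planes there are. Unlike the maximum it has an explicit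
    measurable gradient, a convex combination of the slopes. *)
Definition softmax (y : n.-tuple mR) : mR := beta^-1 * ln (plane_sum y).

Definition softweight y i : R := expR (beta * plane i y) / plane_sum y.

Definition softgrad (y : n.-tuple mR) : n.-tuple mR :=
  [tuple \sum_i softweight y i * tnth (w i) k | k < n].

Let beta0 : 0 < beta. Proof. by rewrite ltr0n; apply/card_gt0P; exists i0. Qed.

Lemma plane_sum_ge i y : expR (beta * plane i y) <= plane_sum y.
Proof. by rewrite /plane_sum (bigD1 i)//= lerDl sumr_ge0// => j _; exact: expR_ge0. Qed.

Lemma plane_sum_gt0 y : 0 < plane_sum y.
Proof. exact: lt_le_trans (expR_gt0 _) (plane_sum_ge i0 y). Qed.

Lemma softmax_ge i y : plane i y <= softmax y.
Proof.
rewrite /softmax ler_pdivlMl// -[leLHS]expRK ler_ln ?posrE ?expR_gt0 ?plane_sum_gt0//.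
exact: plane_sum_ge.
Qed.

Lemma softmax_le y c : (forall i, plane i y <= c) -> softmax y <= c + 1.
Proof.
move=> h; rewrite /softmax ler_pdivrMl// mulrDr mulr1.
rewrite -ler_expR lnK ?posrE ?plane_sum_gt0// expRD.
apply: (@le_trans _ _ (\sum_(i : I) expR (beta * c))).
  by apply: ler_sum => i _; rewrite ler_expR ler_pM2l.
rewrite sumr_const -[leLHS]mulr_natr; apply: ler_wpM2l; first exact: expR_ge0.
by have := expR_ge1Dx beta; lra.
Qed.

Lemma softweight_ge0 y i : 0 <= softweight y i.
Proof. by rewrite divr_ge0 ?expR_ge0// ltW// plane_sum_gt0. Qed.

Lemma sum_softweight y : \sum_i softweight y i = 1.
Proof. by rewrite -mulr_suml divff// gt_eqF// plane_sum_gt0. Qed.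

Lemma dot_softgrad y z : dot (softgrad y) z = \sum_i softweight y i * dot (w i) z.
Proof.
rewrite /dot; under eq_bigr do rewrite tnth_mktuple mulr_suml.
rewrite exchange_big /=; apply: eq_bigr => i _; rewrite mulr_sumr; apply: eq_bigr => k _.
by rewrite mulrA.
Qed.

Lemma softgrad_le y : dot (softgrad y) (softgrad y) <= C ^+ 2.
Proof.
set V := softgrad y.
have : dot V V <= \sum_i softweight y i * ((C ^+ 2 + dot V V) / 2).
  rewrite [leLHS]dot_softgrad; apply: ler_sum => i _; apply: ler_wpM2l; first exact: softweight_ge0.
  by apply: (le_trans (dot_amgm _ _)); rewrite ler_pM2r// lerD2r.
by rewrite -mulr_suml sum_softweight mul1r; lra.
Qed.

(** Convexity of log-sum-exp: the ratio of the two sums is a [softweight] mean of exponentials, each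
    bounded below by the tangent line of exp at the mean exponent beta * m. *)
Lemma softmax_supp y z : softmax y + (dot (softgrad y) z - dot (softgrad y) y) <= softmax z.
Proof.
set m := dot (softgrad y) z - dot (softgrad y) y.
rewrite /softmax -lerBrDl -mulrBr ler_pdivlMl// -ln_div ?posrE ?plane_sum_gt0//.
rewrite -ler_expR lnK ?posrE ?divr_gt0 ?plane_sum_gt0//.
have -> : plane_sum z / plane_sum y = \sum_i softweight y i * expR (beta * (dot (w i) z - dot (w i) y)).
  rewrite /plane_sum mulr_suml; apply: eq_bigr => i _.
  rewrite /softweight mulrAC -expRD; congr (expR _ / _); rewrite /plane; ring.
apply: (@le_trans _ _ (\sum_i softweight y i * (expR (beta * m) * (1 + (beta * (dot (w i) z - dot (w i) y) - beta * m))))).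
  rewrite le_eqVlt; apply/orP; left; apply/eqP.
  transitivity (expR (beta * m) * ((1 - beta * m) * (\sum_i softweight y i) + beta * (\sum_i softweight y i * dot (w i) z - \sum_i softweight y i * dot (w i) y))).
    by rewrite sum_softweight -!dot_softgrad -/m; ring.
  rewrite mulr_sumr -sumrB mulr_sumr -big_split mulr_sumr; apply: eq_bigr => i _ /=; ring.
apply: ler_sum => i _; apply: ler_wpM2l; first exact: softweight_ge0.
set t := beta * (dot (w i) z - dot (w i) y).
apply: (@le_trans _ _ (expR (beta * m) * expR (t - beta * m))); last by rewrite -expRD subrKC.
by rewrite ler_wpM2l ?expR_ge0// expR_ge1Dx.
Qed.

Let mplane i : measurable_fun setT (fun y => plane i y : mR).
Proof. by rewrite /plane; mble. Qed.

Let mexp i : measurable_fun setT (fun y => expR (beta * plane i y) : mR).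
Proof. by have mp := @mplane i; mble. Qed.

Let msum : measurable_fun setT (plane_sum : n.-tuple mR -> mR).
Proof. by apply: measurable_sum. Qed.

Lemma measurable_softmax : measurable_fun setT softmax.
Proof.
apply: measurable_funM; first exact: measurable_cst.
exact: (measurableT_comp (@measurable_ln _)).
Qed.

Lemma measurable_softgrad : measurable_fun setT softgrad.
Proof.
apply/measurable_fun_tnthP => k.
apply: (eq_measurable_fun (fun y => \sum_i expR (beta * plane i y) * expR (- ln (plane_sum y)) * tnth (w i) k)).
  move=> y _ /=; rewrite tnth_mktuple; apply: eq_bigr => i _.
  by rewrite expRN lnK ?posrE ?plane_sum_gt0.
apply: measurable_sum => i; apply: measurable_funM; last exact: measurable_cst.
have ml : measurable_fun setT (fun y => ln (plane_sum y) : mR) by exact: (measurableT_comp (@measurable_ln _)).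
by apply: measurable_funM; [exact: mexp|mble].
Qed.

End softmax.

Section lower_tail.
Variables (R : realType) (n : nat).
Notation mR := (measurableTypeR R).
Notation gaussn := (iid (@gauss R)).
Variables (l : n.-tuple mR -> mR) (v : n.-tuple mR -> n.-tuple mR) (B : set (n.-tuple mR)) (a C : R).
Hypotheses (ml : measurable_fun setT l) (mB : measurable B) (C0 : 0 < C).
Hypothesis lB : forall y, B y -> a <= l y.
Hypothesis vB : forall y, B y -> dot (v y) (v y) <= C ^+ 2.
Hypothesis supp : forall y z, B y -> l y + (dot (v y) z - dot (v y) y) <= l z.

(** Labels the cells of side s of a box by a finite type, which will index the planes of
    [softmax]. *)
Lemma box_net r s : 0 < s -> exists (J : nat) (q : n.-tuple mR -> {ffun 'I_n -> 'I_J.+1}),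
  forall y z, (forall k, `|tnth y k| <= r) -> (forall k, `|tnth z k| <= r) -> q y = q z ->
  forall k, `|tnth y k - tnth z k| <= s.
Proof.
move=> s0; pose J := Num.truncn (2 * r / s).
exists J, (fun y => [ffun k => inord (Num.truncn ((tnth y k + r) / s))]) => y z yr zr qyz k.
have key x : `|x| <= r -> (Num.truncn ((x + r) / s) < J.+1)%N /\ (Num.truncn ((x + r) / s))%:R * s <= x + r < ((Num.truncn ((x + r) / s))%:R + 1) * s.
  move=> /ler_normlP[x1 x2]; have p : 0 <= (x + r) / s by rewrite divr_ge0 ?(ltW s0)//; lra.
  split; first by rewrite ltnS; apply: le_truncn; rewrite ler_pM2r ?invr_gt0//; lra.
  have /andP[h1 h2] := truncn_itv p.
  by rewrite -ler_pdivlMr// h1 -ltr_pdivrMr// natr1.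
have [y1 y2] := key _ (yr k); have [z1 z2] := key _ (zr k).
have := congr1 (fun g : {ffun _ -> _} => nat_of_ord (g k)) qyz; rewrite !ffunE !inordK// => e.
rewrite e in y2; case/andP: y2 => ? ?; case/andP: z2 => ? ?.
by rewrite ler_norml; apply/andP; split; lra.
Qed.

(* l is minorised by the soft maximum of its tangent planes at one point of B in each
   cell of a fine grid, which has bounded gradient and is almost l on B. *)
Lemma lower_tail p t : 0 < p -> 0 < t -> (p%:E <= gaussn n B)%E ->
  (gaussn n [set y | (l y < a - 2 - t)%R] <= (136 * C ^+ 2 / (p * t ^+ 2))%:E)%E.
Proof.
move=> p0 t0 pB.
pose M : R := 4 * (Num.sqrt (1 - 1 / 2))^-1 ^+ n.
have Mp : 0 < M.
  have h : (0 : R) < 1 - 1 / 2 by lra.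
  by rewrite /M mulr_gt0// exprn_gt0// invr_gt0 sqrtr_gt0.
have M0 := ltW Mp.
(* Markov: the points outside the ball of radius r have probability at most M / r ^+ 2 <= p / 2, so
   at least half of the mass p of B stays inside. *)
pose r := 1 + 2 * M / p.
have r1 : 1 <= r by rewrite /r lerDl divr_ge0 ?mulr_ge0// ltW.
have rr : 2 * M / p <= r ^+ 2.
  have : r * 1 <= r * r by rewrite ler_wpM2l//; lra.
  by rewrite mulr1 -expr2 => h; apply: le_trans h; rewrite /r lerDr.
pose D := [set y : n.-tuple mR | r ^+ 2 < dot y y].
have mD : measurable D.
  have md : measurable_fun setT (fun y : n.-tuple mR => dot y y : mR) by mble.
  have := measurable_fun_ltr (measurable_cst (r ^+ 2)) md.
  by move=> /(_ measurableT [set true] I); rewrite setTI.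
have hD : (gaussn n D <= (p / 2)%:E)%E.
  have r20 : 0 < r ^+ 2 by rewrite exprn_gt0//; lra.
  have h : ((r ^+ 2)%:E * gaussn n D <= M%:E)%E.
    apply: le_trans (integral_dot_self_le R n).
    have -> : gaussn n D = (\int[gaussn n]_y (\1_D y)%:E)%E by rewrite integral_indic ?setIT.
    rewrite -ge0_integralZl//; first last.
    - by rewrite lee_fin sqr_ge0.
    - by apply/measurable_EFinP; exact: measurable_indic.
    apply: ge0_le_integral; [exact: measurableT| | | |].
    - by move=> y _; rewrite -EFinM lee_fin mulr_ge0 ?sqr_ge0// indicE.
    - by apply: emeasurable_funM; [exact: measurable_cst|apply/measurable_EFinP; exact: measurable_indic].
    - by mble.
    - move=> y _; rewrite -EFinM lee_fin indicE; case: (boolP (y \in D)) => [/set_mem yD|_].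
        by rewrite mulr1; exact: ltW.
      by rewrite mulr0 dot_ge0.
  have fD : (gaussn n D) \is a fin_num by exact: fin_num_measure.
  rewrite -(fineK fD) in h *; move: h; set x := fine _; rewrite -EFinM !lee_fin => h.
  have x0 : 0 <= x by exact: fine_ge0.
  have : 2 * M / p * x <= M by apply: le_trans h; rewrite ler_wpM2r.
  have -> : 2 * M / p * x = M * (2 * x / p) by ring.
  rewrite -{2}[M]mulr1 (ler_pM2l Mp) ler_pdivrMr// mul1r => xp.
  by rewrite ler_pdivlMr// mulrC.
have mBD : measurable (B `\` D) by exact: measurableD.
have hBD : ((p / 2)%:E <= gaussn n (B `\` D))%E.
  have h : (gaussn n B <= gaussn n (B `\` D) + gaussn n D)%E.
    apply: (@le_trans _ _ (gaussn n ((B `\` D) `|` D))); last exact: measureU2.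
    apply: le_measure; rewrite ?inE//; first exact: measurableU.
    by move=> y By; have [yD|yD] := pselect (D y); [right|left].
  have fD : (gaussn n D) \is a fin_num by exact: fin_num_measure.
  have fB : (gaussn n (B `\` D)) \is a fin_num by exact: fin_num_measure.
  have := le_trans pB h; move: hD.
  rewrite -(fineK fD) -(fineK fB) -EFinD !lee_fin; lra.
have [b0 Bb0] : exists b0, B b0.
  apply: contrapT => nB; have B0 : B = set0 by apply/seteqP; split => // y By; apply: nB; exists y.
  by move: pB; rewrite B0 measure0 lee_fin leNgt p0.
(* Two points of a cell differ by at most s in each coordinate, hence a plane of slope at most C
   varies between them by at most C s sqrt n <= 1. *)
pose s : R := (C * n.+1%:R)^-1.
have s0 : 0 < s by rewrite invr_gt0 mulr_gt0.
have [J [q hq]] := box_net r s0.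
(* A cell that misses the bounded part of B receives b0, which lies in B: its tangent plane is still
   below l with slope at most C. *)
pose pt i := if pselect (exists y, (B `\` D) y /\ q y = i) is left e then projT1 (cid e) else b0.
have ptB i : B (pt i).
  by rewrite /pt; case: pselect => // e; case: (cid e) => y /= [[]].
pose H := softmax (fun i => l (pt i) - dot (v (pt i)) (pt i)) (fun i => v (pt i)).
pose G := softgrad (fun i => l (pt i) - dot (v (pt i)) (pt i)) (fun i => v (pt i)).
have wC i : dot (v (pt i)) (v (pt i)) <= C ^+ 2 by exact: vB.
(* The level a - 1 allows for the oscillation within a cell. The further unit in a - 2 - t comes
   from the excess of the soft maximum over l. *)
have := gaussian_deviation (measurable_softmax _ _) (measurable_softgrad (q b0) _ _) C0 (softgrad_le (q b0) _ wC) (softmax_supp (q b0) _ _) (a - 1) t0.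
move=> /(_ (fun i => l (pt i) - dot (v (pt i)) (pt i))); rewrite -/H => dev.
have Hl y : H y <= l y + 1.
  apply: (softmax_le (q b0)) => i; rewrite /plane.
  by have := supp y (ptB i); lra.
have HB y : (B `\` D) y -> a - 1 <= H y.
  move=> [By yD]; apply: le_trans (softmax_ge (q b0) _ _ (q y) y).
  have [[Bz zD] qz] : (B `\` D) (pt (q y)) /\ q (pt (q y)) = q y.
    rewrite /pt; case: pselect => [e|[]]; first by case: (cid e).
    by exists y.
  have box x : ~ D x -> forall k, `|tnth x k| <= r.
    move=> xD k; rewrite -(ler_pXn2r (ltn0Sn 1)) ?nnegrE//; last by lra.
    rewrite real_normK ?num_real//; apply: (@le_trans _ _ (dot x x)); last by rewrite leNgt; apply/negP.
    by rewrite /dot (bigD1 k)//= expr2 lerDl sumr_ge0// => j _; rewrite -expr2 sqr_ge0.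
  have hd := hq _ _ (box _ yD) (box _ zD) (esym qz).
  rewrite /plane.
  set z := pt (q y) in Bz zD hd *.
  pose w := lin 1 (-1) y z.
  have ww : dot w w <= n%:R * s ^+ 2.
    apply: (@le_trans _ _ (\sum_(k < n) s ^+ 2)); last by rewrite sumr_const card_ord mulr_natl.
    apply: ler_sum => k _; rewrite -expr2 tnth_lin mul1r mulN1r -real_normK ?num_real//.
    by rewrite lerXn2r ?nnegrE// ?hd// ltW.
  have cs := dot_cauchy_schwarz (v z) w.
  have vw : dot (v z) w ^+ 2 <= 1.
    apply: (le_trans cs); apply: (@le_trans _ _ (C ^+ 2 * (n%:R * s ^+ 2))).
      by apply: ler_pM; rewrite ?dot_ge0// vB.
    have -> : C ^+ 2 * (n%:R * s ^+ 2) = n%:R / n.+1%:R ^+ 2.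
      have : 0 < n.+1%:R :> R by [].
      by rewrite /s; set m := n.+1%:R; move: m => m m0; field; rewrite !gt_eqF.
    rewrite ler_pdivrMr ?exprn_gt0// mul1r -natrX ler_nat.
    by rewrite (leq_trans (leqnSn n))// -{1}[n.+1]expn1 leq_pexp2l.
  have : `|dot (v z) w| <= 1.
    by rewrite -(ler_pXn2r (ltn0Sn 1)) ?nnegrE// real_normK ?num_real// expr1n.
  rewrite /w dot_linr => /ler_normlP[h1 h2].
  by have := lB Bz; lra.
set E := [set y | _].
have mE : measurable E.
  have := measurable_fun_ltr ml (measurable_cst (a - 2 - t)).
  by move=> /(_ measurableT [set true] I); rewrite setTI.
have mH : measurable_fun setT H by exact: measurable_softmax.
have m1 : measurable [set y | a - 1 <= H y].
  have := measurable_fun_ler (measurable_cst (a - 1)) mH.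
  by move=> /(_ measurableT [set true] I); rewrite setTI.
have m2 : measurable [set y | H y < a - 1 - t].
  have := measurable_fun_ltr mH (measurable_cst (a - 1 - t)).
  by move=> /(_ measurableT [set true] I); rewrite setTI.
have : ((t ^+ 2)%:E * ((p / 2)%:E * gaussn n E) <= (68 * C ^+ 2)%:E)%E.
  apply: le_trans dev; apply: lee_wpmul2l; first by rewrite lee_fin sqr_ge0.
  apply: lee_pmul => //; first by rewrite lee_fin divr_ge0// ltW.
    by apply: (le_trans hBD); apply: le_measure; rewrite ?inE.
  apply: le_measure; rewrite ?inE// => y; rewrite /E /=.
  by have := Hl y; lra.
have fE : (gaussn n E) \is a fin_num by exact: fin_num_measure.
rewrite -(fineK fE) -!EFinM !lee_fin; set x := fine _ => h.
rewrite ler_pdivlMr ?mulr_gt0 ?exprn_gt0//; lra.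
Qed.

End lower_tail.

(** * The posterior mean as the gradient of the log-likelihood *)

Section posterior_mean.
Context d (X : measurableType d) (R : realType) (mu : probability X R).
Notation mR := (measurableTypeR R).
Variables (n : nat) (u : X -> n.-tuple mR) (c : R).
Hypotheses (mu_u : measurable_fun setT u) (uc : forall x, dot (u x) (u x) <= c).

Local Notation L := (part mu (fun=> 1) u).

Definition posterior_mean (W : n.-tuple mR) : n.-tuple mR :=
  [tuple (\int[mu]_x (wt (u x) W * tnth (u x) k)) / L W | k < n].

Let L0 W : 0 < L W. Proof. exact: part1_gt0 uc. Qed.

Let iw W : itg mu (fun x => wt (u x) W).
Proof.
have := itg_part (fun=> ler01 : 0 <= (1 : R)) (itg_cst mu 1) mu_u W.
by under eq_fun do rewrite mul1r.
Qed.

Let iwk W k : itg mu (fun x => wt (u x) W * tnth (u x) k).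
Proof.
apply: (itg_le (g := fun x => (1 + c) * wt (u x) W)); [by mble| |exact: itgZ].
move=> x; rewrite normrM (ger0_norm (wt_ge0 _ _)) mulrC ler_wpM2r ?wt_ge0//.
have : tnth (u x) k ^+ 2 <= c.
  apply: le_trans (uc x); rewrite /dot (bigD1 k)//= expr2 lerDl sumr_ge0// => j _.
  by rewrite -expr2 sqr_ge0.
rewrite -[tnth (u x) k ^+ 2]real_normK ?num_real//; set z := `|_|.
by have := sqr_ge0 (z - 1); have := sqr_ge0 z; lra.
Qed.

Lemma itg_wt_dot W h : itg mu (fun x => wt (u x) W * dot (u x) h).
Proof.
have := itg_sum (index_enum 'I_n) (fun k => itgZ (tnth h k) (@iwk W k)).
congr itg; apply/funext => x; rewrite /dot mulr_sumr; apply: eq_bigr => k _; ring.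
Qed.

Lemma Rintegral_wt_dot W h : \int[mu]_x (wt (u x) W * dot (u x) h) = L W * dot (posterior_mean W) h.
Proof.
transitivity (\int[mu]_x \sum_(k < n) tnth h k * (wt (u x) W * tnth (u x) k)).
  by apply: eq_Rintegral => x _; rewrite /dot mulr_sumr; apply: eq_bigr => k _; ring.
rewrite Rintegral_sum; last by move=> k; exact: (itgZ _ (@iwk W k)).
rewrite /dot mulr_sumr; apply: eq_bigr => k _.
rewrite RintegralZl//; last exact: iwk.
by rewrite tnth_mktuple; field; rewrite gt_eqF.
Qed.

(** Jensen under the posterior: L Z / L W is the posterior mean at W of expR (dot (u x) Z - dot (u
    x) W), minorised by the tangent line of exp at the mean exponent m. It is the continuous
    analogue of [softmax_supp]. *)
Lemma ln_part_supp W Z :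
  ln (L W) + (dot (posterior_mean W) Z - dot (posterior_mean W) W) <= ln (L Z).
Proof.
set m := _ - dot _ W.
have Lp Y : L Y \is Num.pos by rewrite posrE.
have em : expR m \is Num.pos by rewrite posrE expR_gt0.
suff h : L W * expR m <= L Z.
  apply: (@le_trans _ _ (ln (L W * expR m))); first by rewrite (lnM (Lp W) em) expRK.
  by rewrite ler_ln ?posrE; [|apply: mulr_gt0; [exact: L0|exact: expR_gt0]|exact: L0].
have i3 := itg_lin3 0 (expR m * (1 - m)) (expR m) (- expR m) (iw W) (itg_wt_dot W Z) (itg_wt_dot W W).
have iZ := itg_part (fun=> ler01 : 0 <= (1 : R)) (itg_cst mu 1) mu_u Z.
have h := Rintegral_le i3 iZ _; apply: le_trans (h _).
  rewrite (Rintegral_lin3 0 (expR m * (1 - m)) (expR m) (- expR m) (iw W) (itg_wt_dot W Z) (itg_wt_dot W W)).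
  rewrite !Rintegral_wt_dot.
  have -> : \int[mu]_x wt (u x) W = L W by apply: eq_Rintegral => x _; rewrite mul1r.
  by rewrite le_eqVlt; apply/orP; left; apply/eqP; rewrite /m; ring.
move=> x; rewrite mul1r.
have -> : wt (u x) Z = wt (u x) W * (expR m * expR (dot (u x) Z - dot (u x) W - m)).
  by rewrite /wt -!expRD; congr expR; ring.
have := expR_ge1Dx (dot (u x) Z - dot (u x) W - m); set e := expR (_ - m) => he.
have -> : 0 + expR m * (1 - m) * wt (u x) W + expR m * (wt (u x) W * dot (u x) Z) + - expR m * (wt (u x) W * dot (u x) W)
  = wt (u x) W * (expR m * (1 + (dot (u x) Z - dot (u x) W - m))) by ring.
by rewrite ler_wpM2l ?wt_ge0// ler_wpM2l ?expR_ge0.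
Qed.

End posterior_mean.

(** * The null law is contiguous to the planted law *)

Section null_le_planted.
Context d (T : measurableType d) (R : realType) (P : probability T R).
Notation mR := (measurableTypeR R).
Notation gaussn := (iid (@gauss R)).
Variables (f : T -> mR) (K : R).
Hypotheses (mf : measurable_fun setT f) (fK : forall x, `|f x| <= K).
Variables (lam lam' : R).
Hypotheses (lam0 : 0 < lam).

Local Notation L N := (@likelihood _ T R P f lam N).
Local Notation spr N := (@pair_moment _ T R P f lam N (@spread R N)).
Local Notation pm N := (posterior_mean (iid P N) (@spike _ T R f lam N)).

(** The squared norm of a posterior mean is the mean of dot (u x) (u y) over two replicas, at most
    lam / (2 N) times their squared overlap. *)
Lemma posterior_mean_sqr_le N W : (0 < N)%N ->
  dot (pm N W) (pm N W) * L N W ^+ 2 <= lam / 2 * spr N W.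
Proof.
move=> N0; have NR : 0 < N%:R :> R by rewrite ltr0n.
set u := @spike _ T R f lam N.
have mu_u : measurable_fun setT u by exact: measurable_spike.
have uc x : dot (u x) (u x) <= lam / 2 * N%:R * K ^+ 4 by exact: (dot_spike_bound P fK lam0 N0).
have aq := admissible_sqr K N0; have aS := admissible_spread K N0.
have ip y : itg (iid P N) (fun x => (overlap f y x ^+ 2 / N%:R) * wt (u x) W).
  by apply: itg_part => //; [by case: aq|exact: (itg_admissible P mf fK aq)].
have inner y : dot (u y) (pm N W) * L N W <= lam / 2 * part (iid P N) (fun x => overlap f y x ^+ 2 / N%:R) u W.
  rewrite dotC mulrC -(Rintegral_wt_dot (iid P N) mu_u uc).
  rewrite /part -RintegralZl//; last exact: ip.
  apply: Rintegral_le; [exact: (itg_wt_dot _ mu_u uc)|exact: itgZ|].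
  move=> x; rewrite mulrA mulrC ler_wpM2r ?wt_ge0// dotC.
  apply: (le_trans (dot_spike_le P fK lam0 N0 _ _)).
  by rewrite le_eqVlt; apply/orP; left; apply/eqP; field; rewrite gt_eqF.
have -> : dot (pm N W) (pm N W) * L N W ^+ 2 = L N W * (L N W * dot (pm N W) (pm N W)) by ring.
rewrite -(Rintegral_wt_dot (iid P N) mu_u uc) -RintegralZl//; last exact: (itg_wt_dot _ mu_u uc).
apply: (@le_trans _ _ (lam / 2 * @pair_moment _ T R P f lam N (fun s => s ^+ 2 / N%:R) W)).
  rewrite /pair_moment -RintegralZl//; last exact: (itg_pair P mf fK lam aq).
  apply: Rintegral_le.
  - by apply: itgZ; exact: (itg_wt_dot _ mu_u uc).
  - by apply: itgZ; exact: (itg_pair P mf fK lam aq).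
  - move=> y; rewrite mulrCA [leRHS]mulrCA ler_wpM2l ?wt_ge0// mulrC; exact: inner.
apply: ler_wpM2l; first by rewrite divr_ge0// ltW.
rewrite -[leRHS]mul1r.
apply: (pair_moment_le P mf fK lam W aq aS) => s _.
by rewrite mul1r /spread lerDr.
Qed.

Hypotheses (f_mean : \int[P]_x f x = 0) (f_var : \int[P]_x (f x) ^+ 2 = 1).
Hypotheses (lam1 : lam < 1) (lamlam' : lam < lam').
Hypothesis free_energy_le : forall s, 0 <= s -> free_energy P f s <= s ^+ 4 / (4 * lam').

(** A is cut by the event L < dl. That event is rare under the null law by [lower_tail]; on the rest
    of A the null probability is at most the planted one divided by dl. *)
Lemma null_le_planted eta : 0 < eta -> exists2 delta, 0 < delta & exists N0, forall N, (N0 <= N)%N ->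
  forall A, measurable A -> (\int[gaussn #|edge N|]_W (L N W * \1_A W)%:E <= delta%:E)%E ->
  (gaussn #|edge N| A <= eta%:E)%E.
Proof.
move=> eta0.
have [s s0 [N0 H]] := typical_mass mf fK f_mean f_var lam0 lam1 lamlam' free_energy_le.
pose p := (4 * s)^-1; have p0 : 0 < p by rewrite invr_gt0 mulr_gt0.
(* On [typical], L ^+ 2 >= 1/16 and spr <= s ^+ 2 bound the squared gradient by 8 lam s ^+ 2; the
   added 1 gives C <= C ^+ 2, the form that [lower_tail] asks for. *)
pose C := 1 + 8 * lam * s ^+ 2.
have C1 : 1 <= C by rewrite lerDl mulr_ge0 ?sqr_ge0// mulr_ge0// ltW.
have C0 : 0 < C by exact: lt_le_trans C1.
(* As t >= 1, also t ^+ 2 >= 272 C ^+ 2 / (p eta), which brings the tail 136 C ^+ 2 / (p t ^+ 2)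
   below eta / 2. *)
pose t := 1 + 272 * C ^+ 2 / (p * eta).
have t1 : 1 <= t.
  rewrite lerDl; apply: divr_ge0; last by apply: ltW; exact: mulr_gt0.
  by apply: mulr_ge0; [exact: ler0n|exact: sqr_ge0].
have t0 : 0 < t by exact: lt_le_trans t1.
pose a : R := ln 4^-1.
pose dl := expR (a - 2 - t).
have dl0 : 0 < dl by exact: expR_gt0.
exists (dl * (eta / 2)); first by rewrite mulr_gt0// divr_gt0.
exists N0 => N /H[N2 mass] A mA hA.
have N0' : (0 < N)%N by exact: ltn_trans N2.
have Lp W : 0 < L N W by exact: (likelihood_gt0 P mf fK).
have mL := @measurable_likelihood _ T R P f mf lam N.
have mu_u := @measurable_spike _ T R f mf lam N.
have uc x : dot (spike f lam (N := N) x) (spike f lam x) <= lam / 2 * N%:R * K ^+ 4 by exact: (dot_spike_bound P fK lam0 N0').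
pose B := @typical _ T R P f lam N s.
have mB : measurable B by exact: (measurable_typical P K mf lam s N0').
have ml : measurable_fun setT (fun W => ln (L N W) : mR) by exact: (measurableT_comp (@measurable_ln _)).
have lB W : B W -> a <= ln (L N W).
  by move=> [h _]; rewrite ler_ln ?posrE ?invr_gt0.
have vB W : B W -> dot (pm N W) (pm N W) <= C ^+ 2.
  move=> [h hs]; have := posterior_mean_sqr_le W N0'; set v := dot _ _ => hv.
  have v0 : 0 <= v by exact: dot_ge0.
  have L4 : (4^-1) ^+ 2 <= L N W ^+ 2 by rewrite lerXn2r ?nnegrE ?invr_ge0// ltW.
  have h1 : v * (4^-1) ^+ 2 <= lam / 2 * s ^+ 2.
    apply: (le_trans (ler_wpM2l v0 L4)); apply: (le_trans hv); rewrite ler_wpM2l//.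
    by rewrite divr_ge0// ltW.
  have vC : v <= C.
    have e : v = 16 * (v * (4^-1) ^+ 2) by field.
    by rewrite e /C; move: h1; set z := v * _; lra.
  by apply: (le_trans vC); rewrite expr2 ler_peMr// ltW.
have tail := lower_tail ml mB C0 lB vB (fun W Z _ => ln_part_supp (iid P N) mu_u uc W Z) p0 t0 mass.
have hE : (gaussn #|edge N| [set W | (L N W < dl)%R] <= (eta / 2)%:E)%E.
  have -> : [set W | (L N W < dl)%R] = [set W | (ln (L N W) < a - 2 - t)%R].
    congr mkset; apply/funext => W; congr is_true.
    by rewrite -[RHS]ltr_expR lnK ?posrE.
  apply: (le_trans tail); rewrite lee_fin ler_pdivrMr ?mulr_gt0 ?exprn_gt0//.
  have : 272 * C ^+ 2 / (p * eta) <= t ^+ 2.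
    have : t * 1 <= t * t by rewrite ler_wpM2l// ltW.
    by rewrite mulr1 -expr2 => h; apply: le_trans h; rewrite /t lerDr.
  rewrite ler_pdivrMr ?mulr_gt0//; lra.
set E := [set W | _] in hE.
have mE : measurable E.
  have := measurable_fun_ltr mL (measurable_cst dl).
  by move=> /(_ measurableT [set true] I); rewrite setTI.
have hAE : (gaussn #|edge N| (A `\` E) <= (eta / 2)%:E)%E.
  have mAE : measurable (A `\` E) by exact: measurableD.
  have : (dl%:E * gaussn #|edge N| (A `\` E) <= (dl * (eta / 2))%:E)%E.
    apply: le_trans hA.
    have -> : gaussn #|edge N| (A `\` E) = (\int[gaussn #|edge N|]_y (\1_(A `\` E) y)%:E)%E by rewrite integral_indic ?setIT.
    rewrite -ge0_integralZl//; first last.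
    - by rewrite lee_fin ltW.
    - by apply/measurable_EFinP; exact: measurable_indic.
    apply: ge0_le_integral; [exact: measurableT| | | |].
    - by move=> W _; rewrite -EFinM lee_fin mulr_ge0 ?indicE// ltW.
    - by apply: emeasurable_funM; [exact: measurable_cst|apply/measurable_EFinP; exact: measurable_indic].
    - by apply/measurable_EFinP; apply: measurable_funM => //; exact: measurable_indic.
    - move=> W _; rewrite -EFinM lee_fin !indicE.
      case: (boolP (W \in A `\` E)) => [/set_mem[WA WE]|_].
        by rewrite mem_set// !mulr1 leNgt; apply/negP.
      by rewrite mulr0 mulr_ge0// ltW.
  have f1 : (gaussn #|edge N| (A `\` E)) \is a fin_num by exact: fin_num_measure.
  by rewrite -(fineK f1) -EFinM !lee_fin ler_pM2l.
have -> : eta%:E = ((eta / 2)%:E + (eta / 2)%:E)%E by rewrite -EFinD; congr EFin; field.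
apply: (@le_trans _ _ (gaussn #|edge N| ((A `\` E) `|` E))).
  apply: le_measure; rewrite ?inE//; first by apply: measurableU => //; exact: measurableD.
  by move=> W WA; have [WE|WE] := pselect (E W); [right|left].
apply: (@le_trans _ _ (gaussn #|edge N| (A `\` E) + gaussn #|edge N| E)%E).
  by apply: measureU2 => //; exact: measurableD.
exact: leeD.
Qed.

End null_le_planted.

(** * Contiguity *)

Lemma cvg_probability0 (R : realType) (u : nat -> \bar R) : (forall n, u n \is a fin_num) -> (forall n, 0 <= u n)%E ->
  u @ \oo --> 0%E <-> forall eta : R, 0 < eta -> exists N0, forall N, (N0 <= N)%N -> (u N <= eta%:E)%E.
Proof.
move=> uf u0; split.
  move=> /fine_cvgP[_ h] eta eta0; move/cvgrPdist_le : h => /(_ eta eta0)[N0 _ H].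
  exists N0 => N NN; have := H N NN; rewrite /= sub0r normrN -(fineK (uf N)) lee_fin.
  by apply: le_trans; exact: ler_norm.
move=> h; apply/fine_cvgP; split; first by near=> n; exact: uf.
apply/cvgrPdist_le => eta /h[N0 H]; exists N0 => // N /H.
by rewrite /= sub0r normrN ger0_norm ?fine_ge0// -(fineK (uf N)) lee_fin.
Unshelve. all: end_near.
Qed.

(** Near 0, ln (1 + y) is y - y ^+ 2 / 2 up to a cubic error, which the gap (1 - k) y ^+ 2 / 2 beats
    for small y. With k = 1 / lam' this will exclude lam' > 1. *)
Lemma ln1p_cubic_bound (R : realType) (k : R) : 0 < k < 1 -> exists2 y, 0 < y & y - k * y ^+ 2 / 2 > ln (1 + y).
Proof.
move=> /andP[k0 k1]; pose E : R := expR 1.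
have E0 : 0 < E by exact: expR_gt0.
pose y := Num.min 1 ((1 - k) / (4 * (1 + E))).
have y0 : 0 < y by rewrite lt_min ltr01 divr_gt0 ?subr_gt0// mulr_gt0// addr_gt0.
have y1 : y <= 1 by rewrite ge_min lexx.
have y2 : y <= (1 - k) / (4 * (1 + E)) by rewrite ge_min lexx orbT.
exists y => //; set t := y - _.
have ky : k * y ^+ 2 <= y ^+ 2 by rewrite ler_piMl ?sqr_ge0// ltW.
have yy : y ^+ 2 <= y by rewrite expr2 ler_piMl// ltW.
have ty : t <= y by rewrite /t gerBl divr_ge0// mulr_ge0 ?sqr_ge0// ltW.
have t0 : 0 <= t by rewrite /t; lra.
rewrite -ltr_expR lnK ?posrE; last by rewrite addr_gt0.
have := expR_taylor2 t => /ler_normlP[h _].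
have h3 : `|t| ^+ 3 * expR `|t| <= y ^+ 3 * E.
  rewrite ger0_norm//; apply: ler_pM; [exact: exprn_ge0|exact: expR_ge0| |].
    by rewrite lerXn2r ?nnegrE// ltW.
  by rewrite ler_expR (le_trans ty).
have h4 : y ^+ 2 - k * y ^+ 3 <= t ^+ 2.
  have -> : t ^+ 2 = y ^+ 2 - k * y ^+ 3 + (k * y ^+ 2 / 2) ^+ 2 by rewrite /t; field.
  by rewrite lerDl sqr_ge0.
have h5 : y ^+ 3 * (4 * (1 + E)) <= y ^+ 2 * (1 - k).
  rewrite exprSr -mulrA; apply: ler_wpM2l; first exact: sqr_ge0.
  by rewrite -ler_pdivlMr// mulr_gt0// addr_gt0.
have y3 : 0 < y ^+ 3 by exact: exprn_gt0.
have ky3 : k * y ^+ 3 <= y ^+ 3 by rewrite ler_piMl// ltW.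
have yE : 0 < y ^+ 3 * E by exact: mulr_gt0.
move: h h3 h4 h5 ky3 yE; rewrite {2}/t.
have -> : y ^+ 3 * (4 * (1 + E)) = 4 * y ^+ 3 + 4 * (y ^+ 3 * E) by ring.
have -> : y ^+ 2 * (1 - k) = y ^+ 2 - k * y ^+ 2 by ring.
set e := expR t; set N3 := _ * expR _; set a := y ^+ 3 * E; set b := k * y ^+ 3; set c := k * y ^+ 2.
lra.
Qed.

(** * Reduction to a spike that is bounded everywhere *)

Section clamp.
Variables (R : realType) (P : probability (measurableTypeR R) R) (K : R).
Notation mR := (measurableTypeR R).
Hypothesis suppK : P [set x | `|x| <= K] = 1%E.

(** Almost surely the identity. It makes the spike bounded at every point, as the pointwise
    estimates on overlaps and exponents require. *)
Definition clamp (x : mR) : mR := if `|x| <= K then x else 0.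

Lemma clamp_le x : `|clamp x| <= `|K|.
Proof.
rewrite /clamp; case: ifP => [h|_]; last by rewrite normr0.
exact: le_trans (ler_norm K).
Qed.

Lemma measurable_clamp : measurable_fun setT clamp.
Proof.
have mn : measurable_fun setT (fun x : mR => `|x| : mR) by exact: (measurable_norm_comp (@measurable_id _ _ _)).
by apply: measurable_fun_ifT => //; exact: measurable_fun_ler.
Qed.

Let S := [set x : mR | `|x| <= K].

Lemma measurable_support : measurable S.
Proof.
have mn : measurable_fun setT (fun x : mR => `|x| : mR) by exact: (measurable_norm_comp (@measurable_id _ _ _)).
have := measurable_fun_ler mn (measurable_cst (K : mR)).
by move=> /(_ measurableT [set true] I); rewrite setTI.
Qed.

Lemma clampE x : S x -> clamp x = x.
Proof. by rewrite /S /clamp /= => ->. Qed.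

Lemma mass_outside_support : P (~` S) = 0%E.
Proof. by have mS := measurable_support; rewrite probability_setC// [P S]suppK subee. Qed.

Lemma integral_clamp (G : mR -> \bar R) : measurable_fun setT G ->
  (\int[P]_x G (clamp x) = \int[P]_x G x)%E.
Proof.
move=> mG; apply: ae_eq_integral => //.
- exact: (measurableT_comp mG measurable_clamp).
- exists (~` S); split; [exact: measurableC measurable_support|exact: mass_outside_support|].
  move=> x /= h Sx; apply: h => _; by rewrite clampE.
Qed.

Lemma integral_prod_clamp (G : mR * mR -> R) : measurable_fun setT G ->
  \int[(P \x @gauss R)%E]_w G (clamp w.1, w.2) = \int[(P \x @gauss R)%E]_w G w.
Proof.
move=> mG; congr fine; apply: ae_eq_integral => //.
- apply/measurable_EFinP; apply: (measurableT_comp mG); apply: measurable_fun_pair; last exact: measurable_snd.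
  exact: (measurableT_comp measurable_clamp measurable_fst).
- exact/measurable_EFinP.
- have mS := measurable_support.
  exists ((~` S) `*` setT); split.
  + by apply: measurableX => //; exact: measurableC.
  + transitivity (P (~` S) * @gauss R setT)%E; last by rewrite mass_outside_support mul0e.
    by apply: product_measure1E => //; exact: measurableC.
  + move=> [x y] /= h; split => // Sx; apply: h => _; by rewrite clampE.
Qed.

(** The inner exponent of [psi] is that of [tilt] at the output s x + z. Both the planted x and the
    integration variable are replaced by their truncations, and 0 <= s identifies s with the square
    root in [psi]. *)
Lemma psi_free_energy s : 0 <= s -> psi P (s ^+ 2) = free_energy P clamp s.
Proof.
move=> s0; have ss : Num.sqrt (s ^+ 2) = s by rewrite sqrtr_sqr ger0_norm.
rewrite /psi ss /free_energy.
have inner (x z : mR) : \int[P]_y expR (s * z * y + s ^+ 2 * y * x - s ^+ 2 / 2 * y ^+ 2) = tilt P clamp s (s * x + z).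
  rewrite /tilt; congr fine; rewrite -[LHS]integral_clamp; last by mble.
  by apply: eq_integral => y _; congr (expR _)%:E; ring.
transitivity (\int[(P \x @gauss R)%E]_w ln (tilt P clamp s (s * w.1 + w.2))).
  by apply: eq_Rintegral => w _; rewrite inner.
apply: (esym (integral_prod_clamp (G := fun w => ln (tilt P clamp s (s * w.1 + w.2))) _)).
apply: (measurableT_comp (@measurable_ln _)); apply: (measurableT_comp (measurable_tilt P measurable_clamp s)); mble.
Qed.

Lemma clamp_mean : ('E_P[(fun x : mR => x)] = 0)%E -> \int[P]_x clamp x = 0.
Proof.
rewrite unlock => h; apply: RintegralEFin.
by rewrite (integral_clamp (G := fun x => x%:E))//; exact/measurable_EFinP.
Qed.

Lemma clamp_var : ('E_P[(fun x : mR => x)] = 0)%E -> ('V_P[(fun x : mR => x)] = 1)%E -> \int[P]_x (clamp x) ^+ 2 = 1.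
Proof.
move=> h; rewrite /variance covariance.unlock h /= expectation.unlock => v.
apply: RintegralEFin; rewrite (integral_clamp (G := fun x => (x ^+ 2)%:E)); last by mble.
rewrite -[RHS]v; apply: eq_integral => x _; congr EFin.
by transitivity ((x - 0) * (x - 0)); [ring|].
Qed.

End clamp.

Section law.
Variables (R : realType) (P : probability (measurableTypeR R) R) (K : R).
Notation mR := (measurableTypeR R).
Notation gaussn := (iid (@gauss R)).
Hypothesis suppK : P [set x | `|x| <= K] = 1%E.
Let f : mR -> mR := clamp K.
Let mf : measurable_fun setT f. Proof. exact: measurable_clamp. Qed.

Lemma spiked_lawE lam N A : measurable A ->
  spiked_law P lam N A = (\int[iid P N]_y \int[gaussn #|edge N|]_W (\1_A (observation lam (y, W)))%:E)%E.
Proof.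
move=> mA.
rewrite (integral2E (iid P N) (gaussn #|edge N|) (F := fun y W => \1_A (observation lam (y, W)))); first last.
- by move=> y W; rewrite indicE.
- have mi : measurable_fun setT (\1_A : _ -> R) by exact: measurable_indic.
  have := measurableT_comp mi (@measurable_observation R lam N).
  by apply: eq_measurable_fun => -[].
have mo := @measurable_observation R lam N.
have mO : measurable (@observation R lam N @^-1` A) by rewrite -[X in measurable X]setTI; exact: mo.
transitivity ((iid P N \x gaussn #|edge N|)%E (@observation R lam N @^-1` A)); first by [].
by rewrite -[X in _ X = _]setIT -integral_indic.
Qed.

Lemma observationE lam N (y : N.-tuple mR) W :
  observation lam (map_tuple f y, W) = lin 1 1 (spike f lam y) W.
Proof.
apply: eq_from_tnth => k.
by rewrite tnth_lin !tnth_mktuple /= !tnth_map; ring.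
Qed.

Lemma spiked_law_likelihood lam N A : measurable A ->
  spiked_law P lam N A = (\int[gaussn #|edge N|]_W (likelihood P f lam W * \1_A W)%:E)%E.
Proof.
move=> mA; rewrite spiked_lawE//.
have mi : measurable_fun setT (\1_A : _ -> R) by exact: measurable_indic.
have mo : measurable_fun setT (fun z : N.-tuple mR * #|edge N|.-tuple mR => \1_A (observation lam (z.1, z.2)) : R).
  have := measurableT_comp mi (@measurable_observation R lam N).
  by apply: eq_measurable_fun => -[].
rewrite -(integral_iid_map mf (fun G mG _ => integral_clamp suppK mG)); first last.
- by move=> y; apply: integral_ge0 => W _; rewrite lee_fin indicE.
- apply: (measurable_fun_fubini_tonelli_F (fun z : N.-tuple mR * #|edge N|.-tuple mR => (\1_A (observation lam (z.1, z.2)))%:E)).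
    exact/measurable_EFinP.
  by move=> z; rewrite lee_fin indicE.
rewrite -(integral_planted_part (iid P N) (measurable_spike mf lam (N := N)) mi); last by move=> W; rewrite indicE.
by apply: eq_integral => y _; apply: eq_integral => W _; rewrite observationE.
Qed.

Lemma spiked_law0 N A : measurable A -> spiked_law P 0 N A = gaussn #|edge N| A.
Proof.
move=> mA; rewrite spiked_lawE//.
transitivity (\int[iid P N]_y (gaussn #|edge N| A))%E; last first.
  have fA : gaussn #|edge N| A \is a fin_num by exact: fin_num_measure.
  by rewrite -(fineK fA) integral_prob_cst.
apply: eq_integral => y _; rewrite -[in RHS](setIT A) -integral_indic//.
apply: eq_integral => W _; congr (\1_A _)%:E.
by apply: eq_from_tnth => k; rewrite tnth_mktuple mul0r sqrtr0 !mul0r add0r.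
Qed.

End law.

Theorem corollary5 (R : realType) (P : probability (measurableTypeR R) R)
    (bounded_supp : exists K : R, P [set x | `|x| <= K] = 1%E)
    (mean0 : ('E_P[(fun x : measurableTypeR R => x)] = 0)%E)
    (var1 : ('V_P[(fun x : measurableTypeR R => x)] = 1)%E)
    (lambda : R) (lambda_ge0 : 0 <= lambda)
    (lambda_lt : (lambda%:E < lambda_c P)%E) :
  mutually_contiguous (spiked_law P lambda) (spiked_law P 0).
Proof.
move: lambda_ge0; rewrite le_eqVlt => /orP[/eqP<-|lam0]; first by [].
have [K suppK] := bounded_supp.
have [_ [lam' [[lam'0 _] [[_ opt] _]] <-]] := ereal_sup_gt lambda_lt.
rewrite lte_fin => lamlam'.
pose f : measurableTypeR R -> measurableTypeR R := clamp K.
have mf : measurable_fun setT f by exact: measurable_clamp.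
have fK : forall x, `|f x| <= `|K| by exact: clamp_le.
have f_mean : \int[P]_x f x = 0 by exact: clamp_mean.
have f_var : \int[P]_x (f x) ^+ 2 = 1 by exact: clamp_var.
have psi0 : psi P 0 = 0.
  have -> : psi P 0 = free_energy P f 0 by rewrite -(psi_free_energy suppK (lexx 0)) expr0n.
  have tilt0 y : tilt P f 0 y = 1.
    rewrite /tilt -[RHS](Rintegral_prob_cst P); apply: eq_Rintegral => x _.
    by rewrite expr0n/= !mul0r subrr expR0.
  rewrite -[RHS](Rintegral_prob_cst (P \x @gauss R)%E); apply: eq_Rintegral => w _.
  by rewrite tilt0 ln1.
have FE s : 0 <= s -> free_energy P f s <= s ^+ 4 / (4 * lam').
  move=> s0; rewrite -psi_free_energy//.
  (* Maximality of q = 0 is tested at q = s ^+ 2 / lam': there lam' q = s ^+ 2, the penalty lam' q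
     ^+ 2 / 4 is s ^+ 4 / (4 lam'), and the potential at 0 is psi 0 = 0. *)
  have q0 : 0 <= s ^+ 2 / lam' by rewrite divr_ge0 ?sqr_ge0// ltW.
  have := opt _ q0; rewrite /rs_potential mulr0 psi0 expr0n/= mulr0 mul0r subr0.
  have -> : lam' * (s ^+ 2 / lam') = s ^+ 2 by rewrite mulrCA divff ?mulr1// gt_eqF.
  have -> : lam' * (s ^+ 2 / lam') ^+ 2 / 4 = s ^+ 4 / (4 * lam') by field; rewrite gt_eqF.
  by rewrite subr_le0.
have lam'1 : lam' <= 1.
  (* For lam' > 1 the lower bound (y - ln (1 + y)) / 2 on psi would exceed y ^+ 2 / (4 lam') at some
     small y, against FE. *)
  rewrite leNgt; apply/negP => l1.
  have k01 : 0 < lam'^-1 < 1 by rewrite invr_gt0 lam'0 invf_lt1.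
  have [y y0 hy] := ln1p_cubic_bound k01.
  have := FE (Num.sqrt y) (sqrtr_ge0 _).
  have := free_energy_ge mf fK f_mean f_var (Num.sqrt y).
  rewrite sqr_sqrtr ?(ltW y0)// (_ : 4%N = 2 * 2)%N// exprM sqr_sqrtr ?(ltW y0)//.
  move=> h1 h2; have := le_trans h1 h2; rewrite leNgt => /negP; apply.
  have -> : y ^+ 2 / (4 * lam') = (lam'^-1 * y ^+ 2 / 2) / 2 by field; rewrite gt_eqF.
  by rewrite ltr_pM2r//; move: hy; lra.
have lam1 : lambda < 1 by exact: lt_le_trans lam'1.
move=> A mA.
have c1 := cvg_probability0 (u := fun N => spiked_law P lambda N (A N)) (fun N => fin_num_measure _ _ (mA N)) (fun N => measure_ge0 _ _).
have c0 := cvg_probability0 (u := fun N => spiked_law P 0 N (A N)) (fun N => fin_num_measure _ _ (mA N)) (fun N => measure_ge0 _ _).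
split=> [/c1 h|/c0 h]; [apply/c0|apply/c1] => eta eta0.
- have [delta d0 [N0 H]] := null_le_planted mf fK lam0 f_mean f_var lam1 lamlam' FE eta0.
  have [N1 h1] := h _ d0; exists (maxn N0 N1) => N; rewrite geq_max => /andP[n0 n1].
  rewrite (spiked_law0 P (mA N)); apply: (H N n0 (A N) (mA N)).
  by rewrite -(spiked_law_likelihood suppK lambda (mA N)); exact: h1.
- have [delta d0 [N0 H]] := planted_le_null mf fK f_mean f_var lam0 lam1 lamlam' FE eta0.
  have [N1 h1] := h _ d0; exists (maxn N0 N1) => N; rewrite geq_max => /andP[n0 n1].
  rewrite (spiked_law_likelihood suppK lambda (mA N)); apply: (H N n0 (A N) (mA N)).
  by rewrite -(spiked_law0 P (mA N)); exact: h1.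
Qed.
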